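(* Let $q\in\mathbb{C}^\times$ be such that $q^2$ is a primitive $\ell$-th root of unity with $\ell\geq 3$, and let $n\geq 1$. Let $\Delta_q(1)^{\underline{\otimes} n}$ be the $n$-fold reduced tensor power of the Weyl module $\Delta_q(1)$ of $\mathrm{U}_q=\mathrm{U}_q(\mathfrak{sl}_2)$, and let $Q_n(\ell)=\mathrm{TL}_n(q)/R_n$ be the Jones algebra. Then there is an isomorphism of algebras $$\mathrm{End}_{\mathrm{U}_q}\bigl(\Delta_q(1)^{\underline{\otimes} n}\bigr)\cong Q_n(\ell).$$
   Context: $\mathrm{U}_q=\mathrm{U}_q(\mathfrak{sl}_2)$ is the quantum group over $\mathbb{C}$ at the root of unity $q$ (Lusztig's divided-power form specialised at $q$); modules are finite-dimensional of type 1. For $n\in\mathbb{Z}_{\ge 0}$, $\Delta_q(n)$ is the Weyl module of highest weight $n$ and $T_q(n)$ is the unique indecomposable tilting module with highest weight $n$; every tilting module is a direct sum of $T_q(n)$'s, and $T_q(n)\cong\Delta_q(n)$ is simple for $0\leq n\leq \ell-2$. Tensor products of tilting modules are tilting. Reduced tensor product: if $M,N$ are tilting modules and $M\otimes N\cong\bigoplus_{n\geq 0}m_nT_q(n)$, then $M\,\underline{\otimes}\,N:=\bigoplus_{n=0}^{\ell-2}m_nT_q(n)$. This operation is associative up to isomorphism (and commutative), so reduced tensor powers make sense; $\Delta_q(1)^{\underline\otimes 1}=\Delta_q(1)$. Temperley-Lieb algebra: $\mathrm{TL}_n(q)$ is the associative unital $\mathbb{C}$-algebra with generators $f_1,\dots,f_{n-1}$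 and relations $f_i^2=-(q+q^{-1})f_i$, $f_if_{i\pm1}f_i=f_i$, $f_if_j=f_jf_i$ if $|i-j|\geq 2$. The Jones-Wenzl idempotent $E_{\ell-1}$ is the unique nonzero idempotent of $\mathrm{TL}_{\ell-1}(q)$ with $f_iE_{\ell-1}=E_{\ell-1}f_i=0$ for $1\leq i\leq\ell-2$. For $n\geq \ell-1$, $R_n$ is the two-sided ideal of $\mathrm{TL}_n(q)$ generated by $E_{\ell-1}\in\mathrm{TL}_{\ell-1}(q)\subseteq \mathrm{TL}_n(q)$ (subalgebra generated by $f_1,\dots,f_{\ell-2}$); for $n<\ell-1$, $R_n=0$, so $Q_n(\ell)=\mathrm{TL}_n(q)$. *)

(* Defs.v *)
From HB Require Import structures.
From mathcomp Require Import all_boot all_order all_algebra.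
From mathcomp Require Import fraction generic_quotient mxtens finmap monalg.
From mathcomp Require Import boolp.

Set Implicit Arguments.
Unset Strict Implicit.
Unset Printing Implicit Defensive.

Import GRing.Theory.
Local Open Scope ring_scope.
Local Open Scope quotient_scope.

(* Algebras over a commutative ring, as rings with a central structure map.   *)
(* The library's algType excludes the zero ring, whereas a quotient of a      *)
(* presented algebra is not a priori nonzero.                                 *)

HB.mixin Record hasScalars (k : pzRingType) A of GRing.PzRing A := {
  scal : {rmorphism k -> A};
  scalC : forall (a : k) (x : A), scal a * x = x * scal a
}.

#[short(type="pzAlgType")]
HB.structure Definition PzAlg (k : pzRingType) :=
  {A of GRing.PzRing A & hasScalars k A}.

Notation "a %:S" := (scal a) (at level 1, format "a %:S") : ring_scope.

Definition alg_morphism (k : pzRingType) (A B : pzAlgType k)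
    (f : {rmorphism A -> B}) : Prop :=
  forall a : k, f a%:S = a%:S.

Definition alg_isomorphic (k : pzRingType) (A B : pzAlgType k) : Prop :=
  exists f : {rmorphism A -> B}, alg_morphism f /\ bijective f.

HB.instance Definition _ (k : comPzRingType) (d : nat) :=
  hasScalars.Build k 'M[k]_d (fun a x => esym (scalar_mxC a x)).

Inductive ideal2 (A : pzRingType) (S : A -> Prop) : A -> Prop :=
| ideal2_gen x of S x : ideal2 S x
| ideal2_0 : ideal2 S 0
| ideal2_add x y of ideal2 S x & ideal2 S y : ideal2 S (x + y)
| ideal2_mull a x of ideal2 S x : ideal2 S (a * x)
| ideal2_mulr a x of ideal2 S x : ideal2 S (x * a).

Section QuotientAlgebra.
Variables (k : pzRingType) (A : pzAlgType k) (S : A -> Prop).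

Lemma ideal2N x : ideal2 S x -> ideal2 S (- x).
Proof. by rewrite -mulN1r; apply: ideal2_mull. Qed.

Definition ideal2_eq (x y : A) : bool := `[< ideal2 S (x - y) >].

Lemma ideal2_eq_refl : reflexive ideal2_eq.
Proof. by move=> x; apply/asboolP; rewrite subrr; apply: ideal2_0. Qed.

Lemma ideal2_eq_sym : symmetric ideal2_eq.
Proof.
by move=> x y; apply/asboolP/asboolP => /ideal2N; rewrite opprB.
Qed.

Lemma ideal2_eq_trans : transitive ideal2_eq.
Proof.
move=> y x z /asboolP xy /asboolP yz; apply/asboolP.
by rewrite -(subrKA y); apply: ideal2_add.
Qed.

Definition ideal2_equiv :=
  EquivRel ideal2_eq ideal2_eq_refl ideal2_eq_sym ideal2_eq_trans.

Definition quot_alg := {eq_quot ideal2_equiv}.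
HB.instance Definition _ := Choice.on quot_alg.
HB.instance Definition _ := EqQuotient.on quot_alg.

Definition to_quot (x : A) : quot_alg := \pi x.

Lemma to_quotP x y : to_quot x = to_quot y <-> ideal2 S (x - y).
Proof.
split=> [/eqmodP /asboolP //|xy]; by apply/eqmodP/asboolP.
Qed.

Lemma to_quotK (u : quot_alg) : to_quot (repr u) = u.
Proof. exact: reprK. Qed.

Lemma repr_quotP x : ideal2 S (repr (to_quot x) - x).
Proof. by apply/to_quotP; rewrite to_quotK. Qed.

Let qadd (u w : quot_alg) := to_quot (repr u + repr w).
Let qopp (u : quot_alg) := to_quot (- repr u).
Let qmul (u w : quot_alg) := to_quot (repr u * repr w).

Let qaddE x y : qadd (to_quot x) (to_quot y) = to_quot (x + y).
Proof.
by apply/to_quotP; rewrite opprD addrACA; apply: ideal2_add;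
  apply: repr_quotP.
Qed.

Let qoppE x : qopp (to_quot x) = to_quot (- x).
Proof.
by apply/to_quotP; rewrite -opprD; apply: ideal2N; apply: repr_quotP.
Qed.

Let qmulE x y : qmul (to_quot x) (to_quot y) = to_quot (x * y).
Proof.
apply/to_quotP; set x' := repr _; set y' := repr _.
have -> : x' * y' - x * y = (x' - x) * y' + x * (y' - y).
  by rewrite mulrBl mulrBr subrKA.
by apply: ideal2_add; [apply: ideal2_mulr | apply: ideal2_mull];
  apply: repr_quotP.
Qed.

Let qaddA : associative qadd.
Proof.
by move=> u w z; rewrite -[u]to_quotK -[w]to_quotK -[z]to_quotK !qaddE addrA.
Qed.
Let qaddC : commutative qadd.
Proof. by move=> u w; rewrite -[u]to_quotK -[w]to_quotK !qaddE addrC. Qed.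
Let qadd0 : left_id (to_quot 0) qadd.
Proof. by move=> u; rewrite -[u]to_quotK !qaddE add0r. Qed.
Let qaddN : left_inverse (to_quot 0) qopp qadd.
Proof. by move=> u; rewrite -[u]to_quotK qoppE qaddE addNr. Qed.

HB.instance Definition _ :=
  GRing.isZmodule.Build quot_alg qaddA qaddC qadd0 qaddN.

Let qmulA : associative qmul.
Proof.
by move=> u w z; rewrite -[u]to_quotK -[w]to_quotK -[z]to_quotK !qmulE mulrA.
Qed.
Let qmul1l : left_id (to_quot 1) qmul.
Proof. by move=> u; rewrite -[u]to_quotK !qmulE mul1r. Qed.
Let qmul1r : right_id (to_quot 1) qmul.
Proof. by move=> u; rewrite -[u]to_quotK !qmulE mulr1. Qed.
Let qmulDl : left_distributive qmul qadd.
Proof.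
by move=> u w z; rewrite -[u]to_quotK -[w]to_quotK -[z]to_quotK
  !(qmulE, qaddE) mulrDl.
Qed.
Let qmulDr : right_distributive qmul qadd.
Proof.
by move=> u w z; rewrite -[u]to_quotK -[w]to_quotK -[z]to_quotK
  !(qmulE, qaddE) mulrDr.
Qed.

HB.instance Definition _ :=
  GRing.Zmodule_isPzRing.Build quot_alg qmulA qmul1l qmul1r qmulDl qmulDr.

Fact to_quot_is_zmod_morphism : zmod_morphism to_quot.
Proof. by move=> x y; rewrite -[- to_quot y]/(qopp _) qoppE -[LHS]qaddE. Qed.
Fact to_quot_is_monoid_morphism : monoid_morphism to_quot.
Proof. by split=> // x y; rewrite -[RHS]/(qmul _ _) qmulE. Qed.
HB.instance Definition _ :=
  GRing.isZmodMorphism.Build A quot_alg to_quot to_quot_is_zmod_morphism.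
HB.instance Definition _ :=
  GRing.isMonoidMorphism.Build A quot_alg to_quot to_quot_is_monoid_morphism.

Let quot_scal : {rmorphism k -> quot_alg} := to_quot \o @scal k A.
Let quot_scalC (a : k) (x : quot_alg) : quot_scal a * x = x * quot_scal a.
Proof. by rewrite -[x]to_quotK /= -!rmorphM scalC. Qed.

HB.instance Definition _ := hasScalars.Build k quot_alg quot_scalC.

End QuotientAlgebra.

Definition free_alg (k : comNzRingType) (G : choiceType) : Type :=
  {malg k[{fmonom G}]}.

Section FreeAlgebra.
Variables (k : comNzRingType) (G : choiceType).

HB.instance Definition _ := GRing.NzRing.on (free_alg k G).

Let free_scalC (a : k) (x : free_alg k G) :
  malgC a * x = x * malgC a :> free_alg k G.
Proof.
rewrite malgM_def fgmulUg [RHS]fgmulgU; apply/eq_bigr => w _.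
by rewrite mul1m mulm1 mulrC.
Qed.

HB.instance Definition _ := hasScalars.Build k (free_alg k G) free_scalC.

Definition free_gen (g : G) : free_alg k G := << fmu g >>.
End FreeAlgebra.

Section QuantumNumbers.
Variables (F : fieldType) (v : F).

(* [n]_v, for v^2 != 1; only used at the indeterminate of Q(v) *)
Definition qint (n : nat) : F := (v ^+ n - v ^- n) / (v - v^-1).

Definition qfact (n : nat) : F := \prod_(1 <= i < n.+1) qint i.

(* Gaussian binomials, balanced normalisation.  The Pascal rule
     [n+1, t+1] = v^(t+1) [n, t+1] + v^-(n-t) [n, t]
   makes sense for every nonzero v, including roots of unity. *)
Fixpoint qbin (n t : nat) : F :=
  match n, t with
  | _, 0 => 1
  | 0, _.+1 => 0
  | n'.+1, t'.+1 => v ^+ t'.+1 * qbin n' t'.+1 + v ^- (n' - t') * qbin n' t'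
  end.

(* [m, t] = \prod_(1 <= s <= t) [m + 1 - s] / [s] for m an integer; for
   negative upper index, [- (p + 1), t] = (-1)^t [p + t, t]. *)
Definition qbinz (m : int) (t : nat) : F :=
  match m with
  | Posz p => qbin p t
  | Negz p => (-1) ^+ t * qbin (p + t) t
  end.

End QuantumNumbers.

(* U_v(sl_2) over a field k, for v in k with v^2 != 1 *)
Section QuantumGroup.
Variables (k : fieldType) (v : k).

Variant Ugen := gE | gF | gK | gKi.
Definition Ugen_code (g : Ugen) : 'I_4 :=
  inord (match g with gE => 0 | gF => 1 | gK => 2 | gKi => 3 end)%N.
Definition Ugen_decode (i : 'I_4) : Ugen := nth gE [:: gE; gF; gK; gKi] i.
Fact Ugen_codeK : cancel Ugen_code Ugen_decode.
Proof. by case; rewrite /Ugen_decode inordK. Qed.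
HB.instance Definition _ := Choice.copy Ugen (can_type Ugen_codeK).

Let gen (g : Ugen) : free_alg k Ugen := free_gen k g.

Variant Uv_relator : free_alg k Ugen -> Prop :=
| Uv_KKi : Uv_relator (gen gK * gen gKi - 1)
| Uv_KiK : Uv_relator (gen gKi * gen gK - 1)
| Uv_KE : Uv_relator (gen gK * gen gE * gen gKi - (v ^+ 2)%:S * gen gE)
| Uv_KF : Uv_relator (gen gK * gen gF * gen gKi - (v ^- 2)%:S * gen gF)
| Uv_EF : Uv_relator (gen gE * gen gF - gen gF * gen gE
                      - ((v - v^-1)^-1)%:S * (gen gK - gen gKi)).

Definition Uv : pzAlgType k := quot_alg Uv_relator.

Definition vE : Uv := to_quot Uv_relator (gen gE).
Definition vF : Uv := to_quot Uv_relator (gen gF).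
Definition vK : Uv := to_quot Uv_relator (gen gK).
Definition vKi : Uv := to_quot Uv_relator (gen gKi).

Definition vEdiv (r : nat) : Uv := ((qfact v r)^-1)%:S * vE ^+ r.
Definition vFdiv (r : nat) : Uv := ((qfact v r)^-1)%:S * vF ^+ r.

(* [K; 0; t] = \prod_(1 <= s <= t)
                 (K v^(1-s) - K^-1 v^(s-1)) / (v^s - v^-s) *)
Definition vKbin (t : nat) : Uv :=
  \prod_(0 <= s < t) (((v ^+ s.+1 - v ^- s.+1)^-1)%:S
                      * ((v ^- s)%:S * vK - (v ^+ s)%:S * vKi)).

(* Lusztig's form, i.e. the Z[v, v^-1]-subalgebra of U_v generated by the
   divided powers and K, K^-1, is the subring generated by these elements and
   by v, v^-1. *)
Inductive in_UA : Uv -> Prop :=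
| UA_v : in_UA v%:S
| UA_vi : in_UA (v^-1)%:S
| UA_K : in_UA vK
| UA_Ki : in_UA vKi
| UA_E r : in_UA (vEdiv r)
| UA_F r : in_UA (vFdiv r)
| UA_1 : in_UA 1
| UA_sub x y of in_UA x & in_UA y : in_UA (x - y)
| UA_mul x y of in_UA x & in_UA y : in_UA (x * y).

Definition UA_pred : {pred Uv} := fun x => `[< in_UA x >].

Fact UA_subring_closed : subring_closed UA_pred.
Proof.
split=> [|x y /asboolP xA /asboolP yA|x y /asboolP xA /asboolP yA].
- by apply/asboolP; apply: UA_1.
- by apply/asboolP; apply: UA_sub.
- by apply/asboolP; apply: UA_mul.
Qed.

Record UA := MkUA { UA_val :> Uv; _ : UA_val \in UA_pred }.
HB.instance Definition _ := [isSub for UA_val].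
HB.instance Definition _ := [Choice of UA by <:].
HB.instance Definition _ :=
  GRing.SubChoice_isSubPzRing.Build Uv UA_pred UA UA_subring_closed.

Definition toUA (x : Uv) (xA : in_UA x) : UA := MkUA (asboolT xA).

Definition Lusv : UA := toUA UA_v.
Definition LusK : UA := toUA UA_K.
Definition LusKi : UA := toUA UA_Ki.
Definition LusE (r : nat) : UA := toUA (UA_E r).
Definition LusF (r : nat) : UA := toUA (UA_F r).

End QuantumGroup.

(* Q(v) and its indeterminate *)
Definition Qv : fieldType := {fraction {poly rat}}.
Definition vv : Qv := tofrac 'X.

(* Finite-dimensional modules over U_q = U_A (x)_A F, where A = Z[v, v^-1]    *)
(* acts on F through v |-> q.  A U_q-module structure on F^d is the same as a *)
(* ring morphism from U_A to d x d matrices, acting on column vectors, that   *)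
(* maps v to q.                                                               *)

Local Notation U_A := (UA vv).
Local Notation Lv := (Lusv vv).
Local Notation LK := (LusK vv).
Local Notation LKi := (LusKi vv).
Local Notation LE := (LusE vv).
Local Notation LF := (LusF vv).

Section Modules.
Variables (F : fieldType) (q : F).

Record Uqmod := MkUqmod {
  mdim : nat;
  mact : {rmorphism U_A -> 'M[F]_mdim};
  mact_v : mact Lv = q%:M
}.

Definition is_hom (M N : Uqmod) (f : 'M[F]_(mdim N, mdim M)) : Prop :=
  forall x : U_A, f *m mact M x = mact N x *m f.

Definition iso (M N : Uqmod) : Prop :=
  exists (f : 'M[F]_(mdim N, mdim M)) (g : 'M[F]_(mdim M, mdim N)),
    [/\ is_hom f, f *m g = 1%:M & g *m f = 1%:M].

Definition zero_act (x : U_A) : 'M[F]_0 := 0.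
Fact zero_act_is_zmod_morphism : zmod_morphism zero_act.
Proof. by move=> x y; rewrite /zero_act subr0. Qed.
Fact zero_act_is_monoid_morphism : monoid_morphism zero_act.
Proof. by split=> [|x y]; rewrite [LHS]flatmx0 [RHS]flatmx0. Qed.
HB.instance Definition _ :=
  GRing.isZmodMorphism.Build U_A 'M[F]_0 zero_act zero_act_is_zmod_morphism.
HB.instance Definition _ :=
  GRing.isMonoidMorphism.Build U_A 'M[F]_0 zero_act zero_act_is_monoid_morphism.

Definition zero_mod : Uqmod :=
  @MkUqmod 0 zero_act (etrans (flatmx0 _) (esym (flatmx0 _))).

Section DirectSum.
Variables M N : Uqmod.

Definition dsum_act (x : U_A) : 'M[F]_(mdim M + mdim N) :=
  block_mx (mact M x) 0 0 (mact N x).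

Fact dsum_act_is_zmod_morphism : zmod_morphism dsum_act.
Proof.
by move=> x y; rewrite /dsum_act opp_block_mx add_block_mx !oppr0 !addr0
  !rmorphB.
Qed.
Fact dsum_act_is_monoid_morphism : monoid_morphism dsum_act.
Proof.
split=> [|x y]; first by rewrite /dsum_act !rmorph1 -scalar_mx_block.
by rewrite /dsum_act !rmorphM -[RHS]/(_ *m _) mulmx_block !mul0mx !mulmx0
  !addr0 !add0r.
Qed.
HB.instance Definition _ := GRing.isZmodMorphism.Build U_A
  'M[F]_(mdim M + mdim N) dsum_act dsum_act_is_zmod_morphism.
HB.instance Definition _ := GRing.isMonoidMorphism.Build U_A
  'M[F]_(mdim M + mdim N) dsum_act dsum_act_is_monoid_morphism.

Fact dsum_act_v : dsum_act Lv = q%:M.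
Proof. by rewrite /dsum_act !mact_v -scalar_mx_block. Qed.

Definition dsum : Uqmod := MkUqmod dsum_act_v.
End DirectSum.

Definition dsum_iter (m : nat) (M : Uqmod) : Uqmod := iter m (dsum M) zero_mod.

(* M is, in some basis, the module on which the generators E^(r), F^(r), K of
   U_q act by the given matrices. *)
Definition realizes (M : Uqmod) (d : nat) (E Fd : nat -> 'M[F]_d) (K : 'M[F]_d)
  : Prop :=
  exists (B : 'M[F]_(mdim M, d)) (B' : 'M[F]_(d, mdim M)),
    [/\ B *m B' = 1%:M, B' *m B = 1%:M,
        forall r, mact M (LE r) *m B = B *m E r,
        forall r, mact M (LF r) *m B = B *m Fd r
      & mact M LK *m B = B *m K].

(* Weyl module of highest weight n, with basis e_0, ..., e_n:
     K e_i = q^(n - 2i) e_i,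
     E^(r) e_i = [n - i + r, r] e_(i - r)   (0 if r > i),
     F^(r) e_i = [i + r, r] e_(i + r)       (0 if i + r > n). *)
Definition WeylE (n r : nat) : 'M[F]_n.+1 :=
  \matrix_(j, i) if i == (j + r)%N :> nat then qbin q (n - i + r) r else 0.
Definition WeylF (n r : nat) : 'M[F]_n.+1 :=
  \matrix_(j, i) if j == (i + r)%N :> nat then qbin q (i + r) r else 0.
Definition WeylK (n : nat) : 'M[F]_n.+1 :=
  \matrix_(j, i) if j == i then q ^+ n * q ^- i.*2 else 0.

Definition is_Weyl (n : nat) (M : Uqmod) : Prop :=
  realizes M (WeylE n) (WeylF n) (WeylK n).

(* Dual Weyl module: the contravariant dual of the Weyl module, i.e. its dual
   space with the action twisted by the anti-automorphism that exchanges
   E^(r) and F^(r) and fixes K. *)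
Definition is_dualWeyl (n : nat) (M : Uqmod) : Prop :=
  realizes M (fun r => (WeylF n r)^T) (fun r => (WeylE n r)^T) (WeylK n)^T.

(* Tensor products, for the comultiplication
     E |-> E (x) 1 + K (x) E,  F |-> F (x) K^-1 + 1 (x) F,  K |-> K (x) K,
   for which
     E^(r) |-> sum_(a + b = r) v^(ab) E^(a) K^b (x) E^(b),
     F^(r) |-> sum_(a + b = r) v^(ab) F^(a) (x) F^(b) K^-a. *)
Definition tensE (M N : Uqmod) (r : nat) : 'M[F]_(mdim M * mdim N) :=
  \sum_(a < r.+1) q ^+ (a * (r - a)) *:
    (mact M (LE a * LK ^+ (r - a)) *t mact N (LE (r - a))).
Definition tensF (M N : Uqmod) (r : nat) : 'M[F]_(mdim M * mdim N) :=
  \sum_(a < r.+1) q ^+ (a * (r - a)) *: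
    (mact M (LF a) *t mact N (LF (r - a) * LKi ^+ a)).
Definition tensK (M N : Uqmod) : 'M[F]_(mdim M * mdim N) :=
  mact M LK *t mact N LK.

Definition is_tensor (M N T : Uqmod) : Prop :=
  realizes T (tensE M N) (tensF M N) (tensK M N).

(* Weight spaces.  At a root of unity the eigenvalue of K does not determine
   the weight; the elements [K; 0; t], which belong to U_A, are also needed. *)
Definition weight_vector (M : Uqmod) (m : int) (w : 'cV[F]_(mdim M)) : Prop :=
  mact M LK *m w = q ^ m *: w /\
  forall (t : nat) (x : U_A), UA_val x = vKbin vv t ->
    mact M x *m w = qbinz q m t *: w.

Definition type1 (M : Uqmod) : Prop :=
  forall w : 'cV[F]_(mdim M), exists (c : nat) (m : 'I_c -> int)
    (u : 'I_c -> 'cV[F]_(mdim M)),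
    (forall i, weight_vector (m i) (u i)) /\ w = \sum_i u i.

Definition highest_weight (M : Uqmod) (n : int) : Prop :=
  (exists2 w : 'cV[F]_(mdim M), weight_vector n w & w != 0) /\
  forall (m : int) (w : 'cV[F]_(mdim M)),
    weight_vector m w -> w != 0 -> (m <= n)%R.

Definition short_exact (N M Q : Uqmod) : Prop :=
  exists (f : 'M[F]_(mdim M, mdim N)) (g : 'M[F]_(mdim Q, mdim M)),
    [/\ is_hom f, is_hom g,
        forall w : 'cV_(mdim N), f *m w = 0 -> w = 0,
        forall w : 'cV_(mdim Q), exists u : 'cV_(mdim M), g *m u = w
      & forall w : 'cV_(mdim M),
          g *m w = 0 <-> exists u : 'cV_(mdim N), w = f *m u].

Inductive has_filtration (X : nat -> Uqmod -> Prop) : Uqmod -> Prop :=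
| filtration_0 M of mdim M = 0%N : has_filtration X M
| filtration_S n N M Q of has_filtration X N & short_exact N M Q & X n Q :
    has_filtration X M.

Definition tilting (M : Uqmod) : Prop :=
  [/\ type1 M, has_filtration is_Weyl M & has_filtration is_dualWeyl M].

Definition indecomposable (M : Uqmod) : Prop :=
  mdim M != 0%N /\
  forall A B : Uqmod, iso M (dsum A B) -> mdim A = 0%N \/ mdim B = 0%N.

(* M is isomorphic to T_q(n) *)
Definition is_T (n : nat) (M : Uqmod) : Prop :=
  [/\ tilting M, indecomposable M & highest_weight M n].

(* P is isomorphic to the reduced tensor product of the tilting modules M, N *)
Definition is_reduced_tensor (l : nat) (M N P : Uqmod) : Prop :=
  [/\ tilting M, tilting N &
  exists (c : nat) (T : nat -> Uqmod) (m : nat -> nat),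
  [/\ forall n, (n < c)%N -> is_T n (T n),
      is_tensor M N (\big[dsum/zero_mod]_(n < c) dsum_iter (m n) (T n))
    & iso P (\big[dsum/zero_mod]_(n < c | (n <= l - 2)%N)
               dsum_iter (m n) (T n))]].

(* P is isomorphic to the n-fold reduced tensor power of the Weyl module of
   highest weight 1 *)
Inductive is_reduced_power (l : nat) : nat -> Uqmod -> Prop :=
| reduced_power_1 P of is_Weyl 1 P : is_reduced_power l 1 P
| reduced_power_S n P D P' of is_reduced_power l n P & is_Weyl 1 D
    & is_reduced_tensor l P D P' : is_reduced_power l n.+1 P'.

Section Endomorphisms.
Variable M : Uqmod.

Definition End_pred : {pred 'M[F]_(mdim M)} :=
  fun f => `[< is_hom (M := M) (N := M) f >].

Fact End_subring_closed : subring_closed End_pred.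
Proof.
split=> [|f g /asboolP fM /asboolP gM|f g /asboolP fM /asboolP gM];
  apply/asboolP=> x.
- by rewrite mul1mx mulmx1.
- by rewrite mulmxBl mulmxBr fM gM.
- by rewrite -mulmxA gM mulmxA fM -mulmxA.
Qed.

Record End_Uq := MkEnd { End_val :> 'M[F]_(mdim M); _ : End_val \in End_pred }.
HB.instance Definition _ := [isSub for End_val].
HB.instance Definition _ := [Choice of End_Uq by <:].
HB.instance Definition _ := GRing.SubChoice_isSubPzRing.Build 'M[F]_(mdim M)
  End_pred End_Uq End_subring_closed.

Fact End_scalar_proof (a : F) : a%:M \in End_pred.
Proof. by apply/asboolP=> x; rewrite scalar_mxC. Qed.
Definition End_scalar (a : F) : End_Uq := MkEnd (End_scalar_proof a).

Fact End_scalar_is_zmod_morphism : zmod_morphism End_scalar.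
Proof. by move=> a b; apply/val_inj; rewrite /= rmorphB. Qed.
Fact End_scalar_is_monoid_morphism : monoid_morphism End_scalar.
Proof.
by split=> [|a b]; apply/val_inj; rewrite /= ?rmorph1 ?rmorphM.
Qed.
HB.instance Definition _ := GRing.isZmodMorphism.Build F End_Uq End_scalar
  End_scalar_is_zmod_morphism.
HB.instance Definition _ := GRing.isMonoidMorphism.Build F End_Uq End_scalar
  End_scalar_is_monoid_morphism.

Let End_scalC (a : F) (f : End_Uq) : End_scalar a * f = f * End_scalar a.
Proof. by apply/val_inj; rewrite !rmorphM /=; apply/esym/scalar_mxC. Qed.
HB.instance Definition _ := hasScalars.Build F End_Uq End_scalC.
End Endomorphisms.

End Modules.

Section TemperleyLieb.
Variables (F : fieldType) (q : F).

Section Presentation.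
Variable n : nat.
Let f (i : 'I_n.-1) : free_alg F 'I_n.-1 := free_gen F i.

(* Generators are indexed from 0: f i stands for f_(i+1). *)
Variant TL_relator : free_alg F 'I_n.-1 -> Prop :=
| TL_sq (i : 'I_n.-1) : TL_relator (f i * f i - (- (q + q^-1))%:S * f i)
| TL_near (i j : 'I_n.-1) of j = i.+1 :> nat \/ i = j.+1 :> nat :
    TL_relator (f i * f j * f i - f i)
| TL_far (i j : 'I_n.-1) of (i.+2 <= j \/ j.+2 <= i)%N :
    TL_relator (f i * f j - f j * f i).

Definition TL : pzAlgType F := quot_alg TL_relator.
Definition TLgen (i : 'I_n.-1) : TL := to_quot TL_relator (f i).
End Presentation.

(* E is the Jones-Wenzl idempotent of TL_m *)
Definition is_JonesWenzl (m : nat) (E : TL m) : Prop :=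
  [/\ E != 0, E * E = E & forall i, TLgen i * E = 0 /\ E * TLgen i = 0].

(* g is the canonical morphism from TL_m to TL_n, for m <= n *)
Definition is_TL_inclusion (m n : nat) (g : {rmorphism TL m -> TL n}) : Prop :=
  alg_morphism g /\
  forall (i : 'I_m.-1) (j : 'I_n.-1), i = j :> nat ->
    g (TLgen i) = TLgen j.

(* R_n is the ideal generated by the following subset of TL_n, which is
   empty for n < l - 1 and consists of E_(l-1) otherwise. *)
Definition Jones_generator (l n : nat) (x : TL n) : Prop :=
  (l.-1 <= n)%N /\
  exists (g : {rmorphism TL l.-1 -> TL n}) (E : TL l.-1),
    [/\ is_TL_inclusion g, is_JonesWenzl E & x = g E].

Definition Jones (l n : nat) : pzAlgType F :=
  quot_alg (Jones_generator l (n := n)).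

End TemperleyLieb.

(* Main.v *)
(* Both algebras are identified with the algebra of matrices indexed by the
   paths of length [n], starting at [0], on the graph with vertices
   [0, ..., l - 2] and edges [{k, k + 1}], in which the entry at [(s, t)] is
   nonzero only when [s] and [t] have the same end point.

   On the Jones side, the Temperley-Lieb generators act on paths by the
   classical formulas with weights [[b + 1] / [w + 1]]; the Jones-Wenzl
   idempotent acts by 0 because every long path descends somewhere.  The matrix
   units are obtained from the generators by induction on [n], and faithfulness
   follows from [Q_(n+1) = F + Q_n f_n Q_n] together with the fact that
   [1] belongs to the ideal of the [f_i] as soon as the idempotent is killed.

   On the module side, [W k (x) W 1 = W (k + 1) + W (k - 1)] for the Weyl
   modules with [k <= l - 2], so a reduced tensor power is the sum of the Weyl
   modules [W (end of s)] over the paths [s], and Schur's lemma gives the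
   endomorphisms.  No classification of tilting modules is needed: all the
   summands that occur are retracts of sums of [W k] with [k < l].  To identify
   the label of such a summand from its highest weight, [[K; 0; t]] must belong
   to the integral form, which follows from the formula for [E^(p) F^(r)]. *)

Require Import Defs.
From HB Require Import structures.
From mathcomp Require Import all_boot all_order all_algebra.
From mathcomp Require Import fraction mxtens finmap monalg.
From mathcomp Require Import xfinmap boolp ring zify.

Set Implicit Arguments.
Unset Strict Implicit.
Unset Printing Implicit Defensive.

Import GRing.Theory BigEnoughFSet.
Local Open Scope ring_scope.

(** * Presented algebras *)

(** Both truncations rest on [[l] = 0]. On paths, it makes the weight towards the missing vertex
    [l - 1] vanish, so the relations survive on the finite graph. On modules, [[k + 1] != 0] for
    [k <= l - 2] splits [W k (x) W 1], and [W (l - 1)] is the only summand ever discarded. A reduced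
    tensor product is defined through an arbitrary decomposition into indecomposable tilting
    modules, so its summands must be recognised and the truncation shown to be independent of the
    decomposition. Both come down to Schur's lemma: there are no nonzero morphisms between [W j] and
    [W k] for distinct [j, k < l]. No presentation of [U_A] is at hand, so a module over it cannot
    be given by matrices for generators. Weyl modules are built over the generic algebra on Q(v),
    where the relations can be checked, and their matrix entries are evaluated at [q]. Morphisms, on
    the other hand, are tested on generators alone, so sums, retracts and tensor products can be
    handled as bare families of matrices. The path weights are not symmetrised: this avoids square
    roots of quantum integers and keeps the argument valid over any field. *)

Section FreeAlgebraUniversal.
Variables (k : comNzRingType) (G : choiceType) (A : pzAlgType k) (h : G -> A).

Let word (w : {fmonom G}) : A := \prod_(g <- (w : seq G)) h g.

Definition free_ext (x : free_alg k G) : A :=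
  \sum_(w <- msupp x) (x@_w)%:S * word w.

(** Terms outside the support vanish. The freedom in [d] lets several elements be summed over one
    index set, which additivity requires. *)
Lemma free_ext_fset (d : {fset {fmonom G}}) (x : free_alg k G) :
  (msupp x `<=` d)%fset -> free_ext x = \sum_(w <- d) (x@_w)%:S * word w.
Proof.
move=> le; rewrite [LHS](big_fset_incl _ le) => //= w wd /mcoeff_outdom ->.
by rewrite raddf0 mul0r.
Qed.

Fact free_ext_is_zmod_morphism : zmod_morphism free_ext.
Proof.
move=> x y /=; pose_big_fset {fmonom G} E; rewrite 3?(free_ext_fset (d := E)) //.
  by rewrite -sumrB; apply/eq_bigr=> w _; rewrite mcoeffB raddfB /= mulrBl.
by close.
Qed.

HB.instance Definition _ := GRing.isZmodMorphism.Build (free_alg k G) A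
  free_ext free_ext_is_zmod_morphism.

Lemma free_extU c w : free_ext << c *g w >> = c%:S * word w.
Proof.
by rewrite (free_ext_fset (d := [fset w]%fset)) ?msuppU_le // big_seq_fset1 mcoeffUU.
Qed.

Fact free_ext_is_monoid_morphism : monoid_morphism free_ext.
Proof.
split=> [|x y].
  by rewrite free_extU rmorph1 mul1r /word fm1 big_nil.
rewrite malgME raddf_sum mulr_suml /=; apply: eq_bigr=> i _.
rewrite raddf_sum mulr_sumr /=; apply: eq_bigr=> j _.
rewrite free_extU rmorphM /word fmM big_cat /= -/(word i) -/(word j).
by rewrite -!mulrA; congr (_ * _); rewrite !mulrA scalC.
Qed.

HB.instance Definition _ := GRing.isMonoidMorphism.Build (free_alg k G) A
  free_ext free_ext_is_monoid_morphism.

Lemma free_ext_gen g : free_ext (free_gen k g) = h g.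
Proof. by rewrite free_extU rmorph1 mul1r /word fmU big_seq1. Qed.

Lemma free_ext_scal a : free_ext a%:S = a%:S.
Proof. by rewrite free_extU /word fm1 big_nil mulr1. Qed.

Let free_extB x y : free_ext (x - y) = free_ext x - free_ext y.
Proof. exact: rmorphB. Qed.

Let free_extM x y : free_ext (x * y) = free_ext x * free_ext y.
Proof. exact: rmorphM. Qed.

(** One lemma for each shape of relator: this one, [free_ext_near] and [free_ext_far] serve the
    Temperley-Lieb algebra, the other three serve [Uv]. *)
Lemma free_ext_sq g a :
  free_ext (free_gen k g * free_gen k g - a%:S * free_gen k g)
    = h g * h g - a%:S * h g.
Proof.
rewrite free_extB; congr (_ - _); apply: etrans (free_extM _ _) _.
  by rewrite free_ext_gen.
by rewrite free_ext_scal free_ext_gen.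
Qed.

Lemma free_ext_inv g g' :
  free_ext (free_gen k g * free_gen k g' - 1) = h g * h g' - 1.
Proof.
rewrite free_extB; congr (_ - _); last exact: rmorph1.
by apply: etrans (free_extM _ _) _; rewrite !free_ext_gen.
Qed.

Lemma free_ext_conj g g' g'' a :
  free_ext (free_gen k g * free_gen k g' * free_gen k g'' - a%:S * free_gen k g')
    = h g * h g' * h g'' - a%:S * h g'.
Proof.
rewrite free_extB; congr (_ - _); apply: etrans (free_extM _ _) _; last first.
  by rewrite free_ext_scal free_ext_gen.
rewrite free_ext_gen; congr (_ * _).
by apply: etrans (free_extM _ _) _; rewrite !free_ext_gen.
Qed.

Lemma free_ext_bracket g g' g1 g2 a :
  free_ext (free_gen k g * free_gen k g' - free_gen k g' * free_gen k g
      - a%:S * (free_gen k g1 - free_gen k g2))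
    = h g * h g' - h g' * h g - a%:S * (h g1 - h g2).
Proof.
rewrite free_extB; congr (_ - _).
  by rewrite free_extB; congr (_ - _); apply: etrans (free_extM _ _) _; rewrite !free_ext_gen.
by apply: etrans (free_extM _ _) _; rewrite free_ext_scal free_extB !free_ext_gen.
Qed.

Lemma free_ext_near g g' :
  free_ext (free_gen k g * free_gen k g' * free_gen k g - free_gen k g)
    = h g * h g' * h g - h g.
Proof.
rewrite free_extB free_ext_gen; congr (_ - _); apply: etrans (free_extM _ _) _.
by rewrite free_ext_gen; congr (_ * _); apply: etrans (free_extM _ _) _; rewrite !free_ext_gen.
Qed.

Lemma free_ext_far g g' :
  free_ext (free_gen k g * free_gen k g' - free_gen k g' * free_gen k g)
    = h g * h g' - h g' * h g.
Proof.
by rewrite free_extB; congr (_ - _); apply: etrans (free_extM _ _) _; rewrite !free_ext_gen.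
Qed.
End FreeAlgebraUniversal.

(** Every monomial arises from 1 by prepending letters, so left multiplication by generators is
    enough. *)
Lemma free_alg_ind (k : comNzRingType) (G : choiceType)
    (P : free_alg k G -> Prop) :
  P 1 -> (forall x y, P x -> P y -> P (x + y)) ->
  (forall a x, P x -> P (a%:S * x)) ->
  (forall g x, P x -> P (free_gen k g * x)) -> forall x, P x.
Proof.
move=> P1 PD PZ Pg x; have P0 : P 0 by have := PZ 0 1 P1; rewrite rmorph0 mul0r.
rewrite (monalgE x); elim/big_ind: _ => // w _.
suff Pw : P << w >>.
  have := PZ x@_w << w >> Pw.
  rewrite -[_%:S]/(malgC _) malgM_def fgmulUU mul1m mulr1.
  exact.
case: w => w; elim: w => [|g w IHw].
  suff -> : << FMonom [::] >> = 1 :> free_alg k G by [].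
  have -> : FMonom [::] = mone :> {fmonom G} by apply/val_inj; rewrite /= fm1.
  by [].
suff -> : << FMonom (g :: w) >> = free_gen k g * << FMonom w >> :> free_alg k G.
  exact: Pg.
rewrite malgM_def fgmulUU mulr1; congr << _ *g _ >>.
by apply/val_inj; rewrite /= fmM fmU.
Qed.

Section QuotientUniversal.
Variables (k : pzRingType) (A B : pzAlgType k) (S : A -> Prop).

(** Evaluation on a chosen representative; it is independent of the choice once [f] kills [S], see
    [quot_extE]. *)
Definition quot_ext (f : {rmorphism A -> B}) (u : quot_alg S) : B := f (repr u).

Section Descent.
Variable f : {rmorphism A -> B}.
Hypothesis fS : forall x, S x -> f x = 0.

Lemma ideal2_ker x : ideal2 S x -> f x = 0.
Proof.
elim=> [y /fS //| |y z _ fy _ fz|a y _ fy|a y _ fy]; rewrite ?rmorph0 //.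
- by rewrite rmorphD fy fz addr0.
- by rewrite rmorphM fy mulr0.
- by rewrite rmorphM fy mul0r.
Qed.

Lemma quot_extE x : quot_ext f (to_quot S x) = f x.
Proof.
by apply/eqP; rewrite -subr_eq0 -rmorphB; apply/eqP/ideal2_ker/repr_quotP.
Qed.

Lemma quot_extP : exists g : {rmorphism quot_alg S -> B},
  forall x, g (to_quot S x) = f x.
Proof.
have gB : zmod_morphism (quot_ext f).
  by move=> u w; rewrite -[u]to_quotK -[w]to_quotK -raddfB !quot_extE raddfB.
have gM : monoid_morphism (quot_ext f).
  split=> [|u w]; first by rewrite -[1]/(to_quot S 1) quot_extE rmorph1.
  by rewrite -[u]to_quotK -[w]to_quotK -rmorphM !quot_extE rmorphM.
pose m1 := GRing.isZmodMorphism.Build _ _ (quot_ext f) gB.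
pose m2 := GRing.isMonoidMorphism.Build _ _ (quot_ext f) gM.
pose g : {rmorphism quot_alg S -> B} := HB.pack (quot_ext f) m1 m2.
by exists g => x; apply: quot_extE.
Qed.
End Descent.

End QuotientUniversal.

Lemma presented_ext (k : comNzRingType) (G : choiceType)
    (S : free_alg k G -> Prop) (A : pzAlgType k) (h : G -> A) :
  (forall x, S x -> free_ext h x = 0) ->
  exists f : {rmorphism quot_alg S -> A},
    alg_morphism f /\ forall g, f (to_quot S (free_gen k g)) = h g.
Proof.
move=> hS; have [f fE] := quot_extP (f := free_ext h) hS.
exists f; split=> [a|g]; last by rewrite fE /= free_ext_gen.
by rewrite -[a%:S]/(to_quot S a%:S) fE /= free_ext_scal.
Qed.

Lemma presented_ind (k : comNzRingType) (G : choiceType)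
    (S : free_alg k G -> Prop) (P : quot_alg S -> Prop) :
  P 1 -> (forall x y, P x -> P y -> P (x + y)) ->
  (forall a x, P x -> P (a%:S * x)) ->
  (forall g x, P x -> P (to_quot S (free_gen k g) * x)) -> forall x, P x.
Proof.
move=> P1 PD PZ Pg u; rewrite -[u]to_quotK; elim/free_alg_ind: (repr u).
- exact: P1.
- by move=> x y Px Py; rewrite rmorphD; apply: PD.
- by move=> a x Px; rewrite rmorphM; apply: PZ.
- by move=> g x Px; rewrite rmorphM; apply: Pg.
Qed.

(** * Quantum integers and binomials *)

Section QuantumIntegers.
Variables (F : fieldType) (v : F).
Hypotheses (v0 : v != 0) (vv1 : v - v^-1 != 0).

Lemma qint0 : qint v 0 = 0.
Proof. by rewrite /qint expr0 invr1 subrr mul0r. Qed.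

Lemma qint1 : qint v 1 = 1.
Proof. by rewrite /qint !expr1 divff. Qed.

Lemma qint_def n : v ^+ n - v ^- n = qint v n * (v - v^-1).
Proof. by rewrite /qint divfK. Qed.

Lemma qintD a b : qint v (a + b) = v ^+ b * qint v a + v ^- a * qint v b.
Proof.
rewrite /qint exprD; have va : v ^+ a != 0 by rewrite expf_neq0.
have vb : v ^+ b != 0 by rewrite expf_neq0.
by rewrite /qint !mulrA -mulrDl; congr (_ / _); field; rewrite va vb.
Qed.

Lemma qintDV a b : qint v (a + b) = v ^- b * qint v a + v ^+ a * qint v b.
Proof. by rewrite addnC qintD addrC. Qed.

Lemma qintSS n : qint v n.+2 = (v + v^-1) * qint v n.+1 - qint v n.
Proof.
have vn : v ^+ n != 0 by rewrite expf_neq0.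
rewrite -[n.+2]addn1 qintD -[n.+1]addn1 qintD qint1 !expr1 exprD expr1.
by field; rewrite vn.
Qed.

Lemma qbin0 n : qbin v n 0 = 1. Proof. by case: n. Qed.

Lemma qbinS n t :
  qbin v n.+1 t.+1 = v ^+ t.+1 * qbin v n t.+1 + v ^- (n - t) * qbin v n t.
Proof. by []. Qed.

Lemma qbin_small n t : (n < t)%N -> qbin v n t = 0.
Proof.
elim: n t => [|n IHn] [|t] //; rewrite ltnS => lt_nt.
by rewrite qbinS !IHn ?(ltnW lt_nt) // ?mulr0 ?addr0 // ltnW.
Qed.

Lemma qbinn n : qbin v n n = 1.
Proof.
by elim: n => // n IHn; rewrite qbinS IHn qbin_small // subnn mulr0 add0r invr1 mul1r.
Qed.

(** Stated as an identity of products, since quantum integers may vanish at a root of unity. In the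
    induction, the claim for [n] and the Pascal rule first give absorption at [n + 1], from which
    the claim at [n + 1] follows. *)
Lemma qbin_absorb_sub n t : qint v t.+1 * qbin v n t.+1 = qint v (n - t) * qbin v n t.
Proof.
elim: n t => [|n IHn] t; first by rewrite sub0n qint0 mulr0 mul0r.
have [le_nt|lt_tn] := leqP n.+1 t.
  by rewrite qbin_small ?ltnS // (eqP (_ : n.+1 - t == 0)%N) ?qint0 ?mulr0 ?mul0r.
have absorb s : (s <= n)%N -> qint v s.+1 * qbin v n.+1 s.+1 = qint v n.+1 * qbin v n s.
  move=> le_sn; rewrite qbinS mulrDr mulrCA IHn.
  have -> : n.+1 = (n - s + s.+1)%N by lia.
  by rewrite qintD; ring.
case: t => [|t] in lt_tn *; first by rewrite absorb // subn0 !qbin0.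
have absorb' : qint v (n - t) * qbin v n.+1 t.+1 = qint v n.+1 * qbin v n t.+1.
  rewrite qbinS mulrDr [_ * (v ^- _ * _)]mulrCA -IHn.
  have -> : n.+1 = (n - t + t.+1)%N by lia.
  by rewrite qintD; ring.
have [le_t1n|] := leqP t.+1 n; first by rewrite absorb // subSS absorb'.
by move=> lt_nt; rewrite (_ : n = t) ?qbin_small ?subnn ?qint0 ?mulr0 ?mul0r //; lia.
Qed.

Lemma qbin_absorb n t : qint v t.+1 * qbin v n.+1 t.+1 = qint v n.+1 * qbin v n t.
Proof.
have [le_tn|lt_nt] := leqP t n; last by rewrite !qbin_small ?mulr0.
rewrite qbinS mulrDr mulrCA qbin_absorb_sub.
have -> : n.+1 = (n - t + t.+1)%N by lia.
by rewrite qintD; ring.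
Qed.

Lemma qbin_absorb_top n t : (t <= n)%N ->
  qint v (n.+1 - t) * qbin v n.+1 t = qint v n.+1 * qbin v n t.
Proof. by move=> le_tn; rewrite -qbin_absorb_sub qbin_absorb. Qed.

(** The Pascal rule with [v] and [v^-1] exchanged. The two right-hand sides differ by [v - v^-1]
    times the identity [qbin_absorb_sub]. *)
Lemma qbinSV n t :
  qbin v n.+1 t.+1 = v ^- t.+1 * qbin v n t.+1 + v ^+ (n - t) * qbin v n t.
Proof.
have E := congr1 ( *%R^~ (v - v^-1)) (qbin_absorb_sub n t).
move: E; rewrite -!mulrA ![_ * (v - _)]mulrC !mulrA -!qint_def => E.
rewrite qbinS; apply/eqP; rewrite -subr_eq0; apply/eqP.
transitivity ((v ^+ t.+1 - v ^- t.+1) * qbin v n t.+1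
  - (v ^+ (n - t) - v ^- (n - t)) * qbin v n t); first by ring.
by rewrite E subrr.
Qed.

Lemma qbin1 n : qbin v n 1 = qint v n.
Proof.
case: n => [|n]; first by rewrite qint0.
by have := qbin_absorb n 0; rewrite qint1 mul1r qbin0 mulr1.
Qed.

End QuantumIntegers.

Section RootOfUnity.
Variables (F : fieldType) (q : F) (l : nat).
Hypotheses (q0 : q != 0) (hl : (3 <= l)%N) (hql : l.-primitive_root (q ^+ 2)).

Lemma q_subV_neq0 : q - q^-1 != 0.
Proof.
apply/eqP => /subr0_eq E; have : (q ^+ 2) ^+ 1 == 1.
  by rewrite expr1 expr2 {2}E divff.
by rewrite -(prim_order_dvd hql) dvdn1; case: (l) hl => [|[]].
Qed.
Let qq1 := q_subV_neq0.

(** [[m]] vanishes exactly when [q ^ (2 m) = 1]. *)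
Lemma qint_eq0 m : (qint q m == 0) = (l %| m)%N.
Proof.
rewrite (prim_order_dvd hql) /qint mulf_eq0 invr_eq0 (negPf qq1) orbF subr_eq0.
have qm : q ^+ m != 0 by rewrite expf_neq0.
by rewrite -exprM mulnC exprM expr2 -(inj_eq (mulIf qm)) mulVf.
Qed.

Lemma qint_neq0 m : (0 < m < l)%N -> qint q m != 0.
Proof.
case/andP=> m0 ml; rewrite qint_eq0; apply/negP=> /(dvdn_leq m0).
by rewrite leqNgt ml.
Qed.

Lemma qint_ell : qint q l = 0.
Proof. by apply/eqP; rewrite qint_eq0. Qed.

Lemma q_expr_inj a b : (a < l)%N -> (b < l)%N -> q ^+ a = q ^+ b -> a = b.
Proof.
move=> al bl E; have /eqP : (q ^+ 2) ^+ a = (q ^+ 2) ^+ b by rewrite exprAC E exprAC.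
by rewrite (eq_prim_root_expr hql) !modn_small // => /eqP.
Qed.

Lemma qbin_neq0 n t : (t <= n < l)%N -> qbin q n t != 0.
Proof.
elim: n t => [|n IHn] [|t] //; rewrite ?qbin0 ?oner_neq0 // ltnS => /andP[tn nl].
have := qbin_absorb q0 qq1 n t => /eqP.
apply: contraTneq => ->; rewrite mulr0 eq_sym mulf_neq0 ?qint_neq0 ?IHn ?tn //.
exact: ltnW.
Qed.

(* A weight -(p + 1) with p < l never looks like a weight >= 0. *)
Lemma qbin_periodic_neq0 p s : (p < l)%N -> qbin q (p + l * s) (l * s) != 0.
Proof.
elim: p => [|p IHp] pl; first by rewrite qbinn oner_neq0.
(* Absorption relates the values at [p] and [p + 1] through the factor [[p + 1 + l s]], nonzero
   because [l] does not divide [p + 1]. *)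
have := qbin_absorb_top q0 qq1 (leq_addl p (l * s)).
rewrite -addSn addnK => /eqP; apply: contraTneq => ->.
rewrite mulr0 eq_sym mulf_neq0 ?IHp ?(ltnW pl) //.
rewrite qint_eq0 dvdn_addl ?dvdn_mulr //; apply/negP=> /(dvdn_leq (ltn0Sn p)).
by rewrite leqNgt pl.
Qed.

End RootOfUnity.

(** * The path representation of the Temperley-Lieb algebra *)

Section Paths.
Variable l : nat.

Definition nbrs (k : nat) : seq nat :=
  [seq a <- k.+1 :: (if k is k'.+1 then [:: k'] else [::]) | (a.+1 < l)%N].

Lemma mem_nbrs k a : (a \in nbrs k) = (a.+1 < l)%N && ((a == k.+1) || (k == a.+1)).
Proof.
by rewrite mem_filter inE; case: k => [|k]; rewrite ?inE // eqSS [k == a]eq_sym.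
Qed.

Lemma nbrs_uniq k : uniq (nbrs k).
Proof. by rewrite filter_uniq //; case: k => //= k; rewrite inE andbT; lia. Qed.

(* Paths are listed from their end point back to their starting point [0]. *)
Fixpoint paths (n : nat) : seq (seq nat) :=
  if n is n'.+1 then [seq a :: s | s <- paths n', a <- nbrs (head 0%N s)]
  else [:: [:: 0%N]].

Fixpoint valid_path (s : seq nat) : bool :=
  match s with
  | [::] => false
  | [:: k] => k == 0%N
  | k :: s' => (k \in nbrs (head 0%N s')) && valid_path s'
  end.

Lemma paths_nil n : ([::] \in paths n) = false.
Proof. by case: n => //= n; apply/negP=> /allpairsPdep[s [a []]]. Qed.

Lemma mem_pathsS n k s :
  (k :: s \in paths n.+1) = (s \in paths n) && (k \in nbrs (head 0%N s)).
Proof.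
apply/allpairsPdep/andP => [[s' [a [ps' ka [-> ->]]]] //|[ps ks]].
by exists s, k.
Qed.

Lemma mem_paths n s : (s \in paths n) = (size s == n.+1) && valid_path s.
Proof.
elim: n s => [|n IHn] [|k s]; rewrite ?paths_nil //.
  by case: s => [|a s]; rewrite ?inE //= !eqseq_cons ?andbT // andbF.
rewrite mem_pathsS IHn eqSS; case: s => //= a s.
by rewrite -andbA; congr (_ && _); rewrite andbC.
Qed.

Lemma paths_uniq n : uniq (paths n).
Proof.
elim: n => // n IHn; rewrite allpairs_uniq_dep // => [s _|]; first exact: nbrs_uniq.
by move=> [s a] [t b] _ _ /= [-> ->].
Qed.

(** The steps listed before [x] involve nothing beyond [x], so the part of the path leading to [x]
    can be exchanged. *)
Lemma valid_path_change r x y y' :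
  valid_path (r ++ x :: y) -> valid_path (x :: y') -> valid_path (r ++ x :: y').
Proof.
elim: r => //= a r IHr; case: r IHr => [|b r] IHr /=.
  by case/andP => ax _ vx; rewrite ax.
by case/andP=> -> vr vx; apply: IHr.
Qed.

Lemma big_pathsS (V : nmodType) n (g : seq nat -> V) :
  \sum_(t <- paths n.+1) g t
    = \sum_(s <- paths n) \sum_(a <- nbrs (head 0%N s)) g (a :: s).
Proof. by rewrite big_allpairs_dep. Qed.

Fixpoint straight (n : nat) : seq nat :=
  if n is n'.+1 then n'.+1 :: straight n' else [:: 0%N].

Lemma head_straight n : head 0%N (straight n) = n. Proof. by case: n. Qed.

Lemma size_straight n : size (straight n) = n.+1.
Proof. by elim: n => //= n ->. Qed.

Lemma straight_paths n : (n.+1 < l)%N -> straight n \in paths n.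
Proof.
elim: n => // n IHn nl; rewrite mem_pathsS IHn ?(ltnW nl) //.
by rewrite head_straight mem_nbrs nl eqxx.
Qed.

Lemma head_path n s : s \in paths n ->
  [/\ (head 0 s <= n)%N, ~~ odd (n - head 0 s)%N & (1 < l -> (head 0 s).+1 < l)%N].
Proof.
elim: n s => [|n IHn] [|k s]; rewrite ?paths_nil //.
  by rewrite inE => /eqP[-> _].
rewrite mem_pathsS mem_nbrs /= => /andP[/IHn[]]; set h := head _ _.
by move=> hn on lh /andP[kl /orP[]/eqP E]; split=> //; lia.
Qed.

Lemma head_path_max n s : s \in paths n -> head 0%N s = n -> s = straight n.
Proof.
elim: n s => [|n IHn] [|k s]; rewrite ?paths_nil //; first by rewrite inE => /eqP.
rewrite mem_pathsS mem_nbrs /= => /andP[ps /andP[_ kh]] k_n.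
rewrite k_n -(IHn s) //; have [hs _ _] := head_path ps.
by case/orP: kh => /eqP; lia.
Qed.

Lemma straight_notin n : (1 < l)%N -> (l.-1 <= n)%N -> straight n \notin paths n.
Proof.
move=> l1 ln; apply/negP=> /head_path[_ _ /(_ l1)]; rewrite head_straight.
lia.
Qed.

(** Go straight to [k], then oscillate between [k] and one of its neighbours, which exists because
    [l >= 3], until the length is [n]. *)
Lemma path_to n k : (3 <= l)%N -> (k <= n)%N -> ~~ odd (n - k) -> (k.+1 < l)%N ->
  exists2 w, w \in paths n & head 0%N w = k.
Proof.
move=> l3 kn; rewrite -{-1}(subnK kn); move: (n - k)%N => d {n kn}.
have [m] := ubnP d; elim: m d => // m IHm [|[|d]] dm od kl //.
  by exists (straight k); rewrite ?head_straight // straight_paths.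
have [||w pw hw] := IHm d _ _ kl; [lia | by rewrite /= negbK in od|].
have [a ak] : exists a, a \in nbrs k.
  case: k {IHm pw hw} kl => [|k] kl; first by exists 1%N; rewrite mem_nbrs l3 eqxx.
  by exists k; rewrite mem_nbrs (ltnW kl) eqxx orbT.
exists (k :: a :: w) => //; rewrite !addSn !mem_pathsS pw hw ak /=.
by move: ak; rewrite !mem_nbrs => /andP[_ /orP[]/eqP E]; rewrite kl E eqxx ?orbT.
Qed.

(** [j] is reached by the first downward step, and [r] lists what comes after it. A path without
    such a step is [straight n], which leaves the graph. *)
Lemma path_first_descent n s : (3 <= l)%N -> (l.-1 <= n)%N -> s \in paths n ->
  exists r j, s = r ++ j :: straight j.+1 /\ (j.+2 < l)%N.
Proof.
move=> l3 ln ps.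
suff [E|//] : s = straight n \/ exists r j, s = r ++ j :: straight j.+1 /\ (j.+2 < l)%N.
  by move: ps (straight_notin (ltnW l3) ln); rewrite E => ->.
elim: n s {ln} ps => [|n IHn] [|k s]; rewrite ?paths_nil //.
  by rewrite inE => /eqP; left.
rewrite mem_pathsS => /andP[ps ks]; have [Es | [r [j [-> jl]]]] := IHn _ ps.
  move: ks ps; rewrite {}Es => + ps; rewrite head_straight mem_nbrs => /andP[kl /orP[/eqP->|/eqP En]].
    by left.
  have [_ _ /(_ (ltnW l3))] := head_path ps; rewrite head_straight En => kl2.
  by right; exists [::], k.
by right; exists (k :: r), j.
Qed.
End Paths.

Lemma big_delta (F : pzRingType) (T : eqType) (s : seq T) (x : T) (g : T -> F) :
  uniq s -> x \in s -> \sum_(y <- s) (x == y)%:R * g y = g x.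
Proof.
move=> us xs; rewrite (bigD1_seq x) //= eqxx mul1r big1 ?addr0 // => y yx.
by rewrite eq_sym (negPf yx) mul0r.
Qed.

Lemma big_if_eq (F : pzRingType) (T : eqType) (s : seq T) (x : T) (c g : T -> F) :
  uniq s -> x \in s ->
  \sum_(y <- s) c y * (if x == y then g y else 0) = c x * g x.
Proof.
move=> us xs; rewrite -(big_delta (fun y => c y * g y) us xs).
by apply: eq_bigr => y _; case: eqP; rewrite ?mul1r ?mulr0 ?mul0r.
Qed.

Section PathMatrices.
Variables (F : fieldType) (l n : nat).
Local Notation paths := (paths l n).
Local Notation N := (size paths).

Definition pmat (c : seq nat -> seq nat -> F) : 'M[F]_N :=
  \matrix_(i, j) c (nth [::] paths i) (nth [::] paths j).

(** Addressing entries by paths hides the enumeration. Outside [paths] the value is 0 by default,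
    hence the membership hypotheses below. *)
Definition ent (M : 'M[F]_N) (s t : seq nat) : F :=
  oapp (fun i => oapp (fun j => M i j) 0 (insub (index t paths))) 0
    (insub (index s paths)).

Lemma ent_nth M (i j : 'I_N) : ent M (nth [::] paths i) (nth [::] paths j) = M i j.
Proof.
by rewrite /ent !index_uniq ?paths_uniq // !valK.
Qed.

Lemma pathsP s : s \in paths -> exists i : 'I_N, s = nth [::] paths i.
Proof.
by move=> ps; exists (Ordinal (introT idP (etrans (index_mem s paths) ps))); rewrite /= nth_index.
Qed.

Lemma ent_pmat c s t : s \in paths -> t \in paths -> ent (pmat c) s t = c s t.
Proof.
by move=> /pathsP[i ->] /pathsP[j ->]; rewrite ent_nth mxE.
Qed.

Lemma entP M M' :
  (forall s t, s \in paths -> t \in paths -> ent M s t = ent M' s t) -> M = M'.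
Proof.
move=> E; apply/matrixP=> i j; rewrite -!ent_nth.
by apply: E; apply: mem_nth.
Qed.

Lemma entM M M' s t : s \in paths -> t \in paths ->
  ent (M *m M') s t = \sum_(u <- paths) ent M s u * ent M' u t.
Proof.
move=> /pathsP[i ->] /pathsP[j ->]; rewrite ent_nth mxE.
rewrite (big_nth [::]) big_mkord; apply: eq_bigr => k _.
by rewrite !ent_nth.
Qed.

Lemma entD M M' s t : ent (M + M') s t = ent M s t + ent M' s t.
Proof.
rewrite /ent; case: (insub (index s _)) => [i|] /=; rewrite ?addr0 //.
by case: (insub (index t _)) => [j|] /=; rewrite ?mxE ?addr0.
Qed.

Lemma entZ a M s t : ent (a *: M) s t = a * ent M s t.
Proof.
rewrite /ent; case: (insub (index s _)) => [i|] /=; rewrite ?mulr0 //.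
by case: (insub (index t _)) => [j|] /=; rewrite ?mxE ?mulr0.
Qed.

Lemma ent0 s t : ent 0 s t = 0.
Proof. by rewrite -(scale0r (0 : 'M_N)) entZ mul0r. Qed.

Lemma ent1 s t : s \in paths -> t \in paths -> ent 1%:M s t = (s == t)%:R.
Proof.
move=> /pathsP[i ->] /pathsP[j ->].
by rewrite ent_nth mxE nth_uniq ?paths_uniq.
Qed.
End PathMatrices.

Section PathOperators.
Variables (F : fieldType) (q : F) (l : nat).
Hypotheses (q0 : q != 0) (hl : (3 <= l)%N) (hql : l.-primitive_root (q ^+ 2)).
Local Notation paths := (paths l).
Local Notation nbrs := (nbrs l).
Let qq1 := q_subV_neq0 q0 hl hql.

(** The sign produces the loop value [-(q + q^-1)]. The relations use two facts: the sum over the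
    neighbours of [w], and [wt w b * wt b w = 1]. *)
Definition wt (w b : nat) : F := - (qint q b.+1 / qint q w.+1).

(** The last generator: it is nonzero only on paths whose last two steps leave [w] and return to it,
    and there it redistributes the intermediate vertex. Operators act on functions of paths, so that
    composites unfold into sums over neighbours; [op_mx] turns them into matrices. *)
Definition top_op (g : seq nat -> F) (s : seq nat) : F :=
  match s with
  | k :: a :: w :: r =>
    if k == w then \sum_(b <- nbrs w) wt w b * g (k :: b :: w :: r) else 0
  | _ => 0
  end.

Definition lift_op (op : (seq nat -> F) -> seq nat -> F) (g : seq nat -> F)
    (s : seq nat) : F :=
  if s is k :: s' then op (fun x => g (k :: x)) s' else 0.

(* Generators are counted from the end point: on paths of length [n], [op_at d]
   is the generator of index [n - 2 - d]. *)
Definition op_at (d : nat) := iter d lift_op top_op.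

Definition dirac (t s : seq nat) : F := (s == t)%:R.

(** The first clause replaces linearity, which an arbitrary function on functions lacks, and says
    that only the values on paths of length [n] matter. The second keeps end points fixed, so that a
    lifted operator again relates genuine paths. *)
Definition path_local n (op : (seq nat -> F) -> seq nat -> F) : Prop :=
  (forall g s, s \in paths n ->
    op g s = \sum_(t <- paths n) op (dirac t) s * g t) /\
  (forall s t, s \in paths n -> t \in paths n -> op (dirac t) s != 0 ->
    head 0%N t = head 0%N s).

Lemma paths3 n k a w r : k :: a :: w :: r \in paths n ->
  [/\ a \in nbrs w, (w.+1 < l)%N & valid_path l (w :: r)].
Proof.
rewrite mem_paths => /andP[_ /andP[_ /andP[aw vw]]]; split=> //.
have /(head_path (l := l)) : w :: r \in paths (size r) by rewrite mem_paths eqxx.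
by case=> _ _; apply; apply: ltnW.
Qed.

Lemma paths3_change n k a w r b : k :: a :: w :: r \in paths n -> k = w ->
  b \in nbrs w -> k :: b :: w :: r \in paths n.
Proof.
move=> ps -> bw; have [_ wl vw] := paths3 ps; move: ps; rewrite !mem_paths.
move=> /andP[-> _]; rewrite (_ : valid_path l _ = [&& w \in nbrs b, b \in nbrs w & valid_path l (w :: r)]) //.
by move: bw; rewrite vw !mem_nbrs wl orbC => /andP[-> ->].
Qed.

Lemma top_opE n g k a w r : k :: a :: w :: r \in paths n ->
  top_op g (k :: a :: w :: r) = \sum_(t <- paths n) top_op (dirac t) (k :: a :: w :: r) * g t.
Proof.
move=> ps; rewrite /top_op; case: eqP => [kw|_]; last first.
  by rewrite big1 // => t _; rewrite mul0r.
under [RHS]eq_bigr do rewrite mulr_suml.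
rewrite exchange_big /= big_seq [RHS]big_seq; apply: eq_bigr => b bw.
under [RHS]eq_bigr do rewrite -mulrA.
by rewrite -mulr_sumr big_delta ?paths_uniq // (paths3_change ps).
Qed.

Lemma top_op_local n : path_local n top_op.
Proof.
split=> [g [|k [|a [|w r]]] ps|[|k [|a [|w r]]] t ps pt] /=; rewrite ?eqxx //;
  try by rewrite big1 // => t _; rewrite mul0r.
  exact: top_opE ps.
case: (k =P w) => [kw|_]; last by rewrite eqxx.
move=> nz; apply/eqP; apply: contraR nz => ht; rewrite big1 // => b _.
rewrite /dirac; case: eqP => [E|_]; last by rewrite mulr0.
by rewrite -E eqxx in ht.
Qed.

Lemma local0 n op s : path_local n op -> s \in paths n -> op (fun=> 0) s = 0.
Proof. by case=> op_lin _ ps; rewrite op_lin // big1 // => t _; rewrite mulr0. Qed.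

Lemma lift_op_dirac n op k a s t : path_local n op -> s \in paths n ->
  lift_op op (dirac (a :: t)) (k :: s) = (a == k)%:R * op (dirac t) s.
Proof.
move=> op_loc ps; rewrite /lift_op /dirac; case: eqP => [->|/eqP ak].
  by rewrite mul1r; congr op; apply/funext=> x; rewrite eqseq_cons eqxx.
rewrite mul0r -[RHS](local0 op_loc ps); congr op; apply/funext=> x.
by rewrite eqseq_cons eq_sym (negPf ak).
Qed.

Lemma lift_op_local n op : path_local n op -> path_local n.+1 (lift_op op).
Proof.
move=> op_loc; have [op_lin op_hd] := op_loc.
split=> [g [|k s]|[|k s] [|a t]]; rewrite ?paths_nil // mem_pathsS => /andP[ps ks].
  rewrite big_pathsS [LHS]op_lin // big_seq [RHS]big_seq.
  apply: eq_bigr => t pt.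
  under eq_bigr do rewrite (lift_op_dirac _ _ _ op_loc ps) -mulrA eq_sym.
  have [op_ts|nz] := eqVneq (op (dirac t) s) 0.
    by rewrite op_ts mul0r big1 // => a _; rewrite mul0r mulr0.
  by rewrite big_delta ?nbrs_uniq // (op_hd s t).
move=> _; rewrite (lift_op_dirac _ _ _ op_loc ps).
by case: (a =P k) => [-> //|_]; rewrite mul0r eqxx.
Qed.

Lemma op_at_local n d : path_local (d + n) (op_at d).
Proof. by elim: d => [|d IHd]; [apply: top_op_local | apply: lift_op_local]. Qed.

Lemma wt_neq0 w b : (b.+1 < l)%N -> (w.+1 < l)%N -> wt w b != 0.
Proof.
move=> bl wl; rewrite oppr_eq0 mulf_neq0 ?invr_eq0 //; exact: (qint_neq0 q0 hl hql).
Qed.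

(* [w + 2] + [w] = (q + q^-1) [w + 1], where the missing neighbours of [w] in
   the truncated graph have [0] = [l] = 0. *)
Lemma wt_sum w : (w.+1 < l)%N -> \sum_(b <- nbrs w) wt w b = - (q + q^-1).
Proof.
move=> wl; have wn0 : qint q w.+1 != 0 by apply: (qint_neq0 q0 hl hql).
have -> : \sum_(b <- nbrs w) wt w b = - (qint q w.+2 + qint q w) / qint q w.+1.
  rewrite big_filter big_mkcond big_cons.
  have -> : (if (w.+2 < l)%N then wt w w.+1 else 0) = - (qint q w.+2 / qint q w.+1).
    case: ifP => //; rewrite /wt => wl2; have -> : w.+2 = l by lia.
    by rewrite (qint_ell q0 hl hql) mul0r oppr0.
  case: w wl {wn0} => [|w] wl.
    by rewrite big_nil qint0 // addr0 mulNr; apply: addr0.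
  by rewrite big_cons big_nil (ltnW wl) /wt /=; ring.
by rewrite qintSS // subrK mulNr mulfK.
Qed.

Lemma top_op_sq n g s : s \in paths n ->
  top_op (top_op g) s = - (q + q^-1) * top_op g s.
Proof.
case: s => [|k [|a [|w r]]] ps; rewrite /= ?mulr0 //.
case: eqP => [kw|_]; last by rewrite mulr0.
by have [_ wl _] := paths3 ps; rewrite -mulr_suml wt_sum.
Qed.

Lemma wtV a w : (a.+1 < l)%N -> (w.+1 < l)%N -> wt w a * wt a w = 1.
Proof.
move=> al wl; have nz b : (b.+1 < l)%N -> qint q b.+1 != 0 by move=> bl; apply: (qint_neq0 q0 hl hql).
by rewrite /wt mulrNN mulrA divfK ?divff ?nz.
Qed.

(** Here and in the next lemma, the tests for backtracking select one term in each of two sums, and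
    the two weights left over are inverse to each other by [wtV]. *)
Lemma top_lift_top n g s : s \in paths n.+3 ->
  top_op (lift_op top_op (top_op g)) s = top_op g s.
Proof.
case: s => [|k [|a [|w [|b r]]]] ps //; try by move: ps; rewrite mem_paths.
have [aw wl vb] := paths3 ps.
have bl : (b.+1 < l)%N.
  have /(head_path (l := l)) : b :: r \in paths (size r).
    by case/andP: vb => _ vb; rewrite mem_paths eqxx.
  by case=> _ _; apply; apply: ltnW.
have wb : w \in nbrs b by case/andP: vb.
rewrite /=; case: eqP => // kw; subst k.
under eq_bigr do rewrite eq_sym.
rewrite big_if_eq ?nbrs_uniq //; last by move: wb; rewrite !mem_nbrs bl wl orbC.
by rewrite big_if_eq ?nbrs_uniq // mulrA wtV // mul1r.
Qed.

Lemma lift_top_lift n g s : s \in paths n.+3 ->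
  lift_op top_op (top_op (lift_op top_op g)) s = lift_op top_op g s.
Proof.
case: s => [|e [|k [|a [|w r]]]] ps //; try by move: ps; rewrite mem_paths.
move: ps; rewrite mem_pathsS => /andP[ps ek].
have [aw wl _] := paths3 ps; rewrite /=; case: eqP => // kw; subst k.
have el : (e.+1 < l)%N by move: ek; rewrite mem_nbrs => /andP[].
rewrite big_if_eq ?nbrs_uniq //.
under eq_bigr do rewrite eq_sym.
rewrite big_if_eq ?nbrs_uniq //; first by rewrite mulrA wtV // mul1r.
by move: ek; rewrite /= !mem_nbrs el wl orbC.
Qed.

(** The lifted operator sees only the path up to [w] and preserves its end point [w], so it changes
    neither the test [k == w] nor the weights of the last generator. *)
Lemma top_lift_lift_comm n op g s : path_local n op -> s \in paths n.+2 ->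
  top_op (lift_op (lift_op op) g) s = lift_op (lift_op op) (top_op g) s.
Proof.
move=> op_loc; have [op_lin op_hd] := op_loc.
case: s => [|k [|a s]] ps; try by move: ps; rewrite mem_paths.
move: (ps); rewrite !mem_pathsS => /andP[/andP[ps0 as0] kas0].
case: s => [|w r] in ps ps0 as0 kas0 *; first by rewrite paths_nil in ps0.
rewrite [RHS]/= [RHS]op_lin // [LHS]/=.
transitivity (if k == w then \sum_(t <- paths n) op (dirac t) (w :: r) *
    (\sum_(b <- nbrs w) wt w b * g (k :: b :: t)) else 0).
  case: eqP => // kw; under [RHS]eq_bigr do rewrite mulr_sumr.
  rewrite exchange_big; apply: eq_bigr => b _; rewrite /= op_lin // mulr_sumr.
  by apply: eq_bigr => t _; rewrite mulrCA.
have E t : t \in paths n -> op (dirac t) (w :: r) * top_op g (k :: a :: t)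
  = if k == w then op (dirac t) (w :: r) * (\sum_(b <- nbrs w) wt w b * g (k :: b :: t)) else 0.
  move=> pt; have [->|nz] := eqVneq (op (dirac t) (w :: r)) 0.
    by rewrite !mul0r if_same.
  have := op_hd _ _ ps0 pt nz; case: t pt {nz} => [|w' t] pt; first by rewrite paths_nil in pt.
  by move=> /= ->; case: eqP => // _; rewrite mulr0.
rewrite big_seq [RHS]big_seq; case: eqP E => [_|_] E; last first.
  by rewrite big1 // => t pt; rewrite E.
by apply: eq_bigr => t pt; rewrite E.
Qed.

Lemma iter_liftM d A B g :
  iter d lift_op (fun g' => A (B g')) g = iter d lift_op A (iter d lift_op B g).
Proof.
elim: d g => //= d IHd g; apply/funext=> -[|k s] //=.
by rewrite IHd.
Qed.

Lemma iter_lift_eq d n A B :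
  (forall g s, s \in paths n -> A g s = B g s) ->
  forall g s, s \in paths (d + n) -> iter d lift_op A g s = iter d lift_op B g s.
Proof.
move=> AB; elim: d => [|d IHd] // g [|k s]; first by rewrite paths_nil.
by rewrite addSn mem_pathsS => /andP[ps _]; apply: IHd.
Qed.

Definition op_mx n op : 'M[F]_(size (paths n)) := @pmat F l n (fun s t => op (dirac t) s).

Lemma ent_op_mxM n op M s t : path_local n op -> s \in paths n -> t \in paths n ->
  ent (op_mx n op *m M) s t = op (fun u => ent M u t) s.
Proof.
move=> [op_lin _] ps pt; rewrite entM // op_lin // big_seq [RHS]big_seq.
by apply: eq_bigr => u pu; rewrite ent_pmat.
Qed.

Lemma op_mxM n A B : path_local n A ->
  op_mx n A *m op_mx n B = op_mx n (fun g => A (B g)).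
Proof.
move=> A_loc; apply: entP => s t ps pt; rewrite ent_op_mxM // ent_pmat //.
have [A_lin _] := A_loc; rewrite A_lin // [RHS]A_lin // big_seq [RHS]big_seq.
by apply: eq_bigr => u pu; rewrite ent_pmat.
Qed.

Lemma op_mx_eq n A B : (forall g s, s \in paths n -> A g s = B g s) ->
  op_mx n A = op_mx n B.
Proof. by move=> AB; apply: entP => s t ps pt; rewrite !ent_pmat // AB. Qed.

Definition gen_mx n (i : nat) := op_mx n (op_at (n - i.+2)).

Lemma gen_local n i : (i.+1 < n)%N -> path_local n (op_at (n - i.+2)).
Proof. by move=> lt_in; have := @op_at_local i.+2 (n - i.+2); rewrite subnK. Qed.

Lemma gen_mx_sq n i : (i.+1 < n)%N ->
  gen_mx n i *m gen_mx n i = - (q + q^-1) *: gen_mx n i.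
Proof.
move=> lt_in; rewrite op_mxM; last exact: gen_local.
apply: entP => s t ps pt; rewrite entZ !ent_pmat //.
have En : (n - i.+2 + i.+2 = n)%N by rewrite subnK.
rewrite /op_at -iter_liftM; rewrite -En in ps.
rewrite (iter_lift_eq (B := fun g s => - (q + q^-1) * top_op g s) _ _ ps) //.
  elim: (n - _)%N (dirac t) s {ps pt} => //= d IHd g [|k s] /=; last exact: IHd.
  by rewrite mulr0.
by move=> g s' ps'; apply: top_op_sq ps'.
Qed.

Lemma gen_mx_near n i j : (i.+1 < n)%N -> (j.+1 < n)%N ->
  j = i.+1 \/ i = j.+1 -> gen_mx n i *m gen_mx n j *m gen_mx n i = gen_mx n i.
Proof.
move=> lt_in lt_jn adj; rewrite -mulmxA !op_mxM; try exact: gen_local.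
apply: op_mx_eq => g s ps.
have [E|E] := adj.
  have -> : (n - i.+2 = (n - j.+2).+1)%N by lia.
  have En : (n - j.+2 + i.+3 = n)%N by lia.
  rewrite -En in ps; rewrite /op_at !iterSr -!iter_liftM.
  by apply: iter_lift_eq ps => g' s' ps'; apply: lift_top_lift ps'.
have -> : (n - j.+2 = (n - i.+2).+1)%N by lia.
have En : (n - i.+2 + j.+3 = n)%N by lia.
rewrite -En in ps; rewrite /op_at !iterSr -!iter_liftM.
by apply: iter_lift_eq ps => g' s' ps'; apply: top_lift_top ps'.
Qed.

Lemma gen_mx_far n i j : (i.+1 < n)%N -> (j.+1 < n)%N -> (i.+2 <= j)%N ->
  gen_mx n i *m gen_mx n j = gen_mx n j *m gen_mx n i.
Proof.
move=> lt_in lt_jn ij; rewrite !op_mxM; try exact: gen_local.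
apply: op_mx_eq => g s ps.
have Ei : (n - i.+2 = n - j.+2 + (j - i.+2).+2)%N by lia.
have En : (n - j.+2 + (j - i.+2 + i.+2).+2 = n)%N by lia.
rewrite -En in ps; rewrite Ei /op_at !iterD -!iter_liftM.
apply: iter_lift_eq ps => g' s' ps'.
by rewrite /= -(top_lift_lift_comm _ (op_at_local _ _) ps').
Qed.

Lemma gen_mxS n i a s b t : (i.+1 < n)%N ->
  a :: s \in paths n.+1 -> b :: t \in paths n.+1 ->
  ent (gen_mx n.+1 i) (a :: s) (b :: t) = (b == a)%:R * ent (gen_mx n i) s t.
Proof.
move=> lt_in pas pbt; rewrite ent_pmat //.
move: pas pbt; rewrite !mem_pathsS => /andP[ps _] /andP[pt _].
by rewrite ent_pmat // -(lift_op_dirac _ _ _ (gen_local lt_in) ps) subSn.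
Qed.

Lemma gen_mx_top n k a s k' b t :
  k :: a :: s \in paths n.+2 -> k' :: b :: t \in paths n.+2 ->
  ent (gen_mx n.+2 n) (k :: a :: s) (k' :: b :: t)
    = if (k == head 0%N s) && (k' == k) && (s == t) then wt k b else 0.
Proof.
move=> pas pbt; rewrite ent_pmat // subnn.
case: s pas => [|w r] pas; first by move: pas; rewrite !mem_pathsS paths_nil.
rewrite /=; case: eqP => //= kw; subst k.
have -> : \sum_(c <- nbrs w) wt w c * dirac (k' :: b :: t) (w :: c :: w :: r)
   = \sum_(c <- nbrs w) (b == c)%:R * (wt w c * ((k' == w) && (w :: r == t))%:R).
  apply: eq_bigr => c _; rewrite /dirac eqseq_cons [_ :: _ == b :: t]eqseq_cons.
  rewrite [w == k']eq_sym [c == b]eq_sym.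
  by case: (k' == w); case: (b == c); rewrite /= ?mulr0 ?mul0r ?mul1r.
have [E|] := boolP ((k' == w) && (w :: r == t)); last first.
  by move=> _; rewrite big1 // => c _; rewrite !mulr0.
rewrite big_delta ?nbrs_uniq ?mulr1 //.
case/andP: E => _ /eqP <- in pbt.
by move: pbt; rewrite !mem_pathsS => /andP[/andP[]].
Qed.

Lemma op_at_cat r d g x : size r = d ->
  op_at d g (r ++ x) = top_op (fun y => g (r ++ y)) x.
Proof.
elim: r d g => [|k r IHr] [|d] g //= [sz].
exact: (IHr d (fun y => g (k :: y))).
Qed.

(* A vector killed by the first generators vanishes on every path that
   descends early, by induction on the place of the first descent. *)
Lemma annihilated_eq0 n (M : 'M[F]_(size (paths n))) : (l.-1 <= n)%N ->
  (forall i, (i.+2 < l)%N -> gen_mx n i *m M = 0) -> M = 0.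
Proof.
move=> ln fM; apply: entP => s t ps pt; rewrite ent0.
have [r [j [Es jl]]] := path_first_descent hl ln ps.
rewrite {s}Es in ps *; elim: j r ps jl => [|j IHj] r ps jl.
  have sz : size r = (n - 2)%N.
    by move: (ps); rewrite mem_paths size_cat /= => /andP[/eqP E _]; lia.
  (* The vertex 0 has the single neighbour 1, so the equation given by the first generator has one
     term, with nonzero weight. *)
  have := congr1 (fun M => ent M (r ++ 0%N :: straight 1) t) (fM 0%N jl).
  rewrite ent0 ent_op_mxM //; last by apply: (@gen_local n 0); lia.
  rewrite (op_at_cat _ _ sz) /= big_filter big_cons jl big_nil addr0 => /eqP.
  by rewrite mulf_eq0 (negPf (wt_neq0 _ _)) ?(ltnW jl) //= => /eqP.
have sz : size r = (n - j.+3)%N.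
  by move: (ps); rewrite mem_paths size_cat /= size_straight => /andP[/eqP E _]; lia.
have jn : (j.+2 < n)%N.
  by move: (ps); rewrite mem_paths size_cat /= size_straight => /andP[/eqP E _]; lia.
(* The neighbours of [j + 1] are [j + 2] and [j]. The path through [j] first descends to [j], so its
   entry vanishes by induction, and hence the entry of the path through [j + 2] vanishes too. *)
have := congr1 (fun M => ent M (r ++ j.+1 :: straight j.+2) t) (fM j.+1 jl).
rewrite ent0 ent_op_mxM //; last exact: (@gen_local n j.+1).
rewrite (op_at_cat _ _ sz) /= eqxx.
rewrite big_filter !big_cons big_nil jl (ltnW (ltnW jl)) /= addr0.
have := IHj (rcons r j.+1); rewrite cat_rcons => ->; last exact: ltnW jl.
  rewrite mulr0 addr0 => /eqP.
  by rewrite mulf_eq0 (negPf (wt_neq0 _ _)) ?(ltnW jl) //= => /eqP.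
move: ps; rewrite !mem_paths !size_cat /= => /andP[-> ps] /=.
apply: valid_path_change ps _ => /=.
have : straight j.+1 \in paths j.+1 by apply: straight_paths; apply: ltnW.
rewrite mem_paths => /andP[_]; apply: (fun a b c => introT and3P (And3 a b c)).
  by rewrite mem_nbrs eqxx (ltnW jl).
by rewrite mem_nbrs eqxx orbT (ltnW (ltnW jl)).
Qed.
End PathOperators.

(** * Temperley-Lieb relations and the Jones-Wenzl idempotent *)

Definition TL_relations (F : fieldType) (q : F) (A : pzAlgType F) (m : nat)
    (f : nat -> A) : Prop :=
  [/\ forall i, (i < m)%N -> f i * f i = (- (q + q^-1))%:S * f i,
      forall i, (i.+1 < m)%N -> f i * f i.+1 * f i = f i,
      forall i, (i.+1 < m)%N -> f i.+1 * f i * f i.+1 = f i.+1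
    & forall i j, (i.+2 <= j)%N -> (j < m)%N -> f i * f j = f j * f i].

Section ScalarAlgebra.
Variables (k : pzRingType) (A : pzAlgType k).
Implicit Types (a : k) (x y : A).

Lemma scal_mulrCA a x y : x * (a%:S * y) = a%:S * (x * y).
Proof. by rewrite mulrA -scalC mulrA. Qed.

Lemma scalMl a b x : a%:S * (b%:S * x) = (a * b)%:S * x.
Proof. by rewrite mulrA rmorphM. Qed.
End ScalarAlgebra.

Section JonesWenzl.
Variables (F : fieldType) (q : F) (l : nat).
Hypotheses (q0 : q != 0) (hl : (3 <= l)%N) (hql : l.-primitive_root (q ^+ 2)).
Variables (A : pzAlgType F) (m : nat) (f : nat -> A).
Hypotheses (fTL : TL_relations q m f) (ml : (m.+1 < l)%N).
Let qq1 := q_subV_neq0 q0 hl hql.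

Let gens (x : A) := exists2 i, (i < m)%N & x = f i.

(** The factor gained by closing the last strand of the idempotent on [k + 1] strands; at [k = 0] it
    is the loop value. *)
Let d_ k : F := - (qint q k.+2 / qint q k.+1).

(* [p] is the Jones-Wenzl idempotent killed by the first [k] generators and
   [p0] is the previous one. *)
Let jw k (p0 p : A) : Prop :=
  [/\ [/\ forall i, (i < k)%N -> f i * p = 0 /\ p * f i = 0,
          forall i, (k < i < m)%N -> f i * p = p * f i
        & forall i, (k <= i < m)%N -> f i * p0 = p0 * f i],
      [/\ p * p = p, p * p0 = p & p0 * p = p],
      (k < m)%N -> f k * p * f k = (d_ k)%:S * (p0 * f k)
    & ideal2 gens (p - 1)].

(** Wenzl's recursion, run in any algebra with the relations. The last conclusion serves twice: it
    yields [p != 0] in [TL], and it puts 1 in the ideal of the generators wherever [p] is mapped to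
    0. *)
Lemma JonesWenzl_exists : exists p : A,
  [/\ p * p = p, forall i, (i < m)%N -> f i * p = 0 /\ p * f i = 0
    & ideal2 (fun x => exists2 i, (i < m)%N & x = f i) (p - 1)].
Proof.
have [f_sq f_up f_dn f_far] := fTL.
suff [p0 [p [[pk _ _] [pp _ _] _ pI]]] : exists p0 p, jw m p0 p by exists p.
suff H k : (k <= m)%N -> exists p0 p, jw k p0 p by apply: H.
elim: k => [|k IHk] km.
  exists 1, 1; split; last by rewrite subrr; apply: ideal2_0.
  - by split=> // i _; rewrite mul1r mulr1.
  - by rewrite !mul1r.
  move=> m0; rewrite mulr1 mul1r f_sq // /d_ qint1 // divr1.
  by rewrite qintSS // qint0 qint1 // subr0 mulr1.
have {IHk} [p0 [p [[pk pC p0C] [pp pp0 p0p] pd pI]]] := IHk (ltnW km).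
have nz : qint q k.+2 != 0 by apply: (qint_neq0 q0 hl hql); lia.
have nz1 : qint q k.+1 != 0 by apply: (qint_neq0 q0 hl hql); lia.
(* Chosen so that [c * d_ k = -1], which makes [f k] kill [p']; [[k + 2]] is invertible because
   [k + 2 <= m + 1 < l]. *)
pose c : F := qint q k.+1 / qint q k.+2.
have cd : c * d_ k = -1 by rewrite /c /d_ mulrN mulrA divfK // divff.
pose p' := p + c%:S * (p * f k * p).
have p'p : p' * p = p' by rewrite /p' mulrDl pp -!mulrA pp.
have ppx x : p * (p * x) = p * x by rewrite mulrA pp.
have pp' : p * p' = p' by rewrite /p' mulrDr pp scal_mulrCA -!mulrA ppx.
have kp' : f k * p' = 0.
  have E : f k * (p * f k * p) = (d_ k)%:S * (f k * p).
    by rewrite !mulrA pd // -p0C ?leqnn // -!mulrA p0p.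
  by rewrite /p' mulrDr scal_mulrCA E scalMl cd rmorphN rmorph1 mulN1r subrr.
have p'k : p' * f k = 0.
  have E : p * f k * p * f k = (d_ k)%:S * (p * f k).
    by rewrite -!mulrA [f k * (p * _)]mulrA pd // scal_mulrCA [p * (p0 * _)]mulrA pp0.
  by rewrite /p' mulrDl -(mulrA c%:S) E scalMl cd rmorphN rmorph1 mulN1r subrr.
exists p, p'; split.
- split=> i.
  + rewrite ltnS leq_eqVlt => /orP[/eqP -> //|ik].
    have [ip pi] := pk _ ik; split; first by rewrite -pp' mulrA ip mul0r.
    by rewrite -p'p -mulrA pi mulr0.
  + case/andP=> ki im; rewrite /p' mulrDr mulrDl pC ?(ltnW ki) //; congr (_ + _).
    have ip : f i * p = p * f i by apply: pC; rewrite (ltnW ki).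
    rewrite scal_mulrCA -!mulrA -ip; congr (_ * _).
    by rewrite [f k * (f i * _)]mulrA f_far // !mulrA ip -!mulrA.
  + by case/andP=> ki im; apply: pC; rewrite ki.
- split=> //; have z : p' * (p * f k * p) = 0 by rewrite !mulrA p'p p'k mul0r.
  have -> : p' * p' = p' * (p + c%:S * (p * f k * p)) by [].
  by rewrite mulrDr p'p scal_mulrCA z mulr0 addr0.
- move=> k1m; have k1p : f k.+1 * p = p * f k.+1 by apply: pC; rewrite ltnSn.
  have E1 : f k.+1 * p * f k.+1 = (- (q + q^-1))%:S * (p * f k.+1).
    by rewrite k1p -mulrA f_sq // scal_mulrCA.
  have E2 : f k.+1 * (p * f k * p) * f k.+1 = p * f k.+1.
    rewrite !mulrA k1p -!mulrA -k1p [f k * _]mulrA [f k.+1 * _]mulrA.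
    by rewrite [f k.+1 * (_ * _)]mulrA f_dn // k1p ppx.
  (* What remains is the recursion of quantum integers: [-(q + q^-1) + [k + 1] / [k + 2] = -[k + 3]
     / [k + 2]], with the quotients shifted from [k] to [k + 1]. *)
  rewrite /p' mulrDr mulrDl E1 scal_mulrCA -(mulrA c%:S) E2 -mulrDl -rmorphD.
  congr (_%:S * _); rewrite /d_ /c (qintSS q0 qq1 k.+1).
  by field; rewrite nz.
- rewrite /p' addrAC; apply: ideal2_add => //; apply: ideal2_mull; apply: ideal2_mulr.
  by apply: ideal2_mull; apply: ideal2_gen; exists k.
Qed.
End JonesWenzl.

Lemma to_quot0 (k : pzRingType) (A : pzAlgType k) (S : A -> Prop) x :
  S x -> to_quot S x = 0.
Proof.
move=> Sx; rewrite -[0]/(to_quot S 0); apply/to_quotP; rewrite subr0.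
exact: ideal2_gen.
Qed.

Section QuotientRelations.
Variables (k : pzRingType) (A : pzAlgType k) (S : A -> Prop).
Implicit Types f g : A.

Lemma to_quot_rel x y : S (x - y) -> to_quot S x = to_quot S y.
Proof. by move=> Sxy; apply/to_quotP/ideal2_gen. Qed.

Lemma to_quot_sq f a : S (f * f - a%:S * f) ->
  to_quot S f * to_quot S f = a%:S * to_quot S f.
Proof. by move/to_quot_rel; rewrite !rmorphM. Qed.

Lemma to_quot_near f g : S (f * g * f - f) ->
  to_quot S f * to_quot S g * to_quot S f = to_quot S f.
Proof. by move/to_quot_rel; rewrite !rmorphM. Qed.

Lemma to_quot_far f g : S (f * g - g * f) ->
  to_quot S f * to_quot S g = to_quot S g * to_quot S f.
Proof. by move/to_quot_rel; rewrite !rmorphM. Qed.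
End QuotientRelations.

Lemma ideal2_map (k : pzRingType) (A B : pzAlgType k) (f : {rmorphism A -> B})
    (S : A -> Prop) (S' : B -> Prop) :
  (forall x, S x -> S' (f x)) -> forall x, ideal2 S x -> ideal2 S' (f x).
Proof.
move=> SS' x; elim=> [y Sy||y z _ fy _ fz|a y _ fy|a y _ fy].
- exact/ideal2_gen/SS'.
- by rewrite rmorph0; apply: ideal2_0.
- by rewrite rmorphD; apply: ideal2_add.
- by rewrite rmorphM; apply: ideal2_mull.
- by rewrite rmorphM; apply: ideal2_mulr.
Qed.

(** * The Temperley-Lieb algebras and their inclusions *)

Section TemperleyLiebPresentation.
Variables (F : fieldType) (q : F).

(** Indexing by [nat], with default 0 out of range, lets generators of [TL q n] for different [n] be
    compared. *)
Definition tgen n (i : nat) : TL q n := oapp (@TLgen F q n) 0 (insub i).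

Lemma tgenE n (i : 'I_n.-1) : tgen n i = TLgen q i.
Proof. by rewrite /tgen valK. Qed.

Lemma TL_relations_le (A : pzAlgType F) m m' (f : nat -> A) :
  (m <= m')%N -> TL_relations q m' f -> TL_relations q m f.
Proof.
move=> mm [f_sq f_up f_dn f_far].
by split=> [i im|i im|i im|i j ij jm]; [apply: f_sq|apply: f_up|apply: f_dn|apply: f_far] => //;
  apply: leq_trans mm.
Qed.

Lemma TL_relations_map (A B : pzAlgType F) (g : {rmorphism A -> B}) m (f : nat -> A) :
  alg_morphism g -> TL_relations q m f -> TL_relations q m (g \o f).
Proof.
move=> ga [f_sq f_up f_dn f_far].
split=> [i im|i im|i im|i j ij jm] /=; rewrite -!rmorphM.
- by rewrite f_sq // rmorphM ga.
- by rewrite f_up.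
- by rewrite f_dn.
- by rewrite f_far.
Qed.

Lemma tgen_relations n : TL_relations q n.-1 (tgen n).
Proof.
split=> [i im|i im|i im|i j ij jm].
- rewrite -[i]/(val (Ordinal im)) tgenE; exact: to_quot_sq (TL_sq q _).
- pose i1 := Ordinal im; pose i0 := Ordinal (ltnW im).
  rewrite -[i.+1]/(val i1) -[i]/(val i0) !tgenE.
  exact: to_quot_near (@TL_near F q n i0 i1 (or_introl erefl)).
- pose i1 := Ordinal im; pose i0 := Ordinal (ltnW im).
  rewrite -[i.+1]/(val i1) -[i]/(val i0) !tgenE.
  exact: to_quot_near (@TL_near F q n i1 i0 (or_intror erefl)).
have im : (i < n.-1)%N by apply: leq_trans jm; lia.
rewrite -[i]/(val (Ordinal im)) -[j]/(val (Ordinal jm)) !tgenE.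
exact: to_quot_far (@TL_far F q n (Ordinal im) (Ordinal jm) (or_introl ij)).
Qed.

Lemma TL_ext (A : pzAlgType F) n (h : nat -> A) : TL_relations q n.-1 h ->
  exists f : {rmorphism TL q n -> A},
    alg_morphism f /\ forall i, (i < n.-1)%N -> f (tgen n i) = h i.
Proof.
move=> [h_sq h_up h_dn h_far].
have [|f [fa fE]] := @presented_ext F 'I_n.-1 (TL_relator q (n := n)) A (fun i => h i).
  move=> _ [i|i j ij|i j ij].
  - by rewrite free_ext_sq h_sq ?ltn_ord // subrr.
  - rewrite free_ext_near; case: ij => ij; rewrite ij; apply/eqP; rewrite subr_eq0; apply/eqP.
      by apply: h_up; rewrite -ij ltn_ord.
    by apply: h_dn; rewrite -ij ltn_ord.
  - rewrite free_ext_far; apply/eqP; rewrite subr_eq0; apply/eqP.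
    by case: ij => ij; [|symmetry]; apply: h_far.
exists f; split=> // i im; rewrite -[i]/(val (Ordinal im)) tgenE; exact: fE.
Qed.

Lemma TL_ind n (P : TL q n -> Prop) :
  P 1 -> (forall x y, P x -> P y -> P (x + y)) ->
  (forall a x, P x -> P (a%:S * x)) ->
  (forall i x, (i < n.-1)%N -> P x -> P (tgen n i * x)) -> forall x, P x.
Proof.
move=> P1 PD PZ Pg; apply: presented_ind => // i x Px.
by have := Pg i x (ltn_ord i) Px; rewrite tgenE.
Qed.

Lemma TL_morph_eq (A : pzAlgType F) n (f g : {rmorphism TL q n -> A}) :
  alg_morphism f -> alg_morphism g ->
  (forall i, (i < n.-1)%N -> f (tgen n i) = g (tgen n i)) -> f =1 g.
Proof.
move=> fa ga fg; elim/TL_ind=> [|x y fx fy|a x fx|i x im fx].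
- by rewrite !rmorph1.
- by rewrite !rmorphD fx fy.
- by rewrite !rmorphM fx fa ga.
- by rewrite !rmorphM fx fg.
Qed.

Lemma TL_inclusion_exists m n : (m <= n)%N ->
  exists g : {rmorphism TL q m -> TL q n},
    is_TL_inclusion g /\ forall i, (i < m.-1)%N -> g (tgen m i) = tgen n i.
Proof.
move=> mn; have mn1 : (m.-1 <= n.-1)%N by lia.
have [g [ga gE]] := TL_ext (TL_relations_le mn1 (tgen_relations n)).
exists g; split=> //; split=> // i j ij.
by rewrite -!tgenE gE ?ltn_ord // ij.
Qed.
End TemperleyLiebPresentation.

(** * The Jones algebras and their path representation *)

Section JonesAlgebra.
Variables (F : fieldType) (q : F) (l : nat).
Hypotheses (q0 : q != 0) (hl : (3 <= l)%N) (hql : l.-primitive_root (q ^+ 2)).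
Local Notation J := (Jones q l).
Local Notation to_jones n := (to_quot (@Jones_generator F q l n)).

Definition jgen n (i : nat) : J n := to_jones n (tgen q n i).

Lemma to_jones_alg n : alg_morphism (to_jones n : {rmorphism _ -> J n}).
Proof. by []. Qed.

Lemma jgen_relations n : TL_relations q n.-1 (jgen n).
Proof.
exact: (TL_relations_map (@to_jones_alg n) (tgen_relations q n)).
Qed.

Lemma Jones_ext (A : pzAlgType F) n (f : {rmorphism TL q n -> A}) :
  alg_morphism f -> (forall x, @Jones_generator F q l n x -> f x = 0) ->
  exists g : {rmorphism J n -> A},
    alg_morphism g /\ forall x, g (to_jones n x) = f x.
Proof.
move=> fa fJ; have [g gE] := quot_extP fJ; exists g; split=> // a.
by rewrite -[a%:S]/(to_jones n a%:S) gE fa.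
Qed.

Lemma Jones_ind n (P : J n -> Prop) :
  P 1 -> (forall x y, P x -> P y -> P (x + y)) ->
  (forall a x, P x -> P (a%:S * x)) ->
  (forall i x, (i < n.-1)%N -> P x -> P (jgen n i * x)) -> forall x, P x.
Proof.
move=> P1 PD PZ Pg u; rewrite -[u]to_quotK; elim/TL_ind: (repr u).
- exact: P1.
- by move=> x y Px Py; rewrite rmorphD; apply: PD.
- by move=> a x Px; rewrite rmorphM; apply: PZ.
- by move=> i x im Px; rewrite rmorphM; apply: Pg.
Qed.

(** The map from [TL q l.-1] to [TL q n.+1] through [TL q n] agrees with the direct inclusion on
    generators, so the inclusion sends a generator of the ideal at level [n] to one at level
    [n + 1]. *)
Lemma Jones_inc_exists n : exists g : {rmorphism J n -> J n.+1},
  alg_morphism g /\ forall i, (i < n.-1)%N -> g (jgen n i) = jgen n.+1 i.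
Proof.
have [f [[fa _] fE]] := TL_inclusion_exists q (leqnSn n).
pose f' : {rmorphism TL q n -> J n.+1} := to_jones n.+1 \o f.
have f'a : alg_morphism f' by move=> a; rewrite /= fa.
have [x [ln [g [E [[ga gE] JE ->]]]]|g [ga gE]] := Jones_ext f'a.
  have ln1 : (l.-1 <= n.+1)%N by apply: leq_trans ln _.
  have [h [hi hE]] := TL_inclusion_exists q ln1; have [ha _] := hi.
  have -> : f' (g E) = to_jones n.+1 (h E).
    apply: (TL_morph_eq (f := f' \o g) (g := to_jones n.+1 \o h)) => [a|a|i im] /=.
    - by rewrite ga fa.
    - by rewrite ha.
    have im' : (i < n.-1)%N by lia.
    rewrite hE // -fE // -[i in RHS]/(val (Ordinal im')) tgenE.
    by rewrite -(gE (Ordinal im)) // -tgenE.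
  by apply: to_quot0; split=> //; exists h, E.
by exists g; split=> // i im; rewrite gE /= fE.
Qed.

Definition inc n : {rmorphism J n -> J n.+1} := projT1 (cid (Jones_inc_exists n)).

Lemma inc_alg n : alg_morphism (inc n).
Proof. by rewrite /inc; case: cid => g []. Qed.

Lemma inc_gen n i : (i < n.-1)%N -> inc n (jgen n i) = jgen n.+1 i.
Proof. by rewrite /inc; case: cid => g [_ /=]; apply. Qed.

Lemma gen_mx_relations n : TL_relations q n.-1 (gen_mx q l n : nat -> 'M[F]__).
Proof.
split=> [i im|i im|i im|i j ij jm].
- by rewrite -[RHS]/(_%:M *m _) mul_scalar_mx; apply: gen_mx_sq => //; lia.
- by apply: gen_mx_near => //; [lia|lia|left].
- by apply: gen_mx_near => //; [lia|lia|right].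
- by apply: gen_mx_far; lia.
Qed.

Lemma Jones_rep_exists n : exists g : {rmorphism J n -> 'M[F]_(size (paths l n))},
  alg_morphism g /\ forall i, (i < n.-1)%N -> g (jgen n i) = gen_mx q l n i.
Proof.
have [f [fa fE]] := TL_ext (gen_mx_relations n).
have [x [ln [g [E [[ga gE] [_ _ JE] ->]]]]|g [ga gE]] := Jones_ext fa.
  (* The image of the Jones-Wenzl idempotent is killed on the left by the first [l - 2]
     generators. *)
  apply: (annihilated_eq0 q0 hl hql ln) => i il.
  have im : (i < l.-1.-1)%N by lia.
  have im' : (i < n.-1)%N by lia.
  rewrite -fE // -[i]/(val (Ordinal im')) tgenE -(gE (Ordinal im)) //.
  by rewrite -[_ *m _]/(_ * _) -!rmorphM (JE _).1 !rmorph0.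
by exists g; split=> // i im; rewrite gE fE.
Qed.

Definition jrep n : {rmorphism J n -> 'M[F]_(size (paths l n))} :=
  projT1 (cid (Jones_rep_exists n)).

Lemma jrep_alg n : alg_morphism (jrep n).
Proof. by rewrite /jrep; case: cid => g []. Qed.

Lemma jrep_gen n i : (i < n.-1)%N -> jrep n (jgen n i) = gen_mx q l n i.
Proof. by rewrite /jrep; case: cid => g [_ /=]; apply. Qed.

Lemma Jones_one_in_ideal n : (l.-1 <= n)%N ->
  ideal2 (fun x : J n => exists2 i, (i < n.-1)%N & x = jgen n i) 1.
Proof.
move=> ln; have l2 : (l.-2.+1 < l)%N by lia.
have [p [pp pk pI]] := JonesWenzl_exists q0 hl hql (tgen_relations q l.-1) l2.
(* The character sending every generator to 0 kills [p - 1], hence sends [p] to 1. *)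
have p0 : p != 0.
  have [|e [ea eE]] := @TL_ext F q 'M[F]_1 l.-1 (fun=> 0).
    by split=> *; rewrite ?mulr0 ?mul0r.
  have /eqP : e (p - 1) = 0.
    apply: ideal2_ker pI => x [i il ->]; exact: eE.
  rewrite rmorphB rmorph1 subr_eq0 => ep; apply/eqP => pz; move: ep.
  by rewrite pz rmorph0 eq_sym oner_eq0.
have [g [gi gE]] := TL_inclusion_exists q ln; have [ga _] := gi.
pose g' : {rmorphism TL q l.-1 -> J n} := to_jones n \o g.
have gp : g' p = 0.
  apply: to_quot0; split=> //; exists g, p; split=> //; split=> // i.
  by have := pk i (ltn_ord i); rewrite tgenE.
rewrite -[1]opprK -[-1]add0r -gp -(rmorph1 g') -rmorphB; apply: ideal2N.
apply: ideal2_map pI => _ [i il ->].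
by exists i; [lia | rewrite /= gE].
Qed.

End JonesAlgebra.

(** * Bijectivity of the path representation, by induction along the tower *)

Section Tower.
Variables (F : fieldType) (q : F) (l : nat).
Hypotheses (q0 : q != 0) (hl : (3 <= l)%N) (hql : l.-primitive_root (q ^+ 2)).
Variables (J : nat -> pzAlgType F) (jgen : forall n, nat -> J n)
  (inc : forall n, {rmorphism J n -> J n.+1})
  (jrep : forall n, {rmorphism J n -> 'M[F]_(size (paths l n))}).
Hypotheses (jgen_relations : forall n, TL_relations q n.-1 (jgen n))
  (Jones_ind : forall n (P : J n -> Prop),
    P 1 -> (forall x y, P x -> P y -> P (x + y)) ->
    (forall a x, P x -> P (a%:S * x)) ->
    (forall i x, (i < n.-1)%N -> P x -> P (jgen n i * x)) -> forall x, P x)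
  (inc_alg : forall n, alg_morphism (inc n))
  (inc_gen : forall n i, (i < n.-1)%N -> inc n (jgen n i) = jgen n.+1 i)
  (jrep_alg : forall n, alg_morphism (jrep n))
  (jrep_gen : forall n i, (i < n.-1)%N -> jrep n (jgen n i) = gen_mx q l n i)
  (Jones_one_in_ideal : forall n, (l.-1 <= n)%N ->
    ideal2 (fun x : J n => exists2 i, (i < n.-1)%N & x = jgen n i) 1).

(** The subspace [J_(n+1) f J_(n+1)], where [f], of index [n], is the last generator of [J n.+2];
    scalars are absorbed in [a]. *)
Inductive top_span n : J n.+2 -> Prop :=
| top_span_gen a b : top_span (inc n.+1 a * jgen n.+2 n * inc n.+1 b)
| top_span_0 : top_span 0
| top_span_add x y of top_span x & top_span y : top_span (x + y).

Lemma top_span_scal n c x : top_span x -> top_span (c%:S * x : J n.+2).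
Proof.
elim=> [a b||y z _ sy _ sz].
- by rewrite -inc_alg !mulrA -rmorphM; apply: top_span_gen.
- by rewrite mulr0; apply: top_span_0.
- by rewrite mulrDr; apply: top_span_add.
Qed.

Lemma top_span_incl n c x : top_span x -> top_span (inc n.+1 c * x).
Proof.
elim=> [a b||y z _ sy _ sz].
- by rewrite !mulrA -rmorphM; apply: top_span_gen.
- by rewrite mulr0; apply: top_span_0.
- by rewrite mulrDr; apply: top_span_add.
Qed.

Lemma top_span_incr n c x : top_span x -> top_span (x * inc n.+1 c).
Proof.
elim=> [a b||y z _ sy _ sz].
- by rewrite -mulrA -rmorphM; apply: top_span_gen.
- by rewrite mul0r; apply: top_span_0.
- by rewrite mulrDl; apply: top_span_add.
Qed.

(** Downwards from the last generator, by [f_i = f_i f_(i+1) f_i]. *)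
Lemma top_span_jgen n i : (i <= n)%N -> top_span (jgen n.+2 i).
Proof.
have [f_sq f_up f_dn f_far] := jgen_relations n.+2.
move=> le_in; rewrite -(subKn le_in); move: (n - i)%N (leq_subr i n) => d {i le_in}.
elim: d => [|d IHd] dn.
  by have := top_span_gen (1 : J n.+1) 1; rewrite !rmorph1 mul1r mulr1 subn0.
have E : (n - d = (n - d.+1).+1)%N by lia.
rewrite -f_up -?E; last by rewrite /=; lia.
rewrite -inc_gen /=; last by lia.
by apply/top_span_incr/top_span_incl/IHd/ltnW.
Qed.

Lemma jgen_top_comm n c : jgen n.+2 n * inc n.+1 (inc n c) = inc n.+1 (inc n c) * jgen n.+2 n.
Proof.
have [f_sq f_up f_dn f_far] := jgen_relations n.+2.
elim/Jones_ind: c => [|x y Cx Cy|a x Cx|i x im Cx].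
- by rewrite !rmorph1 mulr1 mul1r.
- by rewrite !rmorphD mulrDl mulrDr Cx Cy.
- by rewrite !rmorphM !inc_alg scal_mulrCA Cx !mulrA.
- rewrite !rmorphM /= inc_gen // inc_gen /=; last by lia.
  by rewrite mulrA -f_far ?mulrA -?[LHS]mulrA ?Cx ?mulrA //=; lia.
Qed.

Definition scal_top_span n : J n -> Prop :=
  match n with
  | n'.+2 => fun x => exists (c : F) y, top_span y /\ x = c%:S + y
  | _ => fun x => exists c : F, x = c%:S
  end.

(** Write [f] for the last generator and [f'] for the previous one. A scalar part of [c] gives a
    multiple of [f f]; a term [b f' b'] has [b] and [b'] commuting with [f], so
    [f b f' b' f = b f f' f b' = b f b']. *)
Lemma jgen_inc_jgen n c : scal_top_span c ->
  top_span (jgen n.+2 n * inc n.+1 c * jgen n.+2 n).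
Proof.
have [f_sq f_up f_dn f_far] := jgen_relations n.+2.
have sq a : top_span (jgen n.+2 n * inc n.+1 a%:S * jgen n.+2 n).
  rewrite inc_alg -scalC -mulrA f_sq //.
  by do 2!apply: top_span_scal; apply: top_span_jgen.
case: n => [|n] in c f_sq f_up f_dn f_far sq *; first by case=> a ->.
case=> a [y [sy ->]]; rewrite rmorphD mulrDr mulrDl; apply: top_span_add => //.
elim: sy => [b b'||x z _ sx _ sz].
- rewrite !rmorphM inc_gen //= !mulrA jgen_top_comm -!mulrA -jgen_top_comm.
  rewrite [jgen _ n * _]mulrA [jgen _ n.+1 * (_ * _)]mulrA [jgen _ n.+1 * (_ * _)]mulrA f_dn //.
  by rewrite jgen_top_comm; apply/top_span_incl/top_span_incl/top_span_jgen.
- by rewrite rmorph0 mulr0 mul0r; apply: top_span_0.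
- by rewrite rmorphD mulrDr mulrDl; apply: top_span_add.
Qed.

Lemma top_span_jgenl n : (forall c : J n.+1, scal_top_span c) ->
  forall i x, (i <= n)%N -> top_span x -> top_span (jgen n.+2 i * x).
Proof.
move=> S1 i x le_in sx; have [Ei|ne] := eqVneq i n; last first.
  by rewrite -inc_gen /=; [apply: top_span_incl | lia].
rewrite Ei; elim: sx => [b b'||y z _ sy _ sz].
- by rewrite !mulrA; apply/top_span_incr/jgen_inc_jgen.
- by rewrite mulr0; apply: top_span_0.
- by rewrite mulrDr; apply: top_span_add.
Qed.

Lemma scal_top_spanP n (x : J n) : scal_top_span x.
Proof.
elim: n x => [|[|n] IHn].
1,2: elim/Jones_ind=> [|x y [a ->] [b ->]|a x [b ->]|//].
1,4: by exists 1; rewrite rmorph1.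
1,3: by exists (a + b); rewrite rmorphD.
1,2: by exists (a * b); rewrite rmorphM.
elim/Jones_ind=> [|_ _ [a [x [sx ->]]] [b [y [sy ->]]]|a _ [b [x [sx ->]]]|i _ im [b [x [sx ->]]]].
- by exists 1, 0; split; [apply: top_span_0 | rewrite rmorph1 addr0].
- exists (a + b), (x + y); split; first exact: top_span_add.
  by rewrite rmorphD addrACA.
- exists (a * b), (a%:S * x); split; first exact: top_span_scal.
  by rewrite rmorphM mulrDr.
exists 0, (jgen n.+2 i * (b%:S + x)); split; last by rewrite rmorph0 add0r.
rewrite mulrDr -scalC; apply: top_span_add; first by apply/top_span_scal/top_span_jgen.
exact: top_span_jgenl.
Qed.

Lemma top_span_mull n (x y : J n.+2) : top_span y -> top_span (x * y).
Proof.
elim/Jones_ind: x y => [y|x z IHx IHz y sy|a x IHx y sy|i x im IHx y sy].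
- by rewrite mul1r.
- by rewrite mulrDl; apply: top_span_add; [apply: IHx|apply: IHz].
- by rewrite -mulrA; apply/top_span_scal/IHx.
- by rewrite -mulrA; apply: top_span_jgenl (IHx _ sy) => // c; apply: scal_top_spanP.
Qed.

Lemma top_span_mulr n (x y : J n.+2) : top_span y -> top_span (y * x).
Proof.
move=> sy; have [c [z [sz ->]]] := scal_top_spanP x.
rewrite mulrDr -scalC; apply: top_span_add; first exact: top_span_scal.
exact: top_span_mull.
Qed.

Lemma Jones_one_top_span n : (l.-1 <= n.+2)%N -> top_span (1 : J n.+2).
Proof.
move=> ln; elim: (Jones_one_in_ideal ln) => [_ [i im ->]||x y _ sx _ sy|a x _ sx|a x _ sx].
- exact: top_span_jgen.
- exact: top_span_0.
- exact: top_span_add.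
- exact: top_span_mull.
- exact: top_span_mulr.
Qed.

Lemma ent_sum n (I : Type) (r : seq I) (P : pred I) (M : I -> 'M[F]_(size (paths l n))) s t :
  ent (\sum_(i <- r | P i) M i) s t = \sum_(i <- r | P i) ent (M i) s t.
Proof. by apply: (big_morph (fun M => ent M s t)) => [M1 M2|]; rewrite ?entD ?ent0. Qed.

Lemma jrepZ n a x : jrep n (a%:S * x) = a *: jrep n x.
Proof. by rewrite rmorphM jrep_alg -mul_scalar_mx. Qed.

Lemma jrep_block n x s t : s \in paths l n -> t \in paths l n ->
  head 0%N t != head 0%N s -> ent (jrep n x) s t = 0.
Proof.
elim/Jones_ind: x s t => [|x y Ix Iy|a x Ix|i x im Ix] s t ps pt st.
- by rewrite rmorph1 ent1 //; case: (s =P t) st => // ->; rewrite eqxx.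
- by rewrite rmorphD entD Ix // Iy // addr0.
- by rewrite jrepZ entZ Ix // mulr0.
rewrite rmorphM jrep_gen // [LHS]entM // big_seq big1 // => u pu.
have [ut|ut] := eqVneq (head 0%N t) (head 0%N u); last by rewrite Ix // mulr0.
have il : (i.+1 < n)%N by lia.
have [_ hd] := gen_local q hl il; rewrite ent_pmat //.
have [->|nz] := eqVneq (op_at q l (n - i.+2) (dirac F u) s) 0; first by rewrite mul0r.
by move: st; rewrite ut (hd s u) ?eqxx.
Qed.

Lemma jrep_inc n x a s b t :
  a :: s \in paths l n.+1 -> b :: t \in paths l n.+1 ->
  ent (jrep n.+1 (inc n x)) (a :: s) (b :: t) = (b == a)%:R * ent (jrep n x) s t.
Proof.
elim/Jones_ind: x a s b t => [|x y Ix Iy|c x Ix|i x im Ix] a s b t pas pbt.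
- rewrite !rmorph1 ent1 //; move: pas pbt; rewrite !mem_pathsS => /andP[ps _] /andP[pt _].
  by rewrite ent1 // -natrM mulnb eqseq_cons eq_sym.
- by rewrite !rmorphD !entD Ix // Iy // mulrDr.
- by rewrite rmorphM inc_alg !jrepZ !entZ Ix // mulrCA.
rewrite !rmorphM inc_gen // !jrep_gen //; last by lia.
have [ps as0] : s \in paths l n /\ a \in nbrs l (head 0%N s).
  by apply/andP; rewrite -mem_pathsS.
have [pt _] : t \in paths l n /\ b \in nbrs l (head 0%N t).
  by apply/andP; rewrite -mem_pathsS.
have il : (i.+1 < n)%N by lia.
rewrite [LHS]entM // [in RHS]entM // big_pathsS mulr_sumr big_seq [RHS]big_seq.
apply: eq_bigr => u pu.
have -> : \sum_(c <- nbrs l (head 0%N u)) ent (gen_mx q l n.+1 i) (a :: s) (c :: u) *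
     ent (jrep n.+1 (inc n x)) (c :: u) (b :: t)
  = \sum_(c <- nbrs l (head 0%N u)) (a == c)%:R *
      ((b == c)%:R * (ent (gen_mx q l n i) s u * ent (jrep n x) u t)).
  rewrite big_seq [RHS]big_seq; apply: eq_bigr => c cu.
  have pcu : c :: u \in paths l n.+1 by rewrite mem_pathsS pu.
  by rewrite gen_mxS // Ix // [c == a]eq_sym; ring.
have [_ hd] := gen_local q hl il; rewrite [ent (gen_mx _ _ _ _) s u]ent_pmat // /=.
have [->|nz] := eqVneq (op_at q l (n - i.+2) (dirac F u) s) 0.
  by rewrite !mul0r mulr0 big1 // => c _; rewrite !mulr0.
by rewrite big_delta ?nbrs_uniq // (hd s u).
Qed.

Definition jinj n := forall x, jrep n x = 0 -> x = 0.

Definition jsurj n := forall M : 'M[F]_(size (paths l n)),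
  (forall s t, s \in paths l n -> t \in paths l n -> head 0%N t != head 0%N s ->
    ent M s t = 0) -> exists x, jrep n x = M.

Definition is_unit n s t (x : J n) := forall u v, u \in paths l n -> v \in paths l n ->
  ent (jrep n x) u v = (u == s)%:R * (v == t)%:R.

Definition unit_system n (e : seq nat -> seq nat -> J n) :=
  forall s t, s \in paths l n -> t \in paths l n -> head 0%N s = head 0%N t ->
    is_unit s t (e s t).

Lemma jinj_eq n x y : jinj n ->
  (forall s t, s \in paths l n -> t \in paths l n ->
    ent (jrep n x) s t = ent (jrep n y) s t) -> x = y.
Proof.
move=> inj xy; apply/eqP; rewrite -subr_eq0; apply/eqP/inj.
by rewrite rmorphB (entP xy) subrr.
Qed.

Lemma unit_system_exists n : jsurj n -> exists e, @unit_system n e.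
Proof.
move=> surj.
have H (p : seq nat * seq nat) : exists x : J n,
    p.1 \in paths l n -> p.2 \in paths l n -> head 0%N p.1 = head 0%N p.2 -> is_unit p.1 p.2 x.
  case: p => s t /=.
  have [st|st] := eqVneq (head 0%N s) (head 0%N t); last first.
    by exists 0 => _ _ E; rewrite E eqxx in st.
  have [|x xE] := surj (@pmat F l n (fun u v => (u == s)%:R * (v == t)%:R)).
    move=> u v pu pv uv; rewrite ent_pmat //.
    case: (u =P s) uv => [->|_]; last by rewrite mul0r.
    by case: (v =P t) => [->|_]; rewrite ?mulr0 // st eqxx.
  by exists x => _ _ _ u v pu pv; rewrite xE ent_pmat.
have [e eP] := choice H.
by exists (fun s t => e (s, t)) => s t ps pt st; apply: (eP (s, t)).
Qed.

Lemma unit_mull n s t (e : J n) x u v : is_unit s t e -> t \in paths l n ->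
  u \in paths l n -> v \in paths l n ->
  ent (jrep n (e * x)) u v = (u == s)%:R * ent (jrep n x) t v.
Proof.
move=> eU pt pu pv; rewrite rmorphM [LHS]entM // -(big_delta (fun y => ent (jrep n x) y v) (paths_uniq l n) pt).
rewrite mulr_sumr big_seq [RHS]big_seq; apply: eq_bigr => y py.
by rewrite eU // [t == y]eq_sym mulrA.
Qed.

Lemma unit_mulr n s t (e : J n) x u v : is_unit s t e -> s \in paths l n ->
  u \in paths l n -> v \in paths l n ->
  ent (jrep n (x * e)) u v = (v == t)%:R * ent (jrep n x) u s.
Proof.
move=> eU ps pu pv; rewrite rmorphM [LHS]entM // -(big_delta (fun y => ent (jrep n x) u y) (paths_uniq l n) ps).
rewrite mulr_sumr big_seq [RHS]big_seq; apply: eq_bigr => y py.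
by rewrite eU // [s == y]eq_sym; ring.
Qed.

(** By injectivity, an element is the combination of matrix units whose coefficients are its own
    entries; entries between different end points vanish. *)
Lemma unit_system_ind n e (P : J n -> Prop) : jinj n -> unit_system e ->
  P 0 -> (forall x y, P x -> P y -> P (x + y)) ->
  (forall a x, P x -> P (a%:S * x)) ->
  (forall s t, s \in paths l n -> t \in paths l n -> head 0%N s = head 0%N t ->
    P (e s t)) -> forall x, P x.
Proof.
move=> inj eU P0 PD PZ Pe x.
have -> : x = \sum_(s <- paths l n) \sum_(t <- paths l n)
    (if head 0%N s == head 0%N t then (ent (jrep n x) s t)%:S * e s t else 0).
  apply: (jinj_eq inj) => u v pu pv; rewrite rmorph_sum ent_sum.
  transitivity (\sum_(s <- paths l n) (u == s)%:R * (\sum_(t <- paths l n)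
     (v == t)%:R * (ent (jrep n x) s t))).
    by rewrite big_delta ?paths_uniq // big_delta ?paths_uniq.
  rewrite big_seq [RHS]big_seq; apply: eq_bigr => s ps.
  rewrite rmorph_sum ent_sum mulr_sumr big_seq [RHS]big_seq; apply: eq_bigr => t pt.
  case: ifPn => [/eqP st|st].
    by rewrite jrepZ entZ (eU s t) //; ring.
  by rewrite rmorph0 ent0 jrep_block ?mulr0 // eq_sym.
rewrite big_seq; elim/big_ind: _ => // s ps.
rewrite big_seq; elim/big_ind: _ => // t pt.
by case: eqP => // st; apply/PZ/Pe.
Qed.

Lemma jsurj_of_units n :
  (forall s t, s \in paths l n -> t \in paths l n -> head 0%N s = head 0%N t ->
    exists x : J n, is_unit s t x) -> jsurj n.
Proof.
move=> units M Mblock.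
have H (p : seq nat * seq nat) : exists x : J n,
    p.1 \in paths l n -> p.2 \in paths l n -> forall u v, u \in paths l n -> v \in paths l n ->
    ent (jrep n x) u v = (u == p.1)%:R * ((v == p.2)%:R * ent M p.1 p.2).
  case: p => s t /=; case ps: (s \in paths l n); last by exists 0.
  case pt: (t \in paths l n); last by exists 0.
  have [st|st] := eqVneq (head 0%N t) (head 0%N s); last first.
    by exists 0 => _ _ u v pu pv; rewrite rmorph0 ent0 Mblock // !mulr0.
  have [x xU] := units s t ps pt (esym st).
  by exists ((ent M s t)%:S * x) => _ _ u v pu pv; rewrite jrepZ entZ xU // mulrC mulrA.
have [e eP] := choice H.
exists (\sum_(s <- paths l n) \sum_(t <- paths l n) e (s, t)).
apply: entP => u v pu pv; rewrite rmorph_sum ent_sum.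
rewrite -(big_delta (fun s => ent M s v) (paths_uniq l n) pu) big_seq [RHS]big_seq.
apply: eq_bigr => s ps; rewrite rmorph_sum ent_sum.
rewrite -(big_delta (fun t => ent M s t) (paths_uniq l n) pv) mulr_sumr big_seq [RHS]big_seq.
by apply: eq_bigr => t pt; rewrite eP.
Qed.

(** Elements coming from [J n] commute with the last generator, so [c] crosses it. *)
Lemma top_span_shift n (x y : J n.+1) (c d : J n) :
  inc n.+1 (x * inc n c) * jgen n.+2 n * inc n.+1 (inc n d * y)
    = inc n.+1 x * jgen n.+2 n * inc n.+1 (inc n (c * d) * y).
Proof. by rewrite !rmorphM -[inc n.+1 x * _ * _]mulrA -jgen_top_comm !mulrA. Qed.

Section Step.
Variables (n : nat) (e0 : seq nat -> seq nat -> J n) (e1 : seq nat -> seq nat -> J n.+1).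
Hypotheses (inj0 : jinj n) (inj1 : jinj n.+1) (U0 : unit_system e0) (U1 : unit_system e1).

Let f := jgen n.+2 n.

(** With [k] the end point of [w], this is [wt k (head t)] times the matrix unit between [k :: s]
    and [k :: t], as [basis_eltE] shows; [w] matters only through [k]. *)
Definition basis_elt (w s t : seq nat) : J n.+2 :=
  inc n.+1 (e1 s (head 0%N s :: w)) * f * inc n.+1 (e1 (head 0%N t :: w) t).

(** An included matrix unit of level [n] replaces the tail of a path and leaves its last step
    alone. *)
Lemma inc_unit_mull s a w t : s \in paths l n.+1 -> head 0%N s = a ->
  a :: w \in paths l n.+1 -> a :: t \in paths l n.+1 -> head 0%N w = head 0%N t ->
  e1 s (a :: t) = e1 s (a :: w) * inc n (e0 w t).
Proof.
move=> ps sa paw pat wt; apply: (jinj_eq inj1) => u v pu pv.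
rewrite (unit_mull _ (U1 ps paw _)) // U1 //; congr (_ * _).
case: v pv => [|c v] pv; first by rewrite paths_nil in pv.
rewrite jrep_inc // eqseq_cons -mulnb natrM; congr (_ * _).
move: paw pat pv; rewrite !mem_pathsS => /andP[pw _] /andP[pt _] /andP[pv _].
by rewrite U0 // eqxx mul1r.
Qed.

Lemma inc_unit_mulr s a w t : s \in paths l n.+1 -> head 0%N s = a ->
  a :: w \in paths l n.+1 -> a :: t \in paths l n.+1 -> head 0%N w = head 0%N t ->
  e1 (a :: t) s = inc n (e0 t w) * e1 (a :: w) s.
Proof.
move=> ps sa paw pat wt; apply: (jinj_eq inj1) => u v pu pv.
rewrite (unit_mulr _ (U1 paw ps _)) // U1 // mulrC; congr (_ * _).
case: u pu => [|c u] pu; first by rewrite paths_nil in pu.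
rewrite jrep_inc // eqseq_cons -mulnb natrM [c == a]eq_sym; congr (_ * _).
move: paw pat pu; rewrite !mem_pathsS => /andP[pw _] /andP[pt _] /andP[pu _].
by rewrite U0 // eqxx mulr1.
Qed.

Lemma unit0_mul s t u v : s \in paths l n -> t \in paths l n ->
  u \in paths l n -> v \in paths l n -> head 0%N s = head 0%N t ->
  head 0%N u = head 0%N v ->
  e0 s t * e0 u v = if t == u then e0 s v else 0.
Proof.
move=> ps pt pu pv st uv; apply: (jinj_eq inj0) => x y px py.
rewrite (unit_mull _ (U0 ps pt st)) // U0 //; case: (t =P u) => [tu|_].
  by rewrite mul1r U0 // st tu.
by rewrite mul0r mulr0 rmorph0 ent0.
Qed.

(** The tails [t] and [u] are moved to the same side of [f] and multiplied as matrix units of level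
    [n]. The product is 0 unless they agree, and then any [w] with the same end point can take their
    place. This is what bounds the size of the span. *)
Lemma top_span_reduce a b s t u v w :
  s \in paths l n.+1 -> head 0%N s = a -> a :: t \in paths l n.+1 ->
  v \in paths l n.+1 -> head 0%N v = b -> b :: u \in paths l n.+1 ->
  w \in paths l n -> head 0%N w = head 0%N t ->
  inc n.+1 (e1 s (a :: t)) * f * inc n.+1 (e1 (b :: u) v)
    = if t == u then basis_elt w s v else 0.
Proof.
move=> ps sa pat pv vb pbu pw wt.
have [pt aN] : t \in paths l n /\ a \in nbrs l (head 0%N t) by apply/andP; rewrite -mem_pathsS.
have [pu bN] : u \in paths l n /\ b \in nbrs l (head 0%N u) by apply/andP; rewrite -mem_pathsS.
have paw : a :: w \in paths l n.+1 by rewrite mem_pathsS pw wt.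
rewrite (inc_unit_mull ps sa paw pat wt) (inc_unit_mulr pv vb pbu pbu (erefl _)).
rewrite top_span_shift unit0_mul // /basis_elt sa vb; case: eqP => [tu|_].
  by rewrite -(inc_unit_mulr pv vb _ _ _) // -?tu // mem_pathsS pw wt tu.
by rewrite rmorph0 mul0r rmorph0 !mulr0.
Qed.

Lemma inc_unit_entl s t x s1 M z : s \in paths l n.+1 -> t \in paths l n.+1 ->
  head 0%N s = head 0%N t -> x :: s1 \in paths l n.+2 -> z \in paths l n.+2 ->
  ent (jrep n.+2 (inc n.+1 (e1 s t)) *m M) (x :: s1) z
    = (s1 == s)%:R * ent M (x :: t) z.
Proof.
move=> ps pt st pxs pz; rewrite entM // big_pathsS.
have [ps1 xs1] : s1 \in paths l n.+1 /\ x \in nbrs l (head 0%N s1).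
  by apply/andP; rewrite -mem_pathsS.
transitivity ((s1 == s)%:R * \sum_(u <- paths l n.+1) (t == u)%:R *
    \sum_(c <- nbrs l (head 0%N u)) (x == c)%:R * ent M (c :: u) z).
  rewrite mulr_sumr big_seq [RHS]big_seq; apply: eq_bigr => u pu.
  rewrite !mulr_sumr big_seq [RHS]big_seq; apply: eq_bigr => c cu.
  rewrite jrep_inc ?mem_pathsS ?pu // -?mem_pathsS // U1 //.
  by rewrite [c == x]eq_sym [u == t]eq_sym; ring.
case: (s1 =P s) => [E|_]; last by rewrite !mul0r.
by rewrite big_delta ?paths_uniq // big_delta ?nbrs_uniq // -st -E.
Qed.

Lemma inc_unit_entr s t y s1 M z : s \in paths l n.+1 -> t \in paths l n.+1 ->
  head 0%N s = head 0%N t -> y :: s1 \in paths l n.+2 -> z \in paths l n.+2 ->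
  ent (M *m jrep n.+2 (inc n.+1 (e1 t s))) z (y :: s1)
    = (s1 == s)%:R * ent M z (y :: t).
Proof.
move=> ps pt st pys pz; rewrite entM // big_pathsS.
have [ps1 ys1] : s1 \in paths l n.+1 /\ y \in nbrs l (head 0%N s1).
  by apply/andP; rewrite -mem_pathsS.
transitivity ((s1 == s)%:R * \sum_(u <- paths l n.+1) (t == u)%:R *
    \sum_(c <- nbrs l (head 0%N u)) (y == c)%:R * ent M z (c :: u)).
  rewrite mulr_sumr big_seq [RHS]big_seq; apply: eq_bigr => u pu.
  rewrite !mulr_sumr big_seq [RHS]big_seq; apply: eq_bigr => c cu.
  rewrite jrep_inc ?mem_pathsS ?pu // -?mem_pathsS // U1 //.
  by rewrite [u == t]eq_sym; ring.
case: (s1 =P s) => [E|_]; last by rewrite !mul0r.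
by rewrite big_delta ?paths_uniq // big_delta ?nbrs_uniq // -st -E.
Qed.

Lemma basis_eltE k w s t u v : w \in paths l n -> head 0%N w = k ->
  s \in paths l n.+1 -> t \in paths l n.+1 ->
  head 0%N s \in nbrs l k -> head 0%N t \in nbrs l k ->
  u \in paths l n.+2 -> v \in paths l n.+2 ->
  ent (jrep n.+2 (basis_elt w s t)) u v
    = (u == k :: s)%:R * ((v == k :: t)%:R * wt q k (head 0%N t)).
Proof.
move=> pw wk ps pt sk tk; case: u => [|x s1]; first by rewrite paths_nil.
case: v => [|y t1] pxs pyt; first by rewrite paths_nil in pyt.
have psw : head 0%N s :: w \in paths l n.+1 by rewrite mem_pathsS pw wk.
have ptw : head 0%N t :: w \in paths l n.+1 by rewrite mem_pathsS pw wk.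
rewrite !rmorphM jrep_gen //.
rewrite inc_unit_entr // !eqseq_cons.
case: (t1 =P t) pyt => [->|_] pyt; last by rewrite andbF !mul0r mulr0.
have pyw : y :: head 0%N t :: w \in paths l n.+2.
  by move: pyt; rewrite !mem_pathsS pw wk tk /= => /andP[].
rewrite inc_unit_entl //.
case: (s1 =P s) pxs => [->|_] pxs; last by rewrite andbF !mul0r mulr0.
have pxw : x :: head 0%N s :: w \in paths l n.+2.
  by move: pxs; rewrite !mem_pathsS pw wk sk /= => /andP[].
rewrite !mul1r gen_mx_top // eqxx wk !andbT.
case: (x =P k) => [->|_] /=; last by rewrite mul0r.
by case: (y == k); rewrite ?mul1r ?mul0r.
Qed.

(** A fixed choice of [w] for each end point, which reduces the [basis_elt] to a family indexed by
    pairs of paths. *)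
Definition end_path k : seq nat :=
  nth [::] (paths l n) (find (fun w => head 0%N w == k) (paths l n)).

Lemma end_pathP t : t \in paths l n ->
  end_path (head 0%N t) \in paths l n /\ head 0%N (end_path (head 0%N t)) = head 0%N t.
Proof.
move=> pt; have H : has (fun w => head 0%N w == head 0%N t) (paths l n).
  by apply/hasP; exists t.
split; first by rewrite mem_nth // -has_find.
by apply/eqP; apply: (nth_find [::] H).
Qed.

(* A left inverse of [jrep] on the span of the [a f_n b]. *)
Definition recover (M : 'M[F]_(size (paths l n.+2))) : J n.+2 :=
  \sum_(u <- paths l n.+2) \sum_(v <- paths l n.+2)
    (ent M u v / wt q (head 0%N u) (head 0%N (behead v)))%:S
      * basis_elt (end_path (head 0%N u)) (behead u) (behead v).

Lemma recoverD M M' : recover (M + M') = recover M + recover M'.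
Proof.
rewrite /recover -big_split; apply: eq_bigr => u _; rewrite -big_split.
by apply: eq_bigr => v _; rewrite entD mulrDl rmorphD mulrDl.
Qed.

Lemma recoverZ a M : recover (a *: M) = a%:S * recover M.
Proof.
rewrite /recover mulr_sumr; apply: eq_bigr => u _; rewrite mulr_sumr.
by apply: eq_bigr => v _; rewrite entZ -mulrA rmorphM mulrA.
Qed.

Lemma recover0 : recover 0 = 0.
Proof. by rewrite -(scale0r (0 : 'M_(size (paths l n.+2)))) recoverZ rmorph0 mul0r. Qed.

Lemma recover_basis k w s t : w \in paths l n -> head 0%N w = k ->
  w = end_path k -> s \in paths l n.+1 -> t \in paths l n.+1 ->
  head 0%N s \in nbrs l k -> head 0%N t \in nbrs l k ->
  recover (jrep n.+2 (basis_elt w s t)) = basis_elt w s t.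
Proof.
move=> pw wk wE ps pt sk tk.
have kl : (k.+1 < l)%N by have [_ _] := head_path pw; rewrite wk; apply; lia.
have ks a : a \in nbrs l k -> k \in nbrs l a.
  by rewrite !mem_nbrs kl orbC => /andP[_ ->].
have pks : k :: s \in paths l n.+2 by rewrite mem_pathsS ps ks.
have pkt : k :: t \in paths l n.+2 by rewrite mem_pathsS pt ks.
have nz : wt q k (head 0%N t) != 0.
  by apply: (wt_neq0 q0 hl hql) => //; move: tk; rewrite mem_nbrs => /andP[].
rewrite /recover.
transitivity (\sum_(u <- paths l n.+2) (k :: s == u)%:R *
  (\sum_(v <- paths l n.+2) (k :: t == v)%:R *
    ((wt q k (head 0%N t) / wt q (head 0%N u) (head 0%N (behead v)))%:S
      * basis_elt (end_path (head 0%N u)) (behead u) (behead v)))).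
  rewrite big_seq [RHS]big_seq; apply: eq_bigr => u pu.
  rewrite mulr_sumr big_seq [RHS]big_seq; apply: eq_bigr => v pv.
  rewrite (basis_eltE pw wk) // [k :: s == u]eq_sym [k :: t == v]eq_sym.
  by rewrite -!mulrA !rmorphM !rmorph_nat -!mulrA.
by rewrite !big_delta ?paths_uniq //= divff // rmorph1 mul1r -wE.
Qed.

(** By linearity both outer factors may be matrix units; [top_span_reduce] then leaves 0 or a single
    [basis_elt], which [recover] fixes. *)
Lemma recover_top_span x : top_span x -> recover (jrep n.+2 x) = x.
Proof.
elim=> [a b||y z _ Ry _ Rz]; last by rewrite rmorphD recoverD Ry Rz.
  pose R := fun a b => recover (jrep n.+2 (inc n.+1 a * jgen n.+2 n * inc n.+1 b))
    = inc n.+1 a * jgen n.+2 n * inc n.+1 b.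
  move: a; apply: (unit_system_ind (P := R^~ b) inj1 U1); rewrite /R; [|move=> a a' Ra Ra'|move=> c a Ra|move=> s t ps pt st].
  - by rewrite rmorph0 !mul0r rmorph0 recover0.
  - by rewrite rmorphD !mulrDl rmorphD recoverD Ra Ra'.
  - by rewrite (rmorphM (inc n.+1)) inc_alg -!(mulrA c%:S) jrepZ recoverZ Ra.
  move: b; apply: (unit_system_ind (P := R (e1 s t)) inj1 U1); rewrite /R; [|move=> b b' Rb Rb'|move=> c b Rb|move=> u v pu pv uv].
  - by rewrite rmorph0 !mulr0 rmorph0 recover0.
  - by rewrite rmorphD !mulrDr rmorphD recoverD Rb Rb'.
  - by rewrite (rmorphM (inc n.+1)) inc_alg scal_mulrCA jrepZ recoverZ Rb.
  case: t pt st => [|a t] pat sa; first by rewrite paths_nil in pat.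
  case: u pu uv => [|b u] pbu bv; first by rewrite paths_nil in pbu.
  have [pt aN] : t \in paths l n /\ a \in nbrs l (head 0%N t) by apply/andP; rewrite -mem_pathsS.
  have [pu bN] : u \in paths l n /\ b \in nbrs l (head 0%N u) by apply/andP; rewrite -mem_pathsS.
  have [pw hw] := end_pathP pt.
  rewrite (top_span_reduce ps sa pat pv (esym bv) pbu pw hw).
  case: eqP => [tu|_]; last by rewrite rmorph0 recover0.
  by apply: (recover_basis (k := head 0%N t)); rewrite // ?sa // -bv tu.
by rewrite rmorph0 recover0.
Qed.

(** The straight path is the only one with its end point, so multiplication on the left stays on its
    row; it does not backtrack, so that row of the last generator is 0. *)
Lemma jrep_straight_top_span y t : (n.+3 < l)%N -> top_span y -> t \in paths l n.+2 ->
  ent (jrep n.+2 y) (straight n.+2) t = 0.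
Proof.
move=> nl sy pt; have pst := straight_paths nl.
elim: sy => [a b||x z _ Ex _ Ez]; last by rewrite rmorphD entD Ex Ez addr0.
  rewrite -mulrA rmorphM [LHS]entM // big_seq big1 // => u pu.
  have [hu|hu] := eqVneq (head 0%N u) (head 0%N (straight n.+2)); last first.
    by rewrite jrep_block // mul0r.
  rewrite (head_path_max pu hu) rmorphM jrep_gen // [X in _ * X]entM //.
  rewrite [X in _ * X]big_seq [X in _ * X]big1 ?mulr0 // => v pv.
  case: v pv => [|k [|m v]] pv; first by rewrite paths_nil in pv.
    by rewrite mem_pathsS paths_nil in pv.
  rewrite gen_mx_top // head_straight; case: eqP => [|_ /=]; first by lia.
  by rewrite mul0r.
by rewrite rmorph0 ent0.
Qed.

(** [recover] settles the span, so only the scalar part is at stake. If [n + 2 >= l - 1], then 1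
    lies in the span; otherwise the diagonal entry at the straight path reads the scalar off. *)
Lemma jinj_step : jinj n.+2.
Proof.
move=> x x0; have [c [y [sy xE]]] := scal_top_spanP x.
have [ln|ln] := leqP l.-1 n.+2.
  suff sx : top_span x by rewrite -(recover_top_span sx) x0 recover0.
  rewrite xE; apply: top_span_add => //; rewrite -[c%:S]mulr1.
  exact/top_span_scal/Jones_one_top_span.
have nl : (n.+3 < l)%N by lia.
have pst := straight_paths nl.
have := congr1 (fun M => ent M (straight n.+2) (straight n.+2)) x0.
rewrite xE -[c%:S]mulr1 rmorphD jrepZ rmorph1 entD entZ ent1 // eqxx.
rewrite jrep_straight_top_span // ent0 addr0 mulr1 => c0.
have {}c0 : c = 0 by move: c0; rewrite mulr1.
have sx : top_span x by rewrite xE c0 rmorph0 add0r.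
by rewrite -xE -(recover_top_span sx) x0 recover0.
Qed.

Lemma unit_of_basis k s t w : k :: s \in paths l n.+2 -> k :: t \in paths l n.+2 ->
  w \in paths l n -> head 0%N w = k -> exists x : J n.+2, is_unit (k :: s) (k :: t) x.
Proof.
rewrite !mem_pathsS => /andP[ps ks] /andP[pt kt] pw wk.
have kN a : k \in nbrs l a -> (a.+1 < l)%N -> a \in nbrs l k.
  by rewrite !mem_nbrs orbC => /andP[_ ->] ->.
have [_ _ /(_ (ltnW hl)) sl] := head_path ps.
have [_ _ /(_ (ltnW hl)) tl] := head_path pt.
have [_ _ /(_ (ltnW hl))] := head_path pw; rewrite wk => kl.
have nz : wt q k (head 0%N t) != 0 by apply: (wt_neq0 q0 hl hql).
exists ((wt q k (head 0%N t))^-1%:S * basis_elt w s t) => u v pu pv.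
rewrite jrepZ entZ (basis_eltE pw wk) ?kN //.
by rewrite mulrC -!mulrA divff // mulr1.
Qed.

(** An end point [k != n + 2] is also the end point of a path of length [n], so a [basis_elt] gives
    the unit up to a nonzero weight. For [k = n + 2] the straight path is alone, and its unit is 1
    minus all the other diagonal units. *)
Lemma jsurj_step : jsurj n.+2.
Proof.
have low k s t : k :: s \in paths l n.+2 -> k :: t \in paths l n.+2 -> k != n.+2 ->
    exists x : J n.+2, is_unit (k :: s) (k :: t) x.
  move=> pks pkt kn; have [/= k_le k_od /(_ (ltnW hl)) kl] := head_path pks.
  have [||w pw wk] := @path_to l n k hl _ _ kl; last exact: unit_of_basis pks pkt pw wk.
    by move: k_le k_od kn; rewrite leq_eqVlt => /orP[/eqP->|]; [rewrite eqxx | lia].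
  by move: k_od; lia.
apply: jsurj_of_units => -[|k s] [|k' t] ps pt //=; rewrite ?paths_nil // in ps pt *.
move=> E; rewrite -{k'}E in pt *; have [Ek|kn] := eqVneq k n.+2; last exact: low.
have sE := head_path_max ps Ek; have tE := head_path_max pt Ek.
have H (u : seq nat) : exists x : J n.+2, u \in paths l n.+2 -> u != straight n.+2 ->
    is_unit u u x.
  case pu: (u \in paths l n.+2); last by exists 0.
  have [Eu|us] := eqVneq u (straight n.+2); first by exists 0 => _ /eqP.
  case: u => [|a u] in pu us *; first by rewrite paths_nil in pu.
  have [|x xU] := low a u u pu pu; last by exists x.
  by apply: contra us => /eqP an; rewrite -(head_path_max pu an).
have [e eP] := choice H.
exists (1 - \sum_(u <- paths l n.+2 | u != straight n.+2) e u) => u v pu pv.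
rewrite rmorphB rmorph1 -scaleN1r entD entZ ent1 // rmorph_sum ent_sum sE tE.
have -> : \sum_(i <- paths l n.+2 | i != straight n.+2) ent (jrep n.+2 (e i)) u v
  = \sum_(i <- paths l n.+2) (u == i)%:R * ((v == i)%:R * (i != straight n.+2)%:R).
  rewrite big_mkcond big_seq [RHS]big_seq; apply: eq_bigr => i pi.
  by case: ifP => ist; rewrite ?mulr0 // eP // mulr1.
rewrite big_delta ?paths_uniq // mulN1r [v == u]eq_sym.
case: (u =P straight n.+2) => [->|_] /=; first by rewrite mulr0 subr0 mul1r eq_sym.
by rewrite mulr1 subrr mul0r.
Qed.
End Step.

Lemma paths_small n : (n <= 1)%N -> paths l n = [:: straight n].
Proof. by case: n => [|[|]] //= _; rewrite /nbrs /= hl. Qed.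

Lemma jrep_small n : (n <= 1)%N -> jinj n /\ jsurj n.
Proof.
move=> n1; have pst : straight n \in paths l n by rewrite paths_small // inE.
have pE s : s \in paths l n -> s = straight n by rewrite paths_small // inE => /eqP.
split=> [x x0|M _].
  have [c xE] : exists c : F, x = c%:S.
    by case: n n1 x {pst pE x0} (scal_top_spanP x) => [|[|]].
  have := congr1 (fun M => ent M (straight n) (straight n)) x0.
  rewrite xE -[c%:S]mulr1 jrepZ rmorph1 entZ ent1 // eqxx ent0 => c0.
  have {}c0 : c = 0 by move: c0; rewrite mulr1.
  by rewrite c0 rmorph0 mul0r.
exists (ent M (straight n) (straight n))%:S; apply: entP => s t /pE -> /pE ->.
by rewrite -[_%:S]mulr1 jrepZ rmorph1 entZ ent1 // eqxx mulr1.
Qed.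

Theorem jrep_bijective n : jinj n /\ jsurj n.
Proof.
suff [] : (jinj n /\ jsurj n) /\ (jinj n.+1 /\ jsurj n.+1) by [].
elim: n => [|n [[inj0 surj0] [inj1 surj1]]]; first by split; apply: jrep_small.
have [e0 U0] := unit_system_exists surj0; have [e1 U1] := unit_system_exists surj1.
by split=> //; split; [apply: jinj_step U0 U1 | apply: jsurj_step U1].
Qed.
End Tower.

Section JonesStructure.
Variables (F : fieldType) (q : F) (l : nat).
Hypotheses (q0 : q != 0) (hl : (3 <= l)%N) (hql : l.-primitive_root (q ^+ 2)).

Theorem Jones_path_algebra n :
  exists f : {rmorphism Jones q l n -> 'M[F]_(size (paths l n))},
    [/\ alg_morphism f, injective f
      & forall M, (exists x, f x = M) <->
          forall s t, s \in paths l n -> t \in paths l n -> head 0%N t != head 0%N s ->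
            ent M s t = 0].
Proof.
pose jr := fun n => jrep q0 hl hql n.
have ind := @Jones_ind F q l; have ia := inc_alg q0 hl hql; have ig := inc_gen q0 hl hql.
have ra := jrep_alg q0 hl hql; have rg := jrep_gen q0 hl hql.
have rel := @jgen_relations F q l; have one := Jones_one_in_ideal q0 hl hql.
have [inj surj] := jrep_bijective q0 hl hql rel ind ia ig ra rg one n.
exists (jr n); split.
- exact: ra.
- by apply: raddf_inj => x; apply: inj.
- move=> M; split=> [[x <-] s t|]; last exact: surj.
  exact: (jrep_block q0 hl hql ind ra rg).
Qed.
End JonesStructure.

(** * Modules as families of matrices *)

Section ColumnVectors.
Variable F : fieldType.

Lemma mulmx_cV_eq m n (A B : 'M[F]_(m, n)) :
  (forall v : 'cV_n, A *m v = B *m v) -> A = B.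
Proof.
move=> AB; apply/matrixP=> i j; have := congr1 (fun w : 'cV_m => w i 0) (AB (delta_mx j 0)).
by rewrite -!colE !mxE.
Qed.

Lemma mx_dim0 m n (A B : 'M[F]_(m, n)) : m = 0%N -> A = B.
Proof. by move=> m0; apply/matrixP=> i; have := ltn_ord i; rewrite {2}m0. Qed.

(** Coordinates continued by 0, so that shifting an index past the range is harmless. *)
Definition crd n (v : 'cV[F]_n) (i : nat) : F := oapp (fun j => v j 0) 0 (insub i).

Lemma crd_ord n (v : 'cV[F]_n) (i : 'I_n) : crd v i = v i 0.
Proof. by rewrite /crd valK. Qed.

Lemma crd_out n (v : 'cV[F]_n) i : (n <= i)%N -> crd v i = 0.
Proof. by move=> ni; rewrite /crd insubF // ltnNge ni. Qed.

Lemma crdP n (v w : 'cV[F]_n) : (forall i, (i < n)%N -> crd v i = crd w i) -> v = w.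
Proof.
by move=> vw; apply/matrixP=> i j; rewrite (ord1 j) -!crd_ord vw.
Qed.

Lemma crdD n (v w : 'cV[F]_n) i : crd (v + w) i = crd v i + crd w i.
Proof. by rewrite /crd; case: insub => [j|] /=; rewrite ?mxE ?addr0. Qed.

Lemma crdZ n a (v : 'cV[F]_n) i : crd (a *: v) i = a * crd v i.
Proof. by rewrite /crd; case: insub => [j|] /=; rewrite ?mxE ?mulr0. Qed.

Lemma crd0 n i : crd (0 : 'cV[F]_n) i = 0.
Proof. by rewrite /crd; case: insub => [j|] //=; rewrite mxE. Qed.

(** At most one entry in each row. The generators on Weyl modules, and the maps splitting
    [W k (x) W 1], are made of such matrices, so identities can be checked one coordinate at a
    time. *)
Definition opmx m n (phi : nat -> nat) (c : nat -> F) : 'M[F]_(m, n) :=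
  \matrix_(a, b) if b == phi a :> nat then c a else 0.

Lemma crd_opmx m n phi c (v : 'cV[F]_n) a : (a < m)%N ->
  crd (opmx m n phi c *m v) a = c a * crd v (phi a).
Proof.
move=> am; rewrite -[a in LHS]/(val (Ordinal am)) crd_ord mxE /=.
have [pn|np] := ltnP (phi a) n; last first.
  rewrite crd_out // mulr0 big1 // => b _; rewrite mxE /=.
  by case: eqP => [E|]; rewrite ?mul0r //; move: (ltn_ord b); rewrite E ltnNge np.
rewrite (bigD1 (Ordinal pn)) //= mxE eqxx -(crd_ord v (Ordinal pn)) big1 ?addr0 // => b bn.
by rewrite mxE /= -[phi a]/(val (Ordinal pn)) (inj_eq val_inj) (negPf bn) mul0r.
Qed.
End ColumnVectors.

Inductive uop := UE of nat | UF of nat | UK | UKi.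

(** No relations are imposed: morphisms, sums and cancellation involve only the matrices, and a
    tensor product can be formed without checking that it is a module. *)
Record gmod (F : fieldType) := Gmod { gdim : nat; gact : uop -> 'M[F]_gdim }.

Section GeneratorModules.
Variable F : fieldType.
Implicit Types M N P A B C : gmod F.

Definition ghom M N (f : 'M[F]_(gdim N, gdim M)) : Prop :=
  forall u, f *m gact M u = gact N u *m f.

Definition giso M N : Prop :=
  exists (f : 'M[F]_(gdim N, gdim M)) (g : 'M[F]_(gdim M, gdim N)),
    [/\ ghom f, f *m g = 1%:M & g *m f = 1%:M].

Lemma ghom1 M : ghom (1%:M : 'M_(gdim M)).
Proof. by move=> u; rewrite mul1mx mulmx1. Qed.

Lemma ghomM M N P (f : 'M_(gdim N, gdim M)) (g : 'M_(gdim P, gdim N)) :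
  @ghom N P g -> @ghom M N f -> @ghom M P (g *m f).
Proof. by move=> hg hf u; rewrite -mulmxA hf mulmxA hg mulmxA. Qed.

Lemma ghomD M N (f g : 'M_(gdim N, gdim M)) :
  @ghom M N f -> @ghom M N g -> @ghom M N (f + g).
Proof. by move=> hf hg u; rewrite mulmxDl mulmxDr hf hg. Qed.

Lemma ghomZ M N a (f : 'M_(gdim N, gdim M)) : @ghom M N f -> @ghom M N (a *: f).
Proof. by move=> hf u; rewrite -scalemxAl -scalemxAr hf. Qed.

Lemma ghom_inv M N (f : 'M_(gdim N, gdim M)) (g : 'M_(gdim M, gdim N)) :
  @ghom M N f -> f *m g = 1%:M -> g *m f = 1%:M -> @ghom N M g.
Proof.
move=> hf fg gf u.
by rewrite -[LHS]mulmx1 -fg mulmxA -[_ *m f]mulmxA -hf mulmxA gf mul1mx.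
Qed.

Lemma giso_refl M : giso M M.
Proof. by exists 1%:M, 1%:M; rewrite mulmx1; split=> //; apply: ghom1. Qed.

Lemma giso_sym M N : giso M N -> giso N M.
Proof. by move=> [f [g [hf fg gf]]]; exists g, f; split=> //; apply: ghom_inv fg gf. Qed.

Lemma giso_trans M N P : giso M N -> giso N P -> giso M P.
Proof.
move=> [f [g [hf fg gf]]] [f' [g' [hf' fg' gf']]]; exists (f' *m f), (g *m g'); split.
- exact: ghomM hf.
- by rewrite mulmxA -[_ *m f *m g]mulmxA fg mulmx1.
- by rewrite mulmxA -[_ *m g' *m f']mulmxA gf' mulmx1.
Qed.

Definition gzero : gmod F := @Gmod F 0 (fun=> 0).

Definition gdsum A B : gmod F :=
  Gmod (fun u => block_mx (gact A u) 0 0 (gact B u)).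

Definition in1 A B : 'M[F]_(gdim A + gdim B, gdim A) := col_mx 1%:M 0.
Definition in2 A B : 'M[F]_(gdim A + gdim B, gdim B) := col_mx 0 1%:M.
Definition pr1 A B : 'M[F]_(gdim A, gdim A + gdim B) := row_mx 1%:M 0.
Definition pr2 A B : 'M[F]_(gdim B, gdim A + gdim B) := row_mx 0 1%:M.

Let simp := (mulmx1, mul1mx, mulmx0, mul0mx, addr0, add0r).

Lemma ghom_in1 A B : @ghom A (gdsum A B) (in1 A B).
Proof. by move=> u /=; rewrite mul_block_col mul_col_mx !simp. Qed.
Lemma ghom_in2 A B : @ghom B (gdsum A B) (in2 A B).
Proof. by move=> u /=; rewrite mul_block_col mul_col_mx !simp. Qed.
Lemma ghom_pr1 A B : @ghom (gdsum A B) A (pr1 A B).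
Proof. by move=> u /=; rewrite mul_row_block mul_mx_row !simp. Qed.
Lemma ghom_pr2 A B : @ghom (gdsum A B) B (pr2 A B).
Proof. by move=> u /=; rewrite mul_row_block mul_mx_row !simp. Qed.

Lemma pr1_in1 A B : pr1 A B *m in1 A B = 1%:M.
Proof. by rewrite mul_row_col !simp. Qed.
Lemma pr2_in2 A B : pr2 A B *m in2 A B = 1%:M.
Proof. by rewrite mul_row_col !simp. Qed.
Lemma pr1_in2 A B : pr1 A B *m in2 A B = 0.
Proof. by rewrite mul_row_col !simp. Qed.
Lemma pr2_in1 A B : pr2 A B *m in1 A B = 0.
Proof. by rewrite mul_row_col !simp. Qed.
Lemma in_pr A B : in1 A B *m pr1 A B + in2 A B *m pr2 A B = 1%:M.
Proof. by rewrite -mul_row_col /in1 /in2 -block_mxEh -/(col_mx _ _) /pr1 /pr2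
  -block_mxEv -!scalar_mx_block mulmx1. Qed.

Lemma giso_biprod A B M (i1 : 'M_(gdim M, gdim A)) (i2 : 'M_(gdim M, gdim B)) p1 p2 :
  @ghom A M i1 -> @ghom B M i2 -> p1 *m i1 = 1%:M -> p2 *m i2 = 1%:M ->
  p1 *m i2 = 0 -> p2 *m i1 = 0 -> i1 *m p1 + i2 *m p2 = 1%:M -> giso (gdsum A B) M.
Proof.
move=> h1 h2 e11 e22 e12 e21 e; exists (row_mx i1 i2), (col_mx p1 p2); split.
- by move=> u /=; rewrite mul_row_block mul_mx_row !simp h1 h2.
- by rewrite mul_row_col.
- by rewrite mul_col_row e11 e12 e21 e22 -scalar_mx_block.
Qed.

Lemma giso_gdsum A A' B B' : giso A A' -> giso B B' -> giso (gdsum A B) (gdsum A' B').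
Proof.
move=> [f [g [hf fg gf]]] [f' [g' [hf' fg' gf']]].
exists (block_mx f 0 0 f'), (block_mx g 0 0 g'); split.
- by move=> u /=; rewrite !mulmx_block !simp hf hf'.
- by rewrite mulmx_block !simp fg fg' -scalar_mx_block.
- by rewrite mulmx_block !simp gf gf' -scalar_mx_block.
Qed.

Lemma giso_gdsumA A B C : giso (gdsum (gdsum A B) C) (gdsum A (gdsum B C)).
Proof.
apply: (@giso_biprod (gdsum A B) C (gdsum A (gdsum B C))
  (block_mx 1%:M 0 0 (in1 B C)) (col_mx 0 (in2 B C))
  (block_mx 1%:M 0 0 (pr1 B C)) (row_mx 0 (pr2 B C))).
- by move=> u /=; rewrite !mulmx_block !simp (ghom_in1 B C u).
- by move=> u /=; rewrite mul_block_col mul_col_mx !simp (ghom_in2 B C u).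
- by rewrite mulmx_block !simp pr1_in1 -scalar_mx_block.
- by rewrite mul_row_col !simp pr2_in2.
- by rewrite mul_block_col !simp pr1_in2 col_mx0.
- by rewrite mul_row_block !simp pr2_in1 row_mx0.
rewrite mulmx_block (mul_col_row 0 (in2 B C) 0 (pr2 B C)) add_block_mx !simp in_pr.
by rewrite -scalar_mx_block.
Qed.

Lemma giso_gdsumC A B : giso (gdsum A B) (gdsum B A).
Proof.
apply: (@giso_biprod A B (gdsum B A) (in2 B A) (in1 B A) (pr2 B A) (pr1 B A));
  rewrite ?pr1_in1 ?pr2_in2 ?pr1_in2 ?pr2_in1 //; [exact: ghom_in2|exact: ghom_in1|].
by rewrite addrC in_pr.
Qed.

Lemma giso_dim0 A B : gdim A = 0%N -> gdim B = 0%N -> giso A B.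
Proof.
move=> A0 B0; exists 0, 0; split=> [u||]; first by rewrite mul0mx mulmx0.
  exact: mx_dim0.
exact: mx_dim0.
Qed.

Lemma giso_gzerol A : giso (gdsum gzero A) A.
Proof.
apply: (@giso_biprod gzero A A 0 1%:M 0 1%:M); rewrite ?mulmx0 ?mul0mx ?mulmx1 ?add0r //.
- by move=> u; rewrite mul0mx mulmx0.
- exact: ghom1.
exact: mx_dim0.
Qed.

Definition gnohom A B := forall f : 'M_(gdim B, gdim A), @ghom A B f -> f = 0.

Lemma gnohom_gdsuml A B C : gnohom A C -> gnohom B C -> gnohom (gdsum A B) C.
Proof.
move=> hA hB f hf; rewrite -[f]mulmx1 -(in_pr A B) mulmxDr !mulmxA.
have -> : f *m in1 A B = 0 by apply: hA; apply: ghomM hf _; apply: ghom_in1.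
have -> : f *m in2 A B = 0 by apply: hB; apply: ghomM hf _; apply: ghom_in2.
by rewrite !mul0mx addr0.
Qed.

Lemma gnohom_gdsumr A B C : gnohom A B -> gnohom A C -> gnohom A (gdsum B C).
Proof.
move=> hB hC f hf; rewrite -[f]mul1mx -(in_pr B C) mulmxDl -!mulmxA.
have -> : pr1 B C *m f = 0 by apply: hB; apply: ghomM _ hf; apply: ghom_pr1.
have -> : pr2 B C *m f = 0 by apply: hC; apply: ghomM _ hf; apply: ghom_pr2.
by rewrite !mulmx0 addr0.
Qed.

(** The isomorphism and its inverse are both block triangular, so their first diagonal blocks are
    inverse to each other. *)
Lemma giso_cancel A A' B B' : gnohom A B' -> gnohom A' B ->
  giso (gdsum A B) (gdsum A' B') -> giso A A'.
Proof.
move=> nAB' nA'B [f [g [hf fg gf]]]; have hg := ghom_inv hf fg gf.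
have f21 : pr2 A' B' *m f *m in1 A B = 0.
  apply: nAB'; apply: ghomM (ghom_in1 _ _); apply: ghomM hf; exact: ghom_pr2.
have g21 : pr2 A B *m g *m in1 A' B' = 0.
  apply: nA'B; apply: ghomM (ghom_in1 _ _); apply: ghomM hg; exact: ghom_pr2.
exists (pr1 A' B' *m f *m in1 A B), (pr1 A B *m g *m in1 A' B'); split.
- apply: ghomM (ghom_in1 _ _); apply: ghomM hf; exact: ghom_pr1.
- have E : in1 A B *m pr1 A B *m (g *m in1 A' B') = g *m in1 A' B'.
    by rewrite -[RHS]mul1mx -(in_pr A B) mulmxDl -[in2 A B *m _ *m _]mulmxA
       [pr2 A B *m _]mulmxA g21 mulmx0 addr0.
  rewrite -!mulmxA [in1 A B *m _]mulmxA E mulmxA -[_ *m f *m _]mulmxA [f *m _]mulmxA fg.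
  by rewrite mul1mx pr1_in1.
have E : in1 A' B' *m pr1 A' B' *m (f *m in1 A B) = f *m in1 A B.
  by rewrite -[RHS]mul1mx -(in_pr A' B') mulmxDl -[in2 A' B' *m _ *m _]mulmxA
     [pr2 A' B' *m _]mulmxA f21 mulmx0 addr0.
rewrite -!mulmxA [in1 A' B' *m _]mulmxA E mulmxA -[_ *m g *m _]mulmxA [g *m _]mulmxA gf.
by rewrite mul1mx pr1_in1.
Qed.
End GeneratorModules.

Section WeylSums.
Variables (F : fieldType) (q : F).

Definition WeylKi n : 'M[F]_n.+1 :=
  \matrix_(j, i) if j == i then q ^- n * q ^+ i.*2 else 0.

Definition W (n : nat) : gmod F := Gmod (fun u => match u with
  | UE r => WeylE q n r
  | UF r => WeylF q n r
  | UK => WeylK q n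
  | UKi => WeylKi n
  end).

Lemma WeylE_opmx n r : WeylE q n r = opmx _ _ (fun a => a + r)%N (fun a => qbin q (n - a) r).
Proof.
apply/matrixP=> a b; rewrite !mxE; case: eqP => // E; congr qbin.
by have := ltn_ord b; rewrite E; lia.
Qed.

(** For [a < r] the subtraction is truncated, but then [[a, r] = 0]. *)
Lemma WeylF_opmx n r : WeylF q n r = opmx _ _ (fun a => a - r)%N (fun a => qbin q a r).
Proof.
apply/matrixP=> a b; rewrite !mxE; case: (a =P b + r :> nat)%N => [->|ne].
  by rewrite addnK eqxx.
case: eqP => // E; rewrite qbin_small //; lia.
Qed.

Lemma WeylK_opmx n : WeylK q n = opmx _ _ id (fun a => q ^+ n * q ^- a.*2).
Proof.
apply/matrixP=> a b; rewrite !mxE [a == b]eq_sym -(inj_eq val_inj).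
by case: eqP => // ->.
Qed.

Lemma WeylKi_opmx n : WeylKi n = opmx _ _ id (fun a => q ^- n * q ^+ a.*2).
Proof.
apply/matrixP=> a b; rewrite !mxE [a == b]eq_sym -(inj_eq val_inj).
by case: eqP => // ->.
Qed.

Lemma WeylE0 n : WeylE q n 0 = 1%:M.
Proof.
apply/matrixP=> a b; rewrite !mxE addn0 qbin0 [_ == _ :> nat]eq_sym (inj_eq val_inj).
by case: eqP.
Qed.

Lemma WeylF0 n : WeylF q n 0 = 1%:M.
Proof.
by apply/matrixP=> a b; rewrite !mxE addn0 qbin0 (inj_eq val_inj); case: eqP.
Qed.

Definition WS (L : seq nat) : gmod F := foldr (fun k M => gdsum (W k) M) (gzero F) L.

Lemma giso_WS_cat L1 L2 : giso (WS (L1 ++ L2)) (gdsum (WS L1) (WS L2)).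
Proof.
elim: L1 => [|k L1 IHL] /=; first exact/giso_sym/giso_gzerol.
apply: giso_trans (giso_gdsum (giso_refl _) IHL) _.
exact/giso_sym/giso_gdsumA.
Qed.

Lemma giso_WS_perm L1 L2 : perm_eq L1 L2 -> giso (WS L1) (WS L2).
Proof.
move=> p12; apply: (catCA_perm_ind (P := fun L => giso (WS L1) (WS L))) p12 (giso_refl _).
move=> s1 s2 s3 H; apply: giso_trans H _.
apply: giso_trans (giso_WS_cat _ _) _.
apply: giso_trans (giso_gdsum (giso_refl _) (giso_WS_cat _ _)) _.
apply: giso_trans (giso_sym (giso_gdsumA _ _ _)) _.
apply: giso_trans (giso_gdsum (giso_gdsumC _ _) (giso_refl _)) _.
apply: giso_trans (giso_gdsumA _ _ _) _.
apply: giso_trans (giso_gdsum (giso_refl _) (giso_sym (giso_WS_cat _ _))) _.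
exact/giso_sym/giso_WS_cat.
Qed.

Lemma giso_WS_filter (Q : pred nat) L :
  giso (WS L) (gdsum (WS (filter Q L)) (WS (filter (predC Q) L))).
Proof.
apply: giso_trans (giso_WS_cat _ _); apply: giso_WS_perm.
by rewrite perm_sym perm_filterC.
Qed.
End WeylSums.

(** * Schur's lemma and retracts for Weyl modules below [l] *)

Section Schur.
Variables (F : fieldType) (q : F) (l : nat).
Hypotheses (q0 : q != 0) (hl : (3 <= l)%N) (hql : l.-primitive_root (q ^+ 2)).
Local Notation W := (W q).
Local Notation WS := (WS q).
Let qq1 := q_subV_neq0 q0 hl hql.

(** A rectangular identity, so that morphisms from [W j] to [W k] have one form, also when [j = k]
    holds only propositionally. *)
Definition idmx m n : 'M[F]_(m, n) := opmx m n id (fun=> 1).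

Lemma idmx1 n : idmx n n = 1%:M.
Proof.
apply/matrixP=> a b; rewrite !mxE eq_sym -(inj_eq val_inj).
by case: eqP.
Qed.

Lemma crd_delta0 n a : crd (delta_mx ord0 ord0 : 'cV[F]_n.+1) a = (a == 0%N)%:R.
Proof.
have [an|na] := ltnP a n.+1; last first.
  by rewrite crd_out //; case: a na.
by rewrite -[a in LHS]/(val (Ordinal an)) crd_ord mxE /= andbT -(inj_eq val_inj).
Qed.

(** The image of the highest weight vector [e_0] is killed by [E], hence is a multiple of [e_0],
    since [[k - a] != 0] for [a < k < l]. As [F^(b) e_0 = e_b], this determines [f]; and [K] acts on
    the two highest weight vectors by [q ^ j] and [q ^ k]. *)
Lemma Schur_Weyl j k (f : 'M_(k.+1, j.+1)) : (j < l)%N -> (k < l)%N ->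
  @ghom F (W j) (W k) f -> f = f ord0 ord0 *: idmx k.+1 j.+1 /\ (j != k -> f = 0).
Proof.
move=> jl kl hf; pose e0 : 'cV[F]_j.+1 := delta_mx ord0 ord0; pose x := f *m e0.
have x0 : crd x 0 = f ord0 ord0.
  by rewrite -[0%N]/(val (ord0 : 'I_k.+1)) crd_ord /x -colE mxE.
have xS a : crd x a.+1 = 0.
  have [ak|ka] := ltnP a k; last by rewrite crd_out.
  have Ee0 : WeylE q j 1 *m e0 = 0.
    apply: crdP => b bj; rewrite WeylE_opmx crd_opmx // crd_delta0 addn1 mulr0.
    by rewrite crd0.
  have := hf (UE 1) => /(congr1 (fun M => M *m e0)) /=.
  rewrite -!mulmxA Ee0 mulmx0 => /(congr1 (fun v : 'cV_ _ => crd v a)).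
  rewrite crd0 WeylE_opmx crd_opmx ?addn1; last exact: ltnW.
  move/esym/eqP; rewrite mulf_eq0 qbin1 // => /orP[|/eqP //].
  by rewrite (negPf (qint_neq0 q0 hl hql _)) //; lia.
have xE a : crd x a = if a == 0%N then f ord0 ord0 else 0 by case: a => [|a] /=.
have Fe0 b : (b < j.+1)%N -> WeylF q j b *m e0 = delta_mx (inord b) ord0.
  move=> bj; apply: crdP => a aj; rewrite WeylF_opmx crd_opmx // crd_delta0.
  rewrite -[a in RHS](@inordK j a) // crd_ord mxE andbT -(inj_eq val_inj) /= !inordK //.
  have [->|ne] := eqVneq a b; first by rewrite qbinn // subnn mulr1.
  have [ab|ba] := leqP a b; first by rewrite qbin_small ?mul0r //; lia.
  by rewrite (_ : (a - b == 0)%N = false) ?mulr0 //; lia.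
have fE : f = f ord0 ord0 *: idmx k.+1 j.+1.
  apply/matrixP=> a b; have bj := ltn_ord b.
  have := hf (UF b) => /(congr1 (fun M => M *m e0)) /=.
  rewrite -!mulmxA Fe0 // -colE => /(congr1 (fun v : 'cV_ _ => crd v a)).
  rewrite crd_ord mxE inord_val => ->; rewrite WeylF_opmx crd_opmx // xE !mxE.
  have [Eab|ne] := eqVneq (a : nat) b; first by rewrite Eab qbinn // subnn eqxx mul1r mulr1.
  rewrite /= mulr0.
  have [ab|ba] := leqP a b; first by rewrite qbin_small ?mul0r //; lia.
  by rewrite (_ : (a - b == 0)%N = false) ?mulr0 //; lia.
split=> // jk; suff f0 : f ord0 ord0 = 0 by rewrite fE f0 scale0r.
have Ke0 : WeylK q j *m e0 = q ^+ j *: e0.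
  apply: crdP => a aj; rewrite WeylK_opmx crd_opmx // crdZ crd_delta0.
  by case: a {aj} => [|a]; rewrite ?mulr0 // expr0 invr1 mulr1.
have := hf UK => /(congr1 (fun M => M *m e0)) /=.
rewrite -!mulmxA Ke0 -scalemxAr -/x => /(congr1 (fun v : 'cV_ _ => crd v 0)).
rewrite crdZ WeylK_opmx crd_opmx // xE expr0 invr1 mulr1 /= => /eqP.
rewrite -subr_eq0 -mulrBl mulf_eq0 subr_eq0 => /orP[/eqP E|/eqP //].
by rewrite (q_expr_inj hql jl kl E) eqxx in jk.
Qed.

Lemma gnohom_WS L L' : all (ltn^~ l) L -> all (ltn^~ l) L' ->
  (forall k, k \in L -> k \in L' -> false) -> gnohom (WS L) (WS L').
Proof.
elim: L => [|k L IHL] /= Ll L'l dis; first by move=> f hf; apply/trmx_inj; apply: mx_dim0.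
case/andP: Ll => kl Ll; apply: gnohom_gdsuml; last first.
  by apply: IHL => // j jL; apply: dis; rewrite inE jL orbT.
elim: L' {IHL} L'l dis => [|k' L' IHL'] /= L'l dis; first by move=> f hf; apply: mx_dim0.
case/andP: L'l => k'l L'l; apply: gnohom_gdsumr; last first.
  by apply: IHL' => // j jL jL'; apply: (dis j jL); rewrite inE jL' orbT.
move=> f hf; apply: (Schur_Weyl kl k'l hf).2; apply/eqP=> kk'.
by suff: false by []; apply: (dis k); rewrite ?kk' inE eqxx.
Qed.

Lemma giso_WS_truncate (Q : pred nat) L L' : all (ltn^~ l) L -> all (ltn^~ l) L' ->
  giso (WS L) (WS L') -> giso (WS (filter Q L)) (WS (filter Q L')).
Proof.
move=> Ll L'l LL'.
have allf P M : all (ltn^~ l) M -> all (ltn^~ l) (filter P M).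
  by move=> Ml; apply/allP=> k; rewrite mem_filter => /andP[_ /(allP Ml)].
apply: giso_cancel (giso_trans (giso_trans (giso_sym (giso_WS_filter q Q L)) LL')
  (giso_WS_filter q Q L')).
  apply: gnohom_WS; rewrite ?allf // => k; rewrite !mem_filter => /andP[Qk _] /=.
  by rewrite Qk.
apply: gnohom_WS; rewrite ?allf // => k; rewrite !mem_filter => /andP[Qk _] /=.
by rewrite Qk.
Qed.

(* If [a1 b1 = 0] then [(b1 a1)^2 = 0], so [b2 a2 = 1 - b1 a1] is invertible:
   a summand of [W k + ...] through which no [W k] splits off is a summand of
   the rest. *)
Lemma retract_WS M L (a : 'M_(gdim (WS L), gdim M)) (b : 'M_(gdim M, gdim (WS L))) :
  all (ltn^~ l) L -> @ghom F M (WS L) a -> @ghom F (WS L) M b -> b *m a = 1%:M ->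
  gdim M != 0%N -> exists k (u : 'M_(gdim M, k.+1)) (r : 'M_(k.+1, gdim M)),
    [/\ k \in L, @ghom F (W k) M u, @ghom F M (W k) r & r *m u = 1%:M].
Proof.
move=> + + + + M0; elim: L a b => [|k L IHL] a b /=.
  move=> _ _ _ ba; case/negP: M0; apply/eqP.
  have : (1%:M : 'M[F]_(gdim M)) = 0 by rewrite -ba (mx_dim0 a 0) // mulmx0.
  by move/eqP; rewrite -mxrank_eq0 mxrank1 => /eqP.
move=> /andP[kl Ll] ha hb ba.
pose a1 := pr1 (W k) (WS L) *m a; pose b1 := b *m in1 (W k) (WS L).
pose a2 := pr2 (W k) (WS L) *m a; pose b2 := b *m in2 (W k) (WS L).
have ha1 : ghom (M := M) (N := W k) a1 by apply: ghomM ha; apply: ghom_pr1.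
have hb1 : ghom (M := W k) (N := M) b1 by apply: ghomM hb _; apply: ghom_in1.
have ha2 : ghom (M := M) (N := WS L) a2 by apply: ghomM ha; apply: ghom_pr2.
have hb2 : ghom (M := WS L) (N := M) b2 by apply: ghomM hb _; apply: ghom_in2.
have E : b1 *m a1 + b2 *m a2 = 1%:M.
  rewrite /b1 /a1 /b2 /a2 !mulmxA -[b *m in1 _ _ *m _]mulmxA -[b *m in2 _ _ *m _]mulmxA.
  by rewrite -mulmxDl -mulmxDr in_pr mulmx1.
have [cE _] := Schur_Weyl kl kl (ghomM ha1 hb1).
move: cE; set c := _ ord0 ord0; rewrite idmx1 => cE.
have [c0|cn0] := eqVneq c 0; last first.
  exists k, b1, (c^-1 *: a1); split=> //; rewrite ?inE ?eqxx //.
    exact: ghomZ.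
  by rewrite -scalemxAl cE scalerA mulVf // scale1r.
have z : a1 *m b1 = 0 by rewrite cE c0 scale0r.
(* [1 + b1 a1] is the inverse of [b2 a2], because [b1 a1] squares to 0. *)
have [||||k' [u [r [k'L hu hr ru]]]] := IHL (a2 *m (1%:M + b1 *m a1)) b2 => //.
- apply: ghomM ha2 _; apply: ghomD; first exact: ghom1.
  exact: ghomM hb1 ha1.
- have -> : b2 *m (a2 *m (1%:M + b1 *m a1)) = (1%:M - b1 *m a1) *m (1%:M + b1 *m a1).
    by rewrite mulmxA -E [b1 *m a1 + _]addrC addrK.
  rewrite mulmxDr mulmx1 mulmxBl mul1mx (mulmxA (b1 *m a1) b1 a1) -(mulmxA b1 a1 b1) z.
  by rewrite mulmx0 mul0mx subr0 subrK.
by exists k', u, r; rewrite inE k'L orbT.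
Qed.

Fixpoint wsin (L : seq nat) (i : nat) : 'M[F]_(gdim (WS L), (nth 0%N L i).+1) :=
  match L, i with
  | [::], _ => 0
  | k :: L', 0 => in1 (W k) (WS L')
  | k :: L', i'.+1 => in2 (W k) (WS L') *m wsin L' i'
  end.

Fixpoint wspr (L : seq nat) (i : nat) : 'M[F]_((nth 0%N L i).+1, gdim (WS L)) :=
  match L, i with
  | [::], _ => 0
  | k :: L', 0 => pr1 (W k) (WS L')
  | k :: L', i'.+1 => wspr L' i' *m pr2 (W k) (WS L')
  end.

Lemma ghom_wsin L i : (i < size L)%N -> @ghom F (W (nth 0%N L i)) (WS L) (wsin L i).
Proof.
elim: L i => // k L IHL [|i] /= iL; first exact: ghom_in1.
by apply: (@ghomM F (W (nth 0%N L i)) (WS L) (gdsum (W k) (WS L))); [apply: ghom_in2 | apply: IHL].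
Qed.

Lemma ghom_wspr L i : (i < size L)%N -> @ghom F (WS L) (W (nth 0%N L i)) (wspr L i).
Proof.
elim: L i => // k L IHL [|i] /= iL; first exact: ghom_pr1.
by apply: (@ghomM F (gdsum (W k) (WS L)) (WS L) (W (nth 0%N L i))); [apply: IHL | apply: ghom_pr2].
Qed.

Lemma wspr_wsin L i : (i < size L)%N -> wspr L i *m wsin L i = 1%:M.
Proof.
elim: L i => // k L IHL [|i] /= iL; first exact: (pr1_in1 (W k) (WS L)).
by rewrite mulmxA -(mulmxA (wspr L i) (pr2 (W k) (WS L))) (pr2_in2 (W k) (WS L)) mulmx1 IHL.
Qed.

Lemma wspr_wsin_neq L i j : i != j -> wspr L i *m wsin L j = 0.
Proof.
elim: L i j => [|k L IHL] [|i] [|j] //= ij; rewrite ?mulmx0 //.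
- by rewrite mulmxA (pr1_in2 (W k) (WS L)) mul0mx.
- by rewrite -mulmxA (pr2_in1 (W k) (WS L)) mulmx0.
by rewrite mulmxA -(mulmxA (wspr L i) (pr2 (W k) (WS L))) (pr2_in2 (W k) (WS L)) mulmx1 IHL.
Qed.

Lemma wsin_wspr L : \sum_(i < size L) wsin L i *m wspr L i = 1%:M.
Proof.
elim: L => [|k L IHL]; first exact: mx_dim0.
rewrite /= big_ord_recl /= -[RHS](in_pr (W k) (WS L)); congr (_ + _).
transitivity (in2 (W k) (WS L) *m (\sum_(i < size L) wsin L i *m wspr L i) *m pr2 (W k) (WS L)).
  by rewrite mulmx_sumr mulmx_suml; apply: eq_bigr => i _; rewrite !mulmxA.
by rewrite IHL mulmx1.
Qed.
End Schur.

(** * Tensor product with the two-dimensional Weyl module *)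

Section TensorProducts.
Variables (F : fieldType) (q : F).
Hypothesis q0 : q != 0.
Implicit Types M N P A B : gmod F.

Definition gtens M N : gmod F := @Gmod F (gdim M * gdim N) (fun u => match u with
  | UE r => \sum_(a < r.+1) q ^+ (a * (r - a)) *:
      ((gact M (UE a) * gact M UK ^+ (r - a)) *t gact N (UE (r - a)))
  | UF r => \sum_(a < r.+1) q ^+ (a * (r - a)) *:
      (gact M (UF a) *t (gact N (UF (r - a)) * gact N UKi ^+ a))
  | UK => gact M UK *t gact N UK
  | UKi => gact M UKi *t gact N UKi
  end).

Lemma ghomX M N (f : 'M[F]_(gdim N, gdim M)) u n : ghom f ->
  f *m (gact M u ^+ n) = (gact N u ^+ n) *m f.
Proof.
move=> hf; elim: n => [|n IHn]; first by rewrite !expr0 mulmx1 mul1mx.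
by rewrite !exprS -[_ * _]/(_ *m _) -[gact N u * _]/(_ *m _) mulmxA hf -!mulmxA IHn.
Qed.

Lemma ghom_tens M M' N N' (f : 'M_(gdim M', gdim M)) (g : 'M_(gdim N', gdim N)) :
  @ghom F M M' f -> @ghom F N N' g -> @ghom F (gtens M N) (gtens M' N') (f *t g).
Proof.
move=> hf hg [r|r||] /=.
- rewrite mulmx_suml mulmx_sumr; apply: eq_bigr => a _.
  rewrite -scalemxAr -scalemxAl !tensmx_mul hg -[_ * _]/(_ *m _) -[gact M' _ * _]/(_ *m _).
  by rewrite mulmxA hf -!mulmxA ghomX.
- rewrite mulmx_suml mulmx_sumr; apply: eq_bigr => a _.
  rewrite -scalemxAr -scalemxAl !tensmx_mul hf -[_ * _]/(_ *m _) -[gact N' _ * _]/(_ *m _).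
  by rewrite mulmxA hg -!mulmxA ghomX.
- by rewrite !tensmx_mul hf hg.
- by rewrite !tensmx_mul hf hg.
Qed.

Lemma tensmx11 m n : (1%:M : 'M[F]_m) *t (1%:M : 'M[F]_n) = 1%:M.
Proof.
apply/matrixP=> i j; rewrite !mxE -natrM mulnb; congr (_%:R : F).
by rewrite -(inj_eq (can_inj (@mxtens_unindexK m n))) xpair_eqE.
Qed.

Lemma giso_tens M M' N N' : giso M M' -> giso N N' -> giso (gtens M N) (gtens M' N').
Proof.
move=> [f [g [hf fg gf]]] [f' [g' [hf' fg' gf']]].
exists (f *t f'), (g *t g'); split; first exact: ghom_tens.
  by rewrite tensmx_mul fg fg' tensmx11.
by rewrite tensmx_mul gf gf' tensmx11.
Qed.

Definition pred_act M (X : nat -> uop) (r : nat) : 'M[F]_(gdim M) :=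
  if r is r'.+1 then gact M (X r') else 0.

(* [M (x) W 1], in the blocks [M (x) e_0] and [M (x) e_1]. *)
Definition gdbl M : gmod F := @Gmod F (gdim M + gdim M) (fun u => match u with
  | UE r => block_mx (gact M (UE r))
      (q ^+ r.-1 *: (pred_act M UE r *m gact M UK)) 0 (gact M (UE r))
  | UF r => block_mx (q ^- r *: gact M (UF r)) 0
      (pred_act M UF r) (q ^+ r *: gact M (UF r))
  | UK => block_mx (q *: gact M UK) 0 0 (q^-1 *: gact M UK)
  | UKi => block_mx (q^-1 *: gact M UKi) 0 0 (q *: gact M UKi)
  end).

Lemma WeylE1_ge2 s : (1 < s)%N -> WeylE q 1 s = 0.
Proof.
move=> s1; apply/matrixP=> a b; rewrite !mxE; case: eqP => // E.
by have := ltn_ord b; lia.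
Qed.

Lemma WeylF1_ge2 s : (1 < s)%N -> WeylF q 1 s = 0.
Proof.
move=> s1; apply/matrixP=> a b; rewrite !mxE; case: eqP => // E.
by have := ltn_ord a; lia.
Qed.

(** Divided powers above the first vanish on [W 1], so at most two terms of the comultiplication
    survive. *)
Lemma gtens_W1_E M r : gact (gtens M (W q 1)) (UE r)
  = gact M (UE r) *t 1%:M + q ^+ r.-1 *: ((pred_act M UE r *m gact M UK) *t WeylE q 1 1).
Proof.
rewrite /= big_ord_recr /= subnn muln0 expr0 scale1r mulr1 WeylE0 addrC; congr (_ + _).
case: r => [|r]; first by rewrite big_ord0 mul0mx tens0mx scaler0.
rewrite big_ord_recr big1 ?add0r /=; last first.
  by move=> a _; rewrite WeylE1_ge2 ?tensmx0 ?scaler0 // ltn_subRL; have := ltn_ord a; lia.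
by rewrite subSnn muln1 expr1 add0r.
Qed.

Lemma gtens_W1_F M r : gact (gtens M (W q 1)) (UF r)
  = gact M (UF r) *t WeylKi q 1 ^+ r
    + q ^+ r.-1 *: (pred_act M UF r *t (WeylF q 1 1 * WeylKi q 1 ^+ r.-1)).
Proof.
rewrite /= big_ord_recr /= subnn muln0 expr0 scale1r WeylF0 mul1r addrC; congr (_ + _).
case: r => [|r]; first by rewrite big_ord0 tens0mx scaler0.
rewrite big_ord_recr big1 ?add0r /=; last first.
  move=> a _; rewrite WeylF1_ge2 ?mul0r ?tensmx0 ?scaler0 // ltn_subRL.
  by have := ltn_ord a; lia.
by rewrite subSnn muln1 add0r.
Qed.

Lemma ord2P (j : 'I_2) : j = ord0 \/ j = ord_max.
Proof. by case: j => -[|[|//]] jl; [left | right]; apply/val_inj. Qed.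

(** The inclusion of [M (x) e_j]. *)
Definition inn d (j : 'I_2) : 'M[F]_(d * 2, d) :=
  \matrix_(p, i) (p == mxtens_index (i, j))%:R.

Lemma tens_inn d (A : 'M[F]_d) (B : 'M[F]_2) j :
  (A *t B) *m inn d j = B ord0 j *: (inn d ord0 *m A) + B ord_max j *: (inn d ord_max *m A).
Proof.
apply/matrixP=> p i; rewrite mxE (bigD1 (mxtens_index (i, j))) //= big1 ?addr0; last first.
  by move=> k ki; rewrite [inn d j k i]mxE (negPf ki) mulr0.
rewrite [inn d j _ _]mxE eqxx mulr1; case: (mxtens_indexP p) => i' j' /=.
rewrite tensmxE !mxE.
have S (j'' : 'I_2) : \sum_k inn d j'' (mxtens_index (i', j')) k * A k i
    = (j' == j'')%:R * A i' i.
  rewrite (bigD1 i') //= big1 ?addr0 => [|k ki]; rewrite !mxE.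
    by rewrite (inj_eq (can_inj (@mxtens_indexK d 2))) xpair_eqE eqxx.
  by rewrite (inj_eq (can_inj (@mxtens_indexK d 2))) xpair_eqE eq_sym (negPf ki) mul0r.
rewrite !S; have [->|->] := ord2P j'; rewrite eqxx /= mul1r mul0r mulr0 ?addr0 ?add0r.
  by rewrite mulrC.
by rewrite mulrC.
Qed.

Lemma WeylKi1X r : WeylKi q 1 ^+ r = \matrix_(i, j) if i == j then (if i == ord0 then q ^- r else q ^+ r) else 0.
Proof.
elim: r => [|r IHr].
  by apply/matrixP=> i j; rewrite !mxE expr0 invr1 if_same; case: eqP.
rewrite exprS IHr; apply/matrixP=> i j; rewrite !mxE (bigD1 i) //= !mxE eqxx big1 ?addr0; last first.
  by move=> k ki; rewrite !mxE [i == k]eq_sym (negPf ki) mul0r.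
case: eqP => [->|]; last by rewrite mulr0.
have qr : q ^+ r != 0 by rewrite expf_neq0.
have [->|->] := ord2P j; rewrite /= ?expr0 ?mulr1 ?expr1 ?exprS; first by field; rewrite qr q0.
by field.
Qed.

Lemma giso_gdbl_tens M : giso (gdbl M) (gtens M (W q 1)).
Proof.
pose d := gdim M; pose g : 'M[F]_(d * 2, d + d) := row_mx (inn d ord0) (inn d ord_max).
have WE (j j' : 'I_2) : WeylE q 1 1 j j' = ((j == ord0) && (j' == ord_max))%:R.
  rewrite mxE; have [->|->] := ord2P j; have [->|->] := ord2P j' => //.
  exact: (qbinn q 1).
have innT (j j' : 'I_2) : (inn d j)^T *m inn d j' = (j == j')%:R%:M.
  apply/matrixP=> a b; rewrite !mxE (bigD1 (mxtens_index (a, j))) //= big1 ?addr0 => [|k ki].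
    rewrite !mxE eqxx mul1r (inj_eq (can_inj (@mxtens_indexK d 2))) xpair_eqE.
    by case: (a == b); case: (j == j').
  by rewrite !mxE (negPf ki) mul0r.
exists g, g^T; split.
- case=> [r|r||] /=.
  + rewrite -[\sum_(a < _) _]/(gact (gtens M (W q 1)) (UE r)) gtens_W1_E.
    rewrite /g mul_row_block mul_mx_row !mulmxDl -!scalemxAl !tens_inn !WE !mxE /=.
    by rewrite !scale1r !scale0r !(mulmx0, addr0, add0r, scaler0) -scalemxAr addrC.
  + rewrite -[\sum_(a < _) _]/(gact (gtens M (W q 1)) (UF r)) gtens_W1_F.
    have E j j' : (WeylF q 1 1 * WeylKi q 1 ^+ r.-1) j j'
        = ((j == ord_max) && (j' == ord0))%:R * q ^- r.-1.
      rewrite WeylKi1X mxE (bigD1 j') //= big1 ?addr0 => [|k kj]; last first.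
        by rewrite !mxE (negPf kj) mulr0.
      rewrite !mxE eqxx; have [->|->] := ord2P j; have [->|->] := ord2P j';
        rewrite ?mul0r //.
      by congr (_ * _); apply: (qbinn q 1).
    rewrite /g mul_row_block mul_mx_row !mulmxDl -!scalemxAl !tens_inn !E WeylKi1X !mxE /=.
    rewrite !mul1r !mul0r !scale0r !(mulmx0, addr0, add0r, scaler0) -!scalemxAr.
    by rewrite scalerA divff ?scale1r // expf_neq0.
  + rewrite /g mul_row_block mul_mx_row !tens_inn !mxE /= !expr0 !expr1 invr1 mulr1.
    by rewrite !scale0r !(mulmx0, addr0, add0r) -!scalemxAr; congr row_mx; congr (_ *: _); field.
  + rewrite /g mul_row_block mul_mx_row !tens_inn !mxE /= !expr0 !expr1 mulr1.
    by rewrite !scale0r !(mulmx0, addr0, add0r) -!scalemxAr; congr row_mx; congr (_ *: _); field.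
- rewrite /g tr_row_mx mul_row_col; apply/matrixP=> p p'; rewrite !mxE.
  case: (mxtens_indexP p) => i j; case: (mxtens_indexP p') => i' j'.
  have S (j'' : 'I_2) : \sum_k inn d j'' (mxtens_index (i, j)) k * (inn d j'')^T k (mxtens_index (i', j'))
    = ((i == i') && (j == j'') && (j' == j''))%:R.
    rewrite (bigD1 i) //= big1 ?addr0 => [|k ki]; rewrite !mxE !(inj_eq (can_inj (@mxtens_indexK d 2))) !xpair_eqE.
      by rewrite eqxx -natrM mulnb [i' == i]eq_sym; case: (i == i'); rewrite /= ?andbF.
    by rewrite [i == k]eq_sym (negPf ki) mul0r.
  rewrite !S (inj_eq (can_inj (@mxtens_indexK d 2))) xpair_eqE.
  by case: (i == i'); have [->|->] := ord2P j; have [->|->] := ord2P j'; rewrite /= ?addr0 ?add0r.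
by rewrite /g tr_row_mx mul_col_row !innT /= raddf0 -scalar_mx_block.
Qed.

Definition dbl m n (f : 'M[F]_(m, n)) : 'M[F]_(m + m, n + n) := block_mx f 0 0 f.

Lemma dblM m n p (f : 'M_(m, n)) (g : 'M_(n, p)) : dbl f *m dbl g = dbl (f *m g).
Proof. by rewrite /dbl mulmx_block !(mulmx0, mul0mx, addr0, add0r). Qed.

Lemma dblD m n (f g : 'M_(m, n)) : dbl (f + g) = dbl f + dbl g.
Proof. by rewrite /dbl add_block_mx !addr0. Qed.

Lemma dbl1 n : dbl (1%:M : 'M_n) = 1%:M.
Proof. by rewrite /dbl -scalar_mx_block. Qed.

Lemma dbl0 m n : dbl (0 : 'M_(m, n)) = 0.
Proof. by rewrite /dbl block_mx0. Qed.

Lemma ghom_dbl M N (f : 'M_(gdim N, gdim M)) :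
  @ghom F M N f -> @ghom F (gdbl M) (gdbl N) (dbl f).
Proof.
move=> hf; have hp X r : f *m pred_act M X r = pred_act N X r *m f.
  by case: r => [|r] /=; rewrite ?mulmx0 ?mul0mx.
case=> [r|r||] /=; rewrite !mulmx_block !(mulmx0, mul0mx, addr0, add0r) -?scalemxAr -?scalemxAl ?hf ?hp //.
by rewrite mulmxA hp -!mulmxA hf.
Qed.

Lemma giso_gdbl_gdsum A B : giso (gdsum (gdbl A) (gdbl B)) (gdbl (gdsum A B)).
Proof.
apply: (@giso_biprod F (gdbl A) (gdbl B) (gdbl (gdsum A B)) (dbl (in1 A B)) (dbl (in2 A B))
  (dbl (pr1 A B)) (dbl (pr2 A B))); rewrite ?dblM.
- exact: (@ghom_dbl A (gdsum A B) _ (@ghom_in1 F A B)).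
- exact: (@ghom_dbl B (gdsum A B) _ (@ghom_in2 F A B)).
- by rewrite pr1_in1 dbl1.
- by rewrite pr2_in2 dbl1.
- by rewrite pr1_in2 dbl0.
- by rewrite pr2_in1 dbl0.
by rewrite -dblD in_pr dbl1.
Qed.
End TensorProducts.

Lemma crd_opmx_if (F : fieldType) m n phi c (v : 'cV[F]_n) a :
  crd (opmx m n phi c *m v) a = if (a < m)%N then c a * crd v (phi a) else 0.
Proof. by case: ltnP => am; [rewrite crd_opmx | rewrite crd_out]. Qed.

Local Arguments qbin : simpl never.

(** * The splitting of [W k (x) W 1] *)

Section WeylTensor.
Variables (F : fieldType) (q : F).
Hypotheses (q0 : q != 0) (qq1 : q - q^-1 != 0).
Variable k : nat.
Hypothesis k1 : qint q k.+1 != 0.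

Let qX n : q ^+ n != 0. Proof. by rewrite expf_neq0. Qed.

(* The highest weight vectors [e_0 x_0] and [e_1 x_0 - q^-k [k] e_0 x_1]
   generate the two summands; these are the images of the bases under the
   divided powers [F^(i)]. *)
Definition up_in : 'M[F]_(k.+1 + k.+1, k.+2) :=
  col_mx (opmx _ _ id (fun a => q ^- a)) (opmx _ _ S (fun=> 1)).
Definition down_in n : 'M[F]_(k.+1 + k.+1, n) :=
  col_mx (opmx _ _ predn (fun a => q * q ^- a * qint q a))
    (opmx _ _ id (fun a => - (q ^- k * qint q (k - a)))).
(** Projections obtained by inverting the two inclusions. On a two-dimensional weight space this is
    a two-by-two system with determinant [- q^-k [k + 1]], which is where [[k + 1] != 0] enters. *)
Definition up_pr : 'M[F]_(k.+2, k.+1 + k.+1) :=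
  row_mx (opmx _ _ id (fun a => qint q (k.+1 - a) / qint q k.+1))
    (opmx _ _ predn (fun a => q ^+ (k.+1 - a) * qint q a / qint q k.+1)).
Definition down_pr n : 'M[F]_(n, k.+1 + k.+1) :=
  row_mx (opmx _ _ S (fun=> q ^+ k / qint q k.+1))
    (opmx _ _ id (fun a => - (q ^+ (k - a.+1) / qint q k.+1))).

Lemma col_mx_cV_eq n (A B A' B' : 'M[F]_(k.+1, n)) :
  (forall v : 'cV_n, A *m v = A' *m v) -> (forall v : 'cV_n, B *m v = B' *m v) ->
  col_mx A B = col_mx A' B'.
Proof. by move=> /mulmx_cV_eq -> /mulmx_cV_eq ->. Qed.

Let qb0 n t : (n < t)%N -> qbin q n t = 0. Proof. exact: qbin_small. Qed.
Let z := (mul0r, mulr0, add0r, addr0, oppr0, @mulr0 F).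

Let crdE n r (v : 'cV_n.+1) a : (a <= n)%N ->
  crd (WeylE q n r *m v) a = qbin q (n - a) r * crd v (a + r).
Proof. by move=> an; rewrite WeylE_opmx crd_opmx. Qed.

Let crdF n r (v : 'cV_n.+1) a : (a <= n)%N ->
  crd (WeylF q n r *m v) a = qbin q a r * crd v (a - r).
Proof. by move=> an; rewrite WeylF_opmx crd_opmx. Qed.

Let crdK n (v : 'cV_n.+1) a : (a <= n)%N ->
  crd (WeylK q n *m v) a = q ^+ n * q ^- a.*2 * crd v a.
Proof. by move=> an; rewrite WeylK_opmx crd_opmx. Qed.

Let crdKi n (v : 'cV_n.+1) a : (a <= n)%N ->
  crd (WeylKi q n *m v) a = q ^- n * q ^+ a.*2 * crd v a.
Proof. by move=> an; rewrite WeylKi_opmx crd_opmx. Qed.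

(** On coordinates, compatibility with [E^(r)] comes down to the Pascal rule [qbinSV], and with
    [F^(r)] to [qbinS]. *)
Lemma up_in_hom : @ghom F (W q k.+1) (gdbl q (W q k)) up_in.
Proof.
case=> [r|r||] /=; rewrite /up_in mul_block_col mul_col_mx ?mul0mx ?add0r ?addr0;
  apply: col_mx_cV_eq => v; apply: crdP => a; rewrite ltnS => ak;
  have ak1 := leqW ak; rewrite ?mulmxDl -?mulmxA -?scalemxAl ?crdD ?crdZ crd_opmx //.
- rewrite !crdE //; case: r => [|r] /=.
    by rewrite !qbin0 addn0 crd_opmx // !mul0mx crd0; ring.
  rewrite -!mulmxA crdE // addnS.
  have [ark|ark] := leqP (a + r) k; last first.
    have -> : qbin q (k.+1 - a) r.+1 = 0 by apply: qb0; lia.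
    have -> : qbin q (k - a) r.+1 = 0 by apply: qb0; lia.
    have -> : qbin q (k - a) r = 0 by apply: qb0; lia.
    by rewrite !z.
  rewrite crdK // !crd_opmx_if !ltnS ark mul1r.
  have [t Ek] : exists t, k = (a + r + t)%N by exists (k - (a + r))%N; lia.
  have Eq : q ^+ k = q ^+ a * q ^+ r * q ^+ t by rewrite Ek !exprD.
  have E1 : (k.+1 - a = (r + t).+1)%N by lia.
  have E2 : (k - a = r + t)%N by lia.
  rewrite E1 E2 qbinSV // addKn -[(a + r).*2]addnn.
  case: ltnP => [ark1|ark1]; last first.
    rewrite [qbin q (r + t) r.+1]qb0; last by lia.
    by rewrite Eq !z !exprD; field; rewrite !qX.
  by rewrite Eq !exprS !exprD; field; rewrite !qX q0.
- rewrite !crdE // subSS crd_opmx_if; case: ltnP => [_|ark]; first by rewrite !mul1r addSn.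
  by rewrite [qbin _ _ _]qb0 ?z //; lia.
- rewrite !crdF // crd_opmx; last by rewrite ltnS (leq_trans (leq_subr _ _)).
  have [ra|ar] := leqP r a; last by rewrite qb0 // !z.
  have [t ->] : exists t, a = (r + t)%N by exists (a - r)%N; lia.
  by rewrite addKn exprD; field; rewrite !qX.
- rewrite crdF //; case: r => [|r] /=.
    by rewrite !qbin0 subn0 !mul0mx crd0 crdF // qbin0 subn0 crd_opmx // expr0; ring.
  rewrite !crdF // subSS !crd_opmx_if.
  rewrite [(a - r < _)%N]ltnS (leq_trans (leq_subr _ _)) // ltnS (leq_trans (leq_subr _ _)) //.
  rewrite qbinS; have [ra|ar] := ltnP r a.
    have E : (a - r = (a - r.+1).+1)%N by lia.
    rewrite -E; ring.
  rewrite [qbin q a r.+1]qb0 ?ltnS // !z; ring.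
- rewrite !crdK // crd_opmx // exprS; ring.
- rewrite !crdK // crd_opmx // doubleS !exprS; field; by rewrite qX q0.
- rewrite !crdKi // crd_opmx // exprS; field; by rewrite !qX q0.
- rewrite !crdKi // crd_opmx // doubleS !exprS; field; by rewrite qX q0.
Qed.

(** On coordinates, the identities are the absorption rules [qbin_absorb_sub] and [qbin_absorb_top],
    used without dividing by [[r + 1]], which may vanish. *)
Lemma down_in_hom n : k = n.+1 -> @ghom F (W q n) (gdbl q (W q k)) (down_in n.+1).
Proof.
move=> kn; have nk a : (a <= n)%N -> (a <= k)%N by rewrite kn => /leqW.
have Ek : q ^+ k = q * q ^+ n by rewrite kn exprS.
case=> [r|r||] /=; rewrite /down_in mul_block_col mul_col_mx ?mul0mx ?add0r ?addr0;
  apply: col_mx_cV_eq => v; apply: crdP => a; rewrite ltnS => ak;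
  rewrite ?mulmxDl -?mulmxA -?scalemxAl ?crdD ?crdZ crd_opmx //.
- have qa : qint q (a + r) = q ^+ r * qint q a + q ^- a * qint q r by rewrite qintD.
  have -> : q * q ^- a * qint q a * crd (WeylE q n r *m v) a.-1
      = q * q ^- a * qint q a * qbin q (k - a) r * crd v (a + r).-1.
    case: a ak {qa} => [|a] ak; first by rewrite qint0; ring.
    by rewrite crdE ?kn ?subSS ?addSn /=; [ring | lia].
  rewrite crdE //; case: r qa => [|r] qa /=.
    by rewrite !qbin0 addn0 !mul0mx crd0 crd_opmx //; ring.
  have [ark|ark] := leqP (a + r) k; last first.
    have -> : qbin q (k - a) r.+1 = 0 by apply: qb0; lia.
    rewrite -!mulmxA crdE // (_ : qbin q (k - a) r = 0) ?z //.
    by apply: qb0; lia.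
  rewrite -!mulmxA crdE // crdK // !crd_opmx_if addnS !ltnS ark /=.
  have abs := qbin_absorb_sub q0 qq1 (k - a) r.
  have -> : (k - (a + r) = k - a - r)%N by lia.
  have -> : q ^+ r * (qbin q (k - a) r * (q ^+ k * q ^- (a + r).*2 *
      (- (q ^- k * qint q (k - a - r)) * crd v (a + r))))
    = - (q ^+ r * q ^- (a + r).*2 * (qint q r.+1 * qbin q (k - a) r.+1) * crd v (a + r)).
    by rewrite abs; field; rewrite !qX.
  case: (ltnP (a + r) k) => ark1; last first.
    have -> : qbin q (k - a) r.+1 = 0 by apply: qb0; lia.
    by rewrite !z.
  rewrite -addnS qa addnS /= -addnn !exprD !exprS !exprD.
  by field; rewrite !qX q0.
- rewrite [RHS]crdE //; have [ak1|ak1] := ltnP a k; last first.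
    have -> : (k - a = 0)%N by lia.
    have -> : crd (WeylE q n r *m v) a = 0 by rewrite crd_out // -kn.
    case: r => [|r]; last by rewrite qb0 // !z.
    rewrite addn0 crd_opmx // (_ : k - a = 0)%N ?qint0; last by lia.
    by rewrite !z.
  rewrite crdE; last by rewrite -ltnS -kn.
  have [m Ea] : exists m, (n - a = m)%N by exists (n - a)%N.
  have Ea1 : (k - a = m.+1)%N by lia.
  rewrite Ea Ea1 crd_opmx_if; have [rm|mr] := leqP r m.
    rewrite ltnS (_ : (a + r <= k)%N); last by lia.
    have -> : (k - (a + r) = m.+1 - r)%N by lia.
    have abs := qbin_absorb_top q0 qq1 rm.
    transitivity (- (q ^- k * (qint q m.+1 * qbin q m r) * crd v (a + r))); first by ring.
    by rewrite -abs; ring.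
  rewrite [qbin q m r]qb0 // !z; case: ifP => [ark|]; last by rewrite mulr0.
  have -> : (k - (a + r) = 0)%N by lia.
  by rewrite qint0 !z.
- rewrite [in RHS]crdF // crd_opmx; last by rewrite ltnS (leq_trans (leq_subr _ _)).
  case: a ak => [|a] ak; first by rewrite qint0 ?sub0n ?qint0 !z.
  rewrite crdF /=; last by rewrite -ltnS -kn.
  have [ra|ar] := leqP r a; last first.
    rewrite [qbin q a r]qb0 // mul0r mulr0.
    rewrite (_ : qint q (a.+1 - r) = 0) ?z //.
    by rewrite (_ : a.+1 - r = 0)%N ?qint0 //; lia.
  have -> : (a.+1 - r).-1 = (a - r)%N by lia.
  have abs := qbin_absorb_top q0 qq1 ra.
  transitivity (q * q ^- a.+1 * (qint q a.+1 * qbin q a r) * crd v (a - r)); first by ring.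
  rewrite -abs (_ : q ^+ a.+1 = q ^+ r * q ^+ (a.+1 - r)); last by rewrite -exprD subnKC // leqW.
  by field; rewrite !qX.
- have E : - (q ^- k * qint q (k - a)) * crd (WeylF q n r *m v) a
      = - (q ^- k * qint q (k - a)) * (qbin q a r * crd v (a - r)).
    have [ak1|ak1] := ltnP a k; first by rewrite crdF //; rewrite -ltnS -kn.
    by rewrite (_ : k - a = 0)%N ?qint0 ?z //; lia.
  rewrite E {E} crdF //; case: r => [|r] /=.
    by rewrite mul0mx crd0 crd_opmx ?subn0 // !expr0; ring.
  have arb : (a - r.+1 < k.+1)%N by rewrite ltnS (leq_trans (leq_subr _ _)).
  have arb' : (a - r < k.+1)%N by rewrite ltnS (leq_trans (leq_subr _ _)).
  rewrite crdF // !crd_opmx //.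
  have [ra|ar] := ltnP r a; last first.
    rewrite [qbin q a r.+1]qb0 //; have [Ear|ne] := eqVneq a r; last first.
      by rewrite [qbin q a r]qb0 ?z //; lia.
    by rewrite Ear subnn qint0 !(mulr0, mul0r, addr0).
  have E : (a - r).-1 = (a - r.+1)%N by lia.
  have abs := qbin_absorb_sub q0 qq1 a r.
  have E2 : (k - (a - r.+1) = (k - a) + r.+1)%N by lia.
  rewrite E E2 qintDV //.
  have Eka : q ^+ k = q ^+ (k - a) * q ^+ a by rewrite -exprD subnK.
  have Ea : q ^+ a = q ^+ (a - r) * q ^+ r by rewrite -exprD subnK // ltnW.
  transitivity (q * q ^- (a - r) * (qint q (a - r) * qbin q a r) * crd v (a - r.+1)
    - q ^+ r.+1 * q ^- k * (q ^- r.+1 * qint q (k - a) + q ^+ (k - a) * qint q r.+1) * qbin q a r.+1 * crd v (a - r.+1)); last by ring.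
  by rewrite -abs Eka Ea exprS; field; rewrite !qX q0.
- case: a ak => [|a] ak; first by rewrite qint0 [in RHS]crdK // crd_opmx //= qint0; ring.
  rewrite crdK /=; last by rewrite -ltnS -kn.
  rewrite crdK // crd_opmx // Ek doubleS !exprS /=; field; by rewrite !qX q0.
- have [ak1|ak1] := ltnP a k; last first.
    rewrite [in RHS]crdK // crd_opmx // (_ : k - a = 0)%N ?qint0; last by lia.
    by rewrite !(mulr0, oppr0, mul0r).
  rewrite crdK; last by rewrite -ltnS -kn.
  rewrite crdK // crd_opmx // Ek; field; by rewrite !qX q0.
- case: a ak => [|a] ak; first by rewrite qint0 [in RHS]crdKi // crd_opmx //= qint0; ring.
  rewrite crdKi /=; last by rewrite -ltnS -kn.
  rewrite crdKi // crd_opmx // Ek doubleS !exprS /=; field; by rewrite !qX q0.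
- have [ak1|ak1] := ltnP a k; last first.
    rewrite [in RHS]crdKi // crd_opmx // (_ : k - a = 0)%N ?qint0; last by lia.
    by rewrite !(mulr0, oppr0, mul0r).
  rewrite crdKi; last by rewrite -ltnS -kn.
  rewrite crdKi // crd_opmx // Ek; field; by rewrite !qX q0.
Qed.

Lemma up_pr_in : up_pr *m up_in = 1%:M.
Proof.
rewrite mul_row_col; apply: mulmx_cV_eq => v; apply: crdP => a; rewrite ltnS => ak.
rewrite mul1mx mulmxDl -!mulmxA crdD !crd_opmx_if ltnS ak.
have -> : (a.-1 < k.+1)%N by lia.
have Eab : qint q k.+1 = q ^+ (k.+1 - a) * qint q a + q ^- a * qint q (k.+1 - a).
  by rewrite -qintD // subnKC.
case: a ak Eab => [|a] ak Eab.
  by rewrite qint0 /= subn0 expr0 invr1 !z divff // !mul1r.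
rewrite /= ltnS; case: ltnP => ak'.
  transitivity ((q ^+ (k.+1 - a.+1) * qint q a.+1 + q ^- a.+1 * qint q (k.+1 - a.+1)) / qint q k.+1 * crd v a.+1).
    by ring.
  by rewrite -Eab divff // mul1r.
have Ea : a = k by lia.
by rewrite Ea subnn expr0 !z !mul1r divff // mul1r.
Qed.

Lemma down_pr_in : down_pr k *m down_in k = 1%:M.
Proof.
rewrite mul_row_col; apply: mulmx_cV_eq => v; apply: crdP => a ak.
rewrite mul1mx mulmxDl -!mulmxA crdD !crd_opmx_if ak ltnS ak ltnS (ltnW ak) /=.
have [t Et] : exists t, k = (a.+1 + t)%N by exists (k - a.+1)%N; lia.
have E1 : (k - a = t.+1)%N by lia.
have E2 : (k - a.+1 = t)%N by lia.
have Eab : qint q k.+1 = q ^+ t.+1 * qint q a.+1 + q ^- a.+1 * qint q t.+1.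
  by rewrite -qintD // Et; congr qint; lia.
have Ek : q ^+ k = q * q ^+ a * q ^+ t by rewrite Et exprD exprS.
rewrite E1 E2.
transitivity ((q ^+ t.+1 * qint q a.+1 + q ^- a.+1 * qint q t.+1) / qint q k.+1 * crd v a).
  by rewrite Ek !exprS; field; rewrite k1 !qX q0.
by rewrite -Eab divff // mul1r.
Qed.

Lemma up_pr_down_in : up_pr *m down_in k = 0.
Proof.
rewrite mul_row_col; apply: mulmx_cV_eq => v; apply: crdP => a; rewrite ltnS => ak.
rewrite mul0mx crd0 mulmxDl -!mulmxA crdD !crd_opmx_if ltnS ak.
have -> : (a.-1 < k.+1)%N by lia.
case: a ak => [|a] ak; first by rewrite qint0 /= !z.
rewrite /= ltnS subSS; case: ltnP => ak'; last first.
  have Ea : a = k by lia.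
  by rewrite Ea subnn qint0 !z.
have Ek : q ^+ k = q ^+ (k - a) * q ^+ a by rewrite -exprD subnK // ltnW.
rewrite Ek exprS; field; by rewrite k1 !qX q0.
Qed.

Lemma down_pr_up_in : down_pr k *m up_in = 0.
Proof.
rewrite mul_row_col; apply: mulmx_cV_eq => v; apply: crdP => a ak.
rewrite mul0mx crd0 mulmxDl -!mulmxA crdD !crd_opmx_if ak ltnS ak ltnS (ltnW ak) /=.
have Ek : q ^+ k = q ^+ (k - a.+1) * q ^+ a.+1 by rewrite -exprD subnK.
rewrite Ek; field; by rewrite k1 !qX.
Qed.

Lemma up_down_in_pr : up_in *m up_pr + down_in k *m down_pr k = 1%:M.
Proof.
rewrite /up_in /up_pr /down_in /down_pr !mul_col_row add_block_mx [RHS]scalar_mx_block.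
congr block_mx; apply: mulmx_cV_eq => v; apply: crdP => a; rewrite ltnS => ak;
  rewrite ?mul1mx ?mul0mx ?crd0 mulmxDl -!mulmxA crdD !crd_opmx_if ?ltnS ?ak ?(leqW ak).
- have Eab : qint q k.+1 = q ^+ (k.+1 - a) * qint q a + q ^- a * qint q (k.+1 - a).
    by rewrite -qintD // subnKC // leqW.
  case: a ak Eab => [|a] ak Eab.
    by rewrite qint0 /= subn0 expr0 invr1 !z divff // !mul1r.
  rewrite /= ak; transitivity ((q ^+ (k.+1 - a.+1) * qint q a.+1 + q ^- a.+1 * qint q (k.+1 - a.+1)) / qint q k.+1 * crd v a.+1).
    have Ek : q ^+ k = q ^+ (k - a.+1) * q ^+ a.+1 by rewrite -exprD subnK.
    rewrite Ek (_ : (k.+1 - a.+1 = (k - a.+1).+1)%N); last by lia.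
    by rewrite !exprS; field; rewrite k1 !qX q0.
  by rewrite -Eab divff // mul1r.
- case: a ak => [|a] ak; first by rewrite qint0 !z.
  rewrite /= ak subSS (_ : (k - a = (k - a.+1).+1)%N); last by lia.
  by rewrite !exprS; field; rewrite k1 !qX q0.
- rewrite subSS; case: (ltnP a k) => ak'; first by field; rewrite k1 !qX.
  by rewrite (_ : k - a = 0)%N ?qint0 ?z //; lia.
- rewrite subSS; case: (ltnP a k) => ak'; last first.
    have -> : a = k by lia.
    by rewrite subnn qint0 /= !z expr0 !mul1r divff // mul1r.
  have [t Et] : exists t, k = (a.+1 + t)%N by exists (k - a.+1)%N; lia.
  have E1 : (k - a = t.+1)%N by lia.
  have E2 : (k - a.+1 = t)%N by lia.
  have Eab : qint q k.+1 = q ^+ t.+1 * qint q a.+1 + q ^- a.+1 * qint q t.+1.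
    by rewrite -qintD // Et; congr qint; lia.
  have Ek : q ^+ k = q * q ^+ a * q ^+ t by rewrite Et exprD exprS.
  rewrite E1 E2 /=.
  transitivity ((q ^+ t.+1 * qint q a.+1 + q ^- a.+1 * qint q t.+1) / qint q k.+1 * crd v a).
    by rewrite Ek !exprS; field; rewrite k1 !qX q0.
  by rewrite -Eab divff // mul1r.
Qed.
End WeylTensor.

(** Neighbours on the half-line before truncation; for [k = l - 2] this includes the label
    [l - 1]. *)
Definition adjacent (k : nat) : seq nat := k.+1 :: (if k is k'.+1 then [:: k'] else [::]).

Section WeylSumTensor.
Variables (F : fieldType) (q : F) (l : nat).
Hypotheses (q0 : q != 0) (hl : (3 <= l)%N) (hql : l.-primitive_root (q ^+ 2)).
Let qq1 := q_subV_neq0 q0 hl hql.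

Lemma giso_gdbl_W k : (k.+1 < l)%N -> giso (gdbl q (W q k)) (WS q (adjacent k)).
Proof.
move=> kl; have k1 : qint q k.+1 != 0 by apply: (qint_neq0 q0 hl hql).
apply: giso_sym; case: k kl k1 => [|n] kl k1 /=.
  apply: (@giso_biprod F (W q 1) (gzero F) (gdbl q (W q 0)) (up_in q 0) (down_in q 0 0)
    (up_pr q 0) (down_pr q 0 0)).
  - exact: up_in_hom.
  - by move=> u; apply: trmx_inj; apply: mx_dim0.
  - exact: up_pr_in.
  - exact: down_pr_in.
  - exact: up_pr_down_in.
  - exact: down_pr_up_in.
  exact: up_down_in_pr.
apply: giso_trans (giso_gdsum (giso_refl _) (giso_trans (giso_gdsumC _ _) (giso_gzerol _))) _.
apply: (@giso_biprod F (W q n.+2) (W q n) (gdbl q (W q n.+1)) (up_in q n.+1) (down_in q n.+1 n.+1)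
  (up_pr q n.+1) (down_pr q n.+1 n.+1)).
- exact: up_in_hom.
- exact: down_in_hom.
- exact: up_pr_in.
- exact: down_pr_in.
- exact: up_pr_down_in.
- exact: down_pr_up_in.
exact: up_down_in_pr.
Qed.

Lemma giso_gdbl_WS L : all (fun k => (k.+1 < l)%N) L ->
  giso (gdbl q (WS q L)) (WS q (flatten (map adjacent L))).
Proof.
elim: L => [|k L IHL] /=; first by move=> _; apply: giso_dim0.
case/andP=> kl Ll; apply: giso_trans (giso_sym (giso_gdbl_gdsum _ _ _)) _.
apply: giso_trans (giso_gdsum (giso_gdbl_W kl) (IHL Ll)) _.
exact/giso_sym/giso_WS_cat.
Qed.

Lemma giso_tens_WS M D L : all (fun k => (k.+1 < l)%N) L -> giso M (WS q L) ->
  giso D (W q 1) -> giso (gtens q M D) (WS q (flatten (map adjacent L))).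
Proof.
move=> Ll ML D1; apply: giso_trans (giso_gdbl_WS Ll).
apply: giso_trans (giso_tens q ML D1) _.
exact/giso_sym/giso_gdbl_tens.
Qed.
End WeylSumTensor.

(** * Modules over the quantum group *)

Local Notation U_A := (UA vv).

Definition uelt (u : uop) : U_A := match u with
  | UE r => LusE vv r
  | UF r => LusF vv r
  | UK => LusK vv
  | UKi => LusKi vv
  end.

Section UvRelations.
Variables (k : pzRingType) (A : pzAlgType k) (S : A -> Prop).
Implicit Types f g h : A.

Lemma to_quot_inv f g : S (f * g - 1) -> to_quot S f * to_quot S g = 1.
Proof. by move/to_quot_rel; rewrite rmorphM rmorph1. Qed.

Lemma to_quot_conj f g h a : S (f * g * h - a%:S * g) ->
  to_quot S f * to_quot S g * to_quot S h = a%:S * to_quot S g.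
Proof. by move/to_quot_rel; rewrite !rmorphM. Qed.

Lemma to_quot_bracket f g h h' a : S (f * g - g * f - a%:S * (h - h')) ->
  to_quot S f * to_quot S g - to_quot S g * to_quot S f
    = a%:S * (to_quot S h - to_quot S h').
Proof. by move/to_quot_rel; rewrite rmorphB !rmorphM rmorphB. Qed.
End UvRelations.

Lemma vKKi (k : fieldType) (v : k) : vK v * vKi v = 1.
Proof. exact: to_quot_inv (Uv_KKi v). Qed.

Lemma vKiK (k : fieldType) (v : k) : vKi v * vK v = 1.
Proof. exact: to_quot_inv (Uv_KiK v). Qed.

Lemma vKE_conj (k : fieldType) (v : k) : vK v * vE v * vKi v = (v ^+ 2)%:S * vE v.
Proof. exact: to_quot_conj (Uv_KE v). Qed.

Lemma vKF_conj (k : fieldType) (v : k) : vK v * vF v * vKi v = (v ^- 2)%:S * vF v.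
Proof. exact: to_quot_conj (Uv_KF v). Qed.

Lemma vEF_bracket (k : fieldType) (v : k) :
  vE v * vF v - vF v * vE v = ((v - v^-1)^-1)%:S * (vK v - vKi v).
Proof. exact: to_quot_bracket (Uv_EF v). Qed.

Lemma UA_valP (x : U_A) : in_UA (UA_val x).
Proof. by case: x => y /= /asboolP. Qed.

Lemma LusKKi : LusK vv * LusKi vv = 1 :> U_A.
Proof. by apply/val_inj; apply: vKKi. Qed.

Lemma LusKiK : LusKi vv * LusK vv = 1 :> U_A.
Proof. by apply/val_inj; apply: vKiK. Qed.

Lemma vv_neq0 : vv != 0.
Proof. by rewrite /vv tofrac_eq0 polyX_eq0. Qed.

Lemma Lusv_inv : Lusv vv * toUA (UA_vi vv) = 1 :> U_A.
Proof.
apply/val_inj; have E : vv%:S * (vv^-1)%:S = 1 :> Uv vv.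
  by rewrite -rmorphM divff ?rmorph1 // vv_neq0.
exact: E.
Qed.

Lemma UA_ind (P : U_A -> Prop) :
  P (Lusv vv) -> P (toUA (UA_vi vv)) -> (forall u, P (uelt u)) -> P 1 ->
  (forall x y, P x -> P y -> P (x - y)) -> (forall x y, P x -> P y -> P (x * y)) ->
  forall x, P x.
Proof.
move=> Pv Pvi Pu P1 PB PM x.
suff H (y : Uv vv) : in_UA y -> forall z : U_A, UA_val z = y -> P z by apply: H (UA_valP x) _ _.
have E (z w : U_A) : UA_val z = UA_val w -> z = w by move=> zw; apply: val_inj.
elim=> [||||r|r||a b ha IHa hb IHb|a b ha IHa hb IHb] z zE.
- by rewrite (E z (Lusv vv) zE).
- by rewrite (E z (toUA (UA_vi vv)) zE).
- by rewrite (E z (uelt UK) zE).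
- by rewrite (E z (uelt UKi) zE).
- by rewrite (E z (uelt (UE r)) zE).
- by rewrite (E z (uelt (UF r)) zE).
- by rewrite (E z 1 zE).
- rewrite (E z (toUA ha - toUA hb)); first by apply: PB; [apply: IHa|apply: IHb].
  by rewrite zE.
- rewrite (E z (toUA ha * toUA hb)); first by apply: PM; [apply: IHa|apply: IHb].
  by rewrite zE.
Qed.

Section UqModules.
Variables (F : fieldType) (q : F).
Hypothesis q0 : q != 0.
Implicit Types M N T : Uqmod q.

Definition gm M : gmod F := Gmod (fun u => mact M (uelt u)).

Lemma mact_vi M : mact M (toUA (UA_vi vv)) = q^-1%:M.
Proof.
have := congr1 (mact M) Lusv_inv; rewrite rmorphM rmorph1 mact_v.
move/(congr1 (fun X => q^-1%:M *m X)); rewrite mulmxA mulmx1.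
by rewrite -scalar_mxM mulVf // mul1mx.
Qed.

(** [U_A] is generated as a ring by these elements together with [v] and [v^-1], which act by
    scalars. *)
Lemma is_homP M N (f : 'M[F]_(mdim N, mdim M)) :
  is_hom f <-> @ghom F (gm M) (gm N) f.
Proof.
split=> [hf u|hf]; first exact: hf.
elim/UA_ind=> [||u||x y hx hy|x y hx hy].
- by rewrite !mact_v scalar_mxC.
- by rewrite !mact_vi scalar_mxC.
- exact: hf.
- by rewrite !rmorph1 mulmx1 mul1mx.
- by rewrite !rmorphB mulmxBr mulmxBl hx hy.
- by rewrite !rmorphM -[_ * _]/(_ *m _) -[mact N x * _]/(_ *m _) mulmxA hx -!mulmxA hy.
Qed.

Lemma isoP M N : iso M N <-> giso (gm M) (gm N).
Proof.
by split=> -[f [g [hf fg gf]]]; exists f, g; split=> //; apply/is_homP.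
Qed.

(** The matrix of [K^-1], absent from [realizes], is forced by that of [K]. *)
Lemma realizesP M d (E Fd : nat -> 'M[F]_d) (K Ki : 'M[F]_d) :
  K *m Ki = 1%:M ->
  realizes M E Fd K <-> giso (gm M) (@Gmod F d (fun u => match u with
     | UE r => E r | UF r => Fd r | UK => K | UKi => Ki end)).
Proof.
move=> KKi; split=> [[B [B' [BB' B'B hE hF hK]]]|/giso_sym[B [B' [hB BB' B'B]]]].
  apply: giso_sym; exists B, B'; split=> // -[r|r||] /=;
    [exact: esym (hE r)|exact: esym (hF r)|exact: esym hK|].
  have KiK : mact M (LusKi vv) *m mact M (LusK vv) = 1%:M.
    by rewrite -[_ *m _]/(_ * _) -rmorphM LusKiK rmorph1.
  by rewrite -[LHS]mul1mx -KiK -!mulmxA [mact M (LusK vv) *m _]mulmxA hK -mulmxA KKi mulmx1.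
exists B, B'; split=> // [r|r|].
- exact: esym (hB (UE r)).
- exact: esym (hB (UF r)).
exact: esym (hB UK).
Qed.

Lemma giso_ext d (a b : uop -> 'M[F]_d) : a =1 b -> giso (Gmod a) (Gmod b).
Proof.
move=> ab; exists 1%:M, 1%:M; split; rewrite ?mulmx1 // => u /=.
by rewrite ab mul1mx mulmx1.
Qed.

Lemma WeylKKi n : WeylK q n *m WeylKi q n = 1%:M.
Proof.
apply: mulmx_cV_eq => v; apply: crdP => a an; rewrite -mulmxA WeylK_opmx WeylKi_opmx mul1mx.
rewrite !crd_opmx //; have qn m : q ^+ m != 0 by rewrite expf_neq0.
by field; rewrite !qn.
Qed.

Lemma is_WeylP n M : is_Weyl n M <-> giso (gm M) (W q n).
Proof. exact: (realizesP M _ _ (WeylKKi n)). Qed.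

Lemma is_tensorP M N T : is_tensor M N T <-> giso (gm T) (gtens q (gm M) (gm N)).
Proof.
have KKi X : mact X (LusK vv) *m mact X (LusKi vv) = 1%:M :> 'M[F]_(mdim X).
  by rewrite -[_ *m _]/(_ * _) -rmorphM LusKKi rmorph1.
have KK : tensK M N *m (mact M (LusKi vv) *t mact N (LusKi vv)) = 1%:M.
  by rewrite /tensK tensmx_mul !KKi tensmx11.
have E : giso (@Gmod F _ (fun u => match u with
     | UE r => tensE M N r | UF r => tensF M N r | UK => tensK M N
     | UKi => mact M (LusKi vv) *t mact N (LusKi vv) end)) (gtens q (gm M) (gm N)).
  apply: giso_ext => -[r|r||] //=; apply: eq_bigr => a _.
    by rewrite rmorphM rmorphXn.
  by rewrite rmorphM rmorphXn.
apply: iff_trans (realizesP _ _ _ KK) _; split=> H; first exact: giso_trans H E.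
exact: giso_trans H (giso_sym E).
Qed.

Lemma giso_dsum M N : giso (gm (dsum M N)) (gdsum (gm M) (gm N)).
Proof. by exists 1%:M, 1%:M; rewrite mulmx1; split=> // u; rewrite mul1mx mulmx1. Qed.

Lemma gm_zero : giso (gm (zero_mod q)) (gzero F).
Proof. exact: giso_dim0. Qed.

Section ImageModule.
Variables (M : Uqmod q) (r : nat) (a : 'M[F]_(mdim M, r)) (b : 'M[F]_(r, mdim M)).
Hypotheses (ba : b *m a = 1%:M) (hab : @ghom F (gm M) (gm M) (a *m b)).

(** The image of the idempotent [a b], on which [x] acts by [b x a]; this is multiplicative because
    [a b] commutes with the action. *)
Lemma image_module_exists : exists A : Uqmod q, exists (i : 'M[F]_(mdim M, mdim A))
   (p : 'M[F]_(mdim A, mdim M)),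
   [/\ mdim A = r, is_hom i, is_hom p, p *m i = 1%:M & i *m p = a *m b].
Proof.
have /is_homP hE := hab.
pose act (x : U_A) : 'M[F]_r := b *m mact M x *m a.
have actB : zmod_morphism act.
  by move=> x y; rewrite /act rmorphB mulmxBr mulmxBl.
have ax x : a *m (b *m mact M x *m a) = mact M x *m a.
  by rewrite !mulmxA hE -!mulmxA ba mulmx1.
have actM : monoid_morphism act.
  split=> [|x y]; first by rewrite /act rmorph1 mulmx1.
  rewrite /act rmorphM -[RHS]/(_ *m _) -[mact M x * _]/(_ *m _).
  by rewrite -[RHS](mulmxA (b *m mact M x)) ax !mulmxA.
pose m1 := GRing.isZmodMorphism.Build _ _ act actB.
pose m2 := GRing.isMonoidMorphism.Build _ _ act actM.
pose f : {rmorphism U_A -> 'M[F]_r} := HB.pack act m1 m2.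
have fv : f (Lusv vv) = q%:M.
  by rewrite /f /= /act mact_v mul_mx_scalar -scalemxAl ba scalemx1.
exists (MkUqmod fv), a, b; split=> //.
move=> x; have E : b *m mact M x = b *m mact M x *m a *m b.
  by rewrite -!mulmxA -hE !mulmxA ba mul1mx.
exact: E.
Qed.
End ImageModule.

Lemma mulmx_cancel_base m n p (pc : 'M[F]_(n, m)) (c : 'M_(m, n)) (r : 'M_(n, p)) pr
    (x : 'M_n) : pc *m c = 1%:M -> r *m pr = 1%:M -> c *m x *m r = c *m r -> x = 1%:M.
Proof.
move=> cc rr E; transitivity (pc *m (c *m x *m r) *m pr).
  by rewrite !mulmxA cc mul1mx -mulmxA rr mulmx1.
by rewrite E !mulmxA cc mul1mx rr.
Qed.

(** Rank factorisations of [e] and [1 - e] realise the two images with dimension equal to the rank,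
    so a zero summand means [e = 0] or [e = 1]. *)
Lemma idempotent_split M (e : 'M[F]_(mdim M)) : is_hom (M := M) (N := M) e ->
  e *m e = e -> exists A B : Uqmod q,
    [/\ iso M (dsum A B), mdim A = \rank e & mdim B = \rank (1%:M - e)].
Proof.
move=> he ee; have factor (e' : 'M[F]_(mdim M)) : e' *m e' = e' ->
    exists (a : 'M[F]_(mdim M, \rank e')) (b : 'M[F]_(\rank e', mdim M)),
      a *m b = e' /\ b *m a = 1%:M.
  move=> ee'; exists (col_base e'), (row_base e'); split; first exact: mulmx_base.
  have E : col_base e' *m (row_base e' *m col_base e') *m row_base e'
      = col_base e' *m row_base e'.
    by rewrite mulmxA mulmx_base -mulmxA mulmx_base ee'.
  have cc : pinvmx (col_base e') *m col_base e' = 1%:M.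
    by rewrite mulVpmx // col_base_full.
  have rr : row_base e' *m pinvmx (row_base e') = 1%:M.
    by rewrite mulmxVp // row_base_free.
  exact: mulmx_cancel_base cc rr E.
pose e' : 'M[F]_(mdim M) := 1%:M - e.
have ee' : e' *m e' = e'.
  by rewrite /e' mulmxBl mul1mx mulmxBr mulmx1 ee subrr subr0.
have he' : is_hom (M := M) (N := M) e'.
  by move=> x; rewrite /e' mulmxBl mulmxBr mul1mx mulmx1 he.
have [a [b [ab ba]]] := factor _ ee; have [a' [b' [ab' ba']]] := factor _ ee'.
have [|A [i [p [dA hi hp pi ip]]]] := image_module_exists ba.
  by rewrite ab; apply/is_homP.
have [|B [i' [p' [dB hi' hp' pi' ip']]]] := image_module_exists ba'.
  by rewrite ab'; apply/is_homP.
exists A, B; split=> //; apply/isoP/giso_sym.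
apply: giso_trans (giso_dsum A B) _.
have z1 : e *m e' = 0 by rewrite /e' mulmxBr mulmx1 ee subrr.
have z2 : e' *m e = 0 by rewrite /e' mulmxBl mul1mx ee subrr.
have pE : p = p *m e by rewrite -ab -ip mulmxA pi mul1mx.
have iE : i = e *m i by rewrite -ab -ip -mulmxA pi mulmx1.
have pE' : p' = p' *m e' by rewrite -ab' -ip' mulmxA pi' mul1mx.
have iE' : i' = e' *m i' by rewrite -ab' -ip' -mulmxA pi' mulmx1.
apply: (@giso_biprod F (gm A) (gm B) (gm M) i i' p p') => //.
- exact/is_homP.
- exact/is_homP.
- by rewrite pE iE' mulmxA -(mulmxA p) z1 mulmx0 mul0mx.
- by rewrite pE' iE mulmxA -(mulmxA p') z2 mulmx0 mul0mx.
by rewrite ip ip' ab ab' /e' addrC subrK.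
Qed.

Lemma indecomposable_idempotent M (e : 'M[F]_(mdim M)) : indecomposable M ->
  is_hom (M := M) (N := M) e -> e *m e = e -> e = 0 \/ e = 1%:M.
Proof.
move=> [_ ind] he ee; have [A [B [isoM dA dB]]] := idempotent_split he ee.
have [A0|B0] := ind A B isoM; [left|right]; apply/eqP.
  by rewrite -mxrank_eq0 -dA A0.
by rewrite eq_sym -subr_eq0 -mxrank_eq0 -dB B0.
Qed.
End UqModules.

(** * Weyl modules by specialisation *)

Section Specialization.
Variables (F : fieldType) (q : F).
Hypothesis q0 : q != 0.

(* [c] is the value at [v = q] of the Laurent polynomial [x] in Z[v, v^-1]. *)
Definition specializes (x : Qv) (c : F) : Prop :=
  exists (p : {poly int}) (m : nat),
    x * vv ^+ m = tofrac (map_poly intr p) /\ c * q ^+ m = (map_poly intr p).[q].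

Let qX m : q ^+ m != 0. Proof. by rewrite expf_neq0. Qed.
Let vX m : vv ^+ m != 0. Proof. by rewrite expf_neq0 // vv_neq0. Qed.

Let tofracX m : vv ^+ m = tofrac ('X^m : {poly rat}).
Proof. by rewrite /vv rmorphXn. Qed.

(** After cross-multiplication the two numerators agree already in Z[X], since Z embeds in Q, and
    can then be evaluated at [q] in any field. *)
Lemma specializes_inj x c c' : specializes x c -> specializes x c' -> c = c'.
Proof.
move=> [p [m [xp cp]]] [p' [m' [xp' cp']]].
have E : p * 'X^m' = p' * 'X^m.
  apply: (map_inj_poly (@intr_inj rat) (rmorph0 _)).
  rewrite !rmorphM /= !map_polyXn; apply/eqP; rewrite -tofrac_eq !rmorphM /= -!tofracX -xp -xp'.
  by rewrite mulrAC.
have /(congr1 (fun r => (map_poly intr r).[q])) := E.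
rewrite !rmorphM /= !map_polyXn !hornerM !hornerXn -cp -cp' mulrAC.
by move/(mulIf (qX m))/(mulIf (qX m')).
Qed.

Lemma specializesD x y c d : specializes x c -> specializes y d -> specializes (x + y) (c + d).
Proof.
move=> [p [m [xp cp]]] [p' [m' [yp dp]]]; exists (p * 'X^m' + p' * 'X^m), (m + m')%N.
rewrite !rmorphD !rmorphM /= !map_polyXn !hornerD !hornerM !hornerXn -cp -dp; split; last first.
  by rewrite exprD; ring.
by rewrite ?rmorphD ?rmorphM /= -!tofracX -xp -yp exprD; ring.
Qed.

Lemma specializesM x y c d : specializes x c -> specializes y d -> specializes (x * y) (c * d).
Proof.
move=> [p [m [xp cp]]] [p' [m' [yp dp]]]; exists (p * p'), (m + m')%N.
rewrite !rmorphM /= hornerM -cp -dp -xp -yp !exprD.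
by split; ring.
Qed.

Lemma specializes_int (n : int) : specializes n%:~R n%:~R.
Proof.
exists n%:P, 0%N; rewrite !expr0 !mulr1 !map_polyC /= hornerC; split=> //.
by rewrite -[RHS]/((@tofrac _ \o polyC) (n%:~R : rat)) rmorph_int.
Qed.

Lemma specializes0 : specializes 0 0.
Proof. exact: (specializes_int 0). Qed.

Lemma specializes1 : specializes 1 1.
Proof. exact: (specializes_int 1). Qed.

Lemma specializesN x c : specializes x c -> specializes (- x) (- c).
Proof.
by move=> xc; rewrite -[- x]mulN1r -[- c]mulN1r; apply: specializesM (specializes_int (-1)) xc.
Qed.

Lemma specializesB x y c d : specializes x c -> specializes y d -> specializes (x - y) (c - d).
Proof. by move=> hx /specializesN; apply: specializesD. Qed.

Lemma specializesX m : specializes (vv ^+ m) (q ^+ m).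
Proof.
exists 'X^m, 0%N; rewrite !expr0 !mulr1 !map_polyXn hornerXn; split=> //.
Qed.

Lemma specializesXV m : specializes (vv ^- m) (q ^- m).
Proof.
exists 1, m; rewrite !rmorph1 hornerC !mulVf //.
Qed.

Lemma specializes_sum (I : Type) (r : seq I) (f : I -> Qv) (g : I -> F) :
  (forall i, specializes (f i) (g i)) -> specializes (\sum_(i <- r) f i) (\sum_(i <- r) g i).
Proof.
move=> fg; elim: r => [|i r IHr]; first by rewrite !big_nil; apply: specializes0.
by rewrite !big_cons; apply: specializesD.
Qed.

Lemma specializes_qbin n t : specializes (qbin vv n t) (qbin q n t).
Proof.
elim: n t => [|n IHn] [|t]; try exact: specializes1; first exact: specializes0.
by rewrite !qbinS; apply: specializesD; apply: specializesM => //;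
  [apply: specializesX | apply: specializesXV].
Qed.

Lemma specializes_qbinz m t : specializes (qbinz vv m t) (qbinz q m t).
Proof.
case: m => m /=; first exact: specializes_qbin.
apply: specializesM (specializes_qbin _ _).
elim: t => [|t IHt]; first by rewrite !expr0; apply: specializes1.
by rewrite !exprS; apply: specializesM IHt; apply: (specializes_int (-1)).
Qed.

(** A total function, to be applied to matrix entries; 0 is only the default outside Z[v, v^-1]. *)
Definition spec (x : Qv) : F :=
  if pselect (exists c, specializes x c) is left e then projT1 (cid e) else 0.

Lemma specE x c : specializes x c -> spec x = c.
Proof.
move=> xc; rewrite /spec; case: pselect => [e|[]]; last by exists c.
by case: cid => d xd /=; apply: specializes_inj xd xc.
Qed.

Definition mx_specializes m n (X : 'M[Qv]_(m, n)) (Y : 'M[F]_(m, n)) : Prop :=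
  forall i j, specializes (X i j) (Y i j).

Lemma map_mx_spec m n (X : 'M_(m, n)) Y : mx_specializes X Y -> map_mx spec X = Y.
Proof. by move=> XY; apply/matrixP=> i j; rewrite mxE (specE (XY i j)). Qed.

Lemma mx_specializesM m n p (X : 'M_(m, n)) (X' : 'M_(n, p)) Y Y' :
  mx_specializes X Y -> mx_specializes X' Y' -> mx_specializes (X *m X') (Y *m Y').
Proof. by move=> XY XY' i j; rewrite !mxE; apply: specializes_sum => k; apply: specializesM. Qed.

Lemma mx_specializesB m n (X X' : 'M_(m, n)) Y Y' :
  mx_specializes X Y -> mx_specializes X' Y' -> mx_specializes (X - X') (Y - Y').
Proof. by move=> XY XY' i j; rewrite !mxE; apply: specializesB. Qed.

Lemma mx_specializes_scalar n x c : specializes x c -> mx_specializes (x%:M : 'M_n) c%:M.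
Proof.
by move=> xc i j; rewrite !mxE; case: (i == j); rewrite ?mulr1n ?mulr0n //; apply: specializes0.
Qed.

Lemma mx_specializes_opmx m n phi f g : (forall i, specializes (f i) (g i)) ->
  mx_specializes (opmx m n phi f) (opmx m n phi g).
Proof. by move=> fg i j; rewrite !mxE; case: ifP => _ //; apply: specializes0. Qed.
End Specialization.

Lemma alg_morphism_comb (k : pzRingType) (A B : pzAlgType k) (f : {rmorphism A -> B})
    (a b c : k) (x y : A) : alg_morphism f ->
  f (a%:S * (b%:S * x - c%:S * y)) = a%:S * (b%:S * f x - c%:S * f y).
Proof. by move=> fS; rewrite rmorphM rmorphB !rmorphM !fS. Qed.

Section GenericWeyl.
Variables (k : fieldType) (v : k).
Hypotheses (v0 : v != 0) (vv1 : v - v^-1 != 0).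
Variable n : nat.

Let E := WeylE v n 1.
Let Fm := WeylF v n 1.
Let K := WeylK v n.
Let Ki := WeylKi v n.
Let vX m : v ^+ m != 0. Proof. by rewrite expf_neq0. Qed.

Lemma Weyl_KKi : K *m Ki = 1%:M. Proof. exact: WeylKKi. Qed.
Lemma Weyl_KiK : Ki *m K = 1%:M. Proof. exact: mulmx1C (Weyl_KKi). Qed.

Lemma Weyl_KE : K *m E *m Ki = v ^+ 2 *: E.
Proof.
rewrite /K /E /Ki WeylK_opmx WeylE_opmx WeylKi_opmx.
apply: mulmx_cV_eq => w; apply: crdP => a an.
rewrite -!mulmxA -scalemxAl crdZ !crd_opmx_if /= an addn1 ltnS.
have [an1|an1] := ltnP a n; last first.
  by rewrite qbin_small ?mul0r ?mulr0 //; lia.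
by rewrite doubleS !exprS; field; rewrite !vX.
Qed.

Lemma Weyl_KF : K *m Fm *m Ki = v ^- 2 *: Fm.
Proof.
rewrite /K /Fm /Ki WeylK_opmx WeylF_opmx WeylKi_opmx.
apply: mulmx_cV_eq => w; apply: crdP => -[|a] an.
  by rewrite -!mulmxA -scalemxAl crdZ !crd_opmx // qbin_small // !(mul0r, mulr0).
rewrite -!mulmxA -scalemxAl crdZ !crd_opmx // subn1 /=; last exact: ltnW.
by rewrite doubleS !exprS; field; rewrite !vX v0.
Qed.

Lemma Weyl_EF : E *m Fm - Fm *m E = (v - v^-1)^-1 *: (K - Ki).
Proof.
rewrite /E /Fm /K /Ki WeylK_opmx WeylE_opmx WeylF_opmx WeylKi_opmx.
apply: mulmx_cV_eq => w; apply: crdP => a an.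
rewrite mulmxBl -scalemxAl mulmxBl -!scaleN1r !crdD !crdZ !crdD !crdZ -!mulmxA !crd_opmx_if an !qbin1 //.
rewrite !addn1 !subn1 /=; have [b Eb] : exists b, n = (a + b)%N by exists (n - a)%N; lia.
have Eb' : (n - a = b)%N by lia.
have Eb1 : (n - a.-1 = if a is 0 then b else b.+1)%N by case: (a) Eb => [|c]; lia.
(* With [n = a + b], this is [[b] [a + 1] - [a] [b + 1] = [b - a]], written so that no negative
   index appears. *)
have key : qint v b * qint v a.+1 - qint v a * qint v b.+1
    = (v - v^-1)^-1 * (v ^- a * v ^+ b - v ^- b * v ^+ a).
  rewrite -[a.+1]addn1 -[b.+1]addn1 !qintD // qint1 // !expr1.
  transitivity (v ^- a * qint v b - v ^- b * qint v a); first by ring.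
  by rewrite /qint; move: (v - v^-1)^-1 => d; ring.
have -> : qint v (n - a) * (if (a.+1 < n.+1)%N then qint v a.+1 * crd w a else 0)
    = qint v b * qint v a.+1 * crd w a.
  rewrite Eb'; case: ltnP => ab; first by rewrite mulrA.
  by rewrite (_ : b = 0)%N ?qint0 ?mul0r //; lia.
have -> : qint v a * (if (a.-1 < n.+1)%N then qint v (n - a.-1) * crd w (a.-1).+1 else 0)
    = qint v a * qint v b.+1 * crd w a.
  case: a an Eb Eb' Eb1 key => [|a] an Eb Eb' Eb1 key; first by rewrite qint0 !mul0r.
  by rewrite /= Eb1 ltnW // mulrA.
have -> : v ^+ n = v ^+ a * v ^+ b by rewrite Eb exprD.
rewrite mulN1r -mulrBl key -addnn !exprD; move: (v - v^-1)^-1 => d.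
by field; rewrite !vX.
Qed.

Lemma WeylE_mul r : E *m WeylE v n r = qint v r.+1 *: WeylE v n r.+1.
Proof.
rewrite /E !WeylE_opmx; apply: mulmx_cV_eq => w; apply: crdP => a an.
rewrite -mulmxA -scalemxAl crdZ !crd_opmx_if an qbin1 // addn1 addnS addSn.
have [an1|an1] := ltnP a n; last first.
  by rewrite (eqP (_ : n - a == 0)%N) // qint0 mul0r [qbin v 0 _]qbin_small // mul0r mulr0.
rewrite ltnS an1 mulrA [RHS]mulrA; congr (_ * _).
have [m Em] : exists m, (n - a = m.+1)%N by exists (n - a.+1)%N; lia.
by rewrite (_ : n - a.+1 = m)%N ?Em ?qbin_absorb //; lia.
Qed.

Lemma WeylF_mul r : Fm *m WeylF v n r = qint v r.+1 *: WeylF v n r.+1.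
Proof.
rewrite /Fm !WeylF_opmx; apply: mulmx_cV_eq => w; apply: crdP => -[|a] an.
  rewrite -mulmxA -scalemxAl crdZ !crd_opmx_if an.
  by rewrite [qbin v 0 1]qbin_small // [qbin v 0 r.+1]qbin_small // !mul0r mulr0.
rewrite -mulmxA -scalemxAl crdZ !crd_opmx_if an qbin1 // subn1 /= subSS ltnW //.
by rewrite mulrA [RHS]mulrA qbin_absorb.
Qed.

Lemma qfactS r : qfact v r.+1 = qfact v r * qint v r.+1.
Proof. by rewrite /qfact big_nat_recr. Qed.

Lemma WeylE_exp r : E ^+ r = qfact v r *: WeylE v n r.
Proof.
elim: r => [|r IHr]; first by rewrite expr0 WeylE0 /qfact big_geq // scale1r.
rewrite exprS IHr -[LHS]/(_ *m _) -scalemxAr WeylE_mul scalerA qfactS.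
by [].
Qed.

Lemma WeylF_exp r : Fm ^+ r = qfact v r *: WeylF v n r.
Proof.
elim: r => [|r IHr]; first by rewrite expr0 WeylF0 /qfact big_geq // scale1r.
rewrite exprS IHr -[LHS]/(_ *m _) -scalemxAr WeylF_mul scalerA qfactS.
by [].
Qed.

Hypothesis vq : forall r, qint v r.+1 != 0.

(** The value of [[K; 0; t]] where [K] acts by the scalar [x]. *)
Definition kbin (x : k) (t : nat) : k :=
  \prod_(0 <= s < t) ((v ^+ s.+1 - v ^- s.+1)^-1 * (v ^- s * x - v ^+ s * x^-1)).

Lemma kbinS x t : kbin x t.+1 =
  kbin x t * ((v ^+ t.+1 - v ^- t.+1)^-1 * (v ^- t * x - v ^+ t * x^-1)).
Proof. by rewrite /kbin big_nat_recr. Qed.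

Let kbin_step a t x y : qint v t.+1 * y = qint v a * x ->
  x * ((v ^+ t.+1 - v ^- t.+1)^-1 * (v ^+ a - v ^- a)) = y.
Proof.
move=> yx; rewrite !qint_def //; apply: (mulfI (vq t)); rewrite yx.
move: (v - v^-1) vv1 (qint v t.+1) (vq t) => d d0 z z0.
by field; rewrite ?d0 ?z0.
Qed.

Lemma kbin_nat p t : kbin (v ^+ p) t = qbin v p t.
Proof.
elim: t => [|t IHt]; first by rewrite qbin0 /kbin big_geq.
rewrite kbinS IHt; have [pt|tp] := ltnP p t.
  by rewrite !qbin_small ?mul0r // ltnW.
rewrite -(kbin_step (qbin_absorb_sub v0 vv1 p t)).
have -> : v ^+ p = v ^+ (p - t) * v ^+ t by rewrite -exprD subnK.
by congr (_ * (_ * _)); field; rewrite !vX.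
Qed.

Lemma kbin_neg p t : kbin (v ^- p.+1) t = (-1) ^+ t * qbin v (p + t) t.
Proof.
elim: t => [|t IHt]; first by rewrite qbin0 /kbin big_geq // mulr1.
rewrite kbinS IHt addnS -(kbin_step (qbin_absorb v0 vv1 (p + t) t)).
rewrite invrK [(-1) ^+ t.+1]exprS (_ : v ^+ (p + t).+1 = v ^+ p.+1 * v ^+ t); last by rewrite -exprD.
rewrite invfM.
by move: (_ - _)^-1 => d; ring.
Qed.

Lemma qbinz_kbin (m : int) t : qbinz v m t = kbin (v ^ m) t.
Proof. by case: m => m; rewrite /= ?kbin_nat // -kbin_neg. Qed.

Lemma qfact_neq0 r : qfact v r != 0.
Proof.
elim: r => [|r IHr]; first by rewrite /qfact big_geq ?oner_eq0.
by rewrite qfactS mulf_neq0.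
Qed.

Definition Weyl_gen (g : Ugen) : 'M[k]_n.+1 :=
  match g with gE => E | gF => Fm | gK => K | gKi => Ki end.

(** Since all [[r]] with [r > 0] are invertible here, [E] and [F] determine the divided powers, and
    only the five relators have to be checked. *)
Lemma generic_Weyl_exists : exists rho : {rmorphism Uv v -> 'M[k]_n.+1},
  [/\ forall a, rho a%:S = a%:M, forall r, rho (vEdiv v r) = WeylE v n r,
      forall r, rho (vFdiv v r) = WeylF v n r, rho (vK v) = K /\ rho (vKi v) = Ki
    & forall t, rho (vKbin v t) = opmx _ _ id (fun a => kbin (v ^+ n * v ^- a.*2) t)].
Proof.
have [x|rho [rhoS rhog]] := @presented_ext k Ugen (@Uv_relator k v) 'M[k]_n.+1 Weyl_gen.
  case.
  - by rewrite free_ext_inv; apply/eqP; rewrite subr_eq0; apply/eqP/Weyl_KKi.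
  - by rewrite free_ext_inv; apply/eqP; rewrite subr_eq0; apply/eqP/Weyl_KiK.
  - rewrite free_ext_conj; apply/eqP; rewrite subr_eq0; apply/eqP.
    exact: etrans Weyl_KE (esym (mul_scalar_mx _ _)).
  - rewrite free_ext_conj; apply/eqP; rewrite subr_eq0; apply/eqP.
    exact: etrans Weyl_KF (esym (mul_scalar_mx _ _)).
  - rewrite free_ext_bracket; apply/eqP; rewrite subr_eq0; apply/eqP.
    exact: etrans Weyl_EF (esym (mul_scalar_mx _ _)).
have rhoE : rho (vE v) = E := rhog gE.
have rhoF : rho (vF v) = Fm := rhog gF.
have rhoK : rho (vK v) = K := rhog gK.
have rhoKi : rho (vKi v) = Ki := rhog gKi.
exists rho; split=> // [r|r|t].
- rewrite rmorphM rmorphXn rhoE WeylE_exp (rhoS _).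
  apply: etrans (mul_scalar_mx _ _) _.
  by rewrite scalerA mulVf ?scale1r // qfact_neq0.
- rewrite rmorphM rmorphXn rhoF WeylF_exp (rhoS _).
  apply: etrans (mul_scalar_mx _ _) _.
  by rewrite scalerA mulVf ?scale1r // qfact_neq0.
have rhobin s : rho (((v ^+ s.+1 - v ^- s.+1)^-1)%:S * ((v ^- s)%:S * vK v - (v ^+ s)%:S * vKi v))
   = (v ^+ s.+1 - v ^- s.+1)^-1 *: (v ^- s *: K - v ^+ s *: Ki).
  apply: etrans (alg_morphism_comb _ _ _ _ _ rhoS) _; rewrite rhoK rhoKi.
  apply: etrans (mul_scalar_mx _ _) _; congr (_ *: _); congr (_ - _); exact: mul_scalar_mx.
apply: etrans (rmorph_prod _ _ _ _) _; rewrite (eq_bigr _ (fun s _ => rhobin s)).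
elim: t => [|t IHt].
  rewrite big_geq //; apply/matrixP=> i j; rewrite !mxE /kbin big_geq //=.
  by rewrite eq_sym -(inj_eq val_inj); case: eqP.
rewrite big_nat_recr //= IHt /K /Ki WeylK_opmx WeylKi_opmx -[LHS]/(_ *m _).
apply: mulmx_cV_eq => w; apply: crdP => a an.
rewrite -mulmxA -scalemxAl mulmxBl -!scalemxAl -!scaleN1r !crd_opmx_if an crdZ crdD !crdZ !crd_opmx_if an.
rewrite kbinS invfM invrK; move: (_ - _)^-1 => d.
by ring.
Qed.
End GenericWeyl.

Lemma vv_expr_neq1 m : (0 < m)%N -> vv ^+ m != 1.
Proof.
move=> m0; rewrite /vv -rmorphXn -(rmorph1 (@tofrac {poly rat})) tofrac_eq.
apply/eqP => /(congr1 (fun p : {poly rat} => size p)).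
by rewrite size_polyXn size_poly1; lia.
Qed.

Lemma expr_subV_neq0 (k : fieldType) (v : k) m : v != 0 -> v ^+ (m + m) != 1 -> v ^+ m - v ^- m != 0.
Proof.
move=> v0 vm; have vm0 : v ^+ m != 0 by rewrite expf_neq0.
by rewrite subr_eq0 -(inj_eq (mulIf vm0)) mulVf // -exprD.
Qed.

Lemma qint_neq0_of (k : fieldType) (v : k) m :
  v - v^-1 != 0 -> v ^+ m - v ^- m != 0 -> qint v m != 0.
Proof. by move=> v1 vm; rewrite mulf_neq0 ?invr_eq0. Qed.

Lemma vv_subV_neq0 m : vv ^+ m.+1 - vv ^- m.+1 != 0.
Proof. exact (@expr_subV_neq0 Qv vv m.+1 vv_neq0 (vv_expr_neq1 (ltn0Sn _))). Qed.

Lemma vv1_neq0 : vv - vv^-1 != 0.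
Proof. exact: (vv_subV_neq0 0). Qed.

Lemma qint_vv_neq0 r : qint vv r.+1 != 0.
Proof. exact (@qint_neq0_of Qv vv r.+1 vv1_neq0 (vv_subV_neq0 r)). Qed.

Section WeylModules.
Variables (F : fieldType) (q : F).
Hypothesis q0 : q != 0.

Lemma Weyl_weight (k : fieldType) (v : k) n a : v != 0 ->
  v ^+ n * v ^- a.*2 = v ^ (n%:Z - a.*2%:Z).
Proof. by move=> v0; rewrite expfzDr // exprnN. Qed.

(** An element of [U_A] acts on the generic Weyl module by a matrix over Z[v, v^-1], because the
    generators do; its entries are evaluated at [q]. The last clause is kept for the computation of
    weights. *)
Lemma Wact_exists n : exists f : {rmorphism U_A -> 'M[F]_n.+1},
  [/\ f (Lusv vv) = q%:M, forall u, f (uelt u) = gact (W q n) u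
    & forall t x, UA_val x = vKbin vv t ->
        f x = opmx _ _ id (fun a => qbinz q (n%:Z - a.*2%:Z) t)].
Proof.
have [rho [rhoS rhoE rhoF [rhoK rhoKi] rhobin]] :=
  generic_Weyl_exists vv_neq0 vv1_neq0 n qint_vv_neq0.
have rhouelt u : mx_specializes q (rho (UA_val (uelt u))) (gact (W q n) u).
  case: u => [r|r||] /=.
  - rewrite rhoE !WeylE_opmx; apply: mx_specializes_opmx => a; exact: specializes_qbin.
  - rewrite rhoF !WeylF_opmx; apply: mx_specializes_opmx => a; exact: specializes_qbin.
  - rewrite rhoK !WeylK_opmx; apply: mx_specializes_opmx => a.
    by apply: specializesM; [apply: specializesX|apply: specializesXV].
  - rewrite rhoKi !WeylKi_opmx; apply: mx_specializes_opmx => a.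
    by apply: specializesM; [apply: specializesXV|apply: specializesX].
have rhoUA (x : U_A) : exists Y, mx_specializes q (rho (UA_val x)) Y.
  elim/UA_ind: x => [||u||x y [Y xY] [Z yZ]|x y [Y xY] [Z yZ]].
  - by exists q%:M; rewrite /= rhoS; apply: mx_specializes_scalar; apply: (specializesX q 1).
  - exists (q^-1)%:M; rewrite /= rhoS; apply: mx_specializes_scalar.
    exact: (specializesXV q0 1).
  - by exists (gact (W q n) u).
  - by exists 1%:M; rewrite /= rmorph1; apply: mx_specializes_scalar; apply: specializes1.
  - by exists (Y - Z); rewrite /= rmorphB; apply: mx_specializesB.
  by exists (Y *m Z); rewrite /= rmorphM; apply: mx_specializesM.
pose act (x : U_A) := map_mx (spec q) (rho (UA_val x)).
have actE x Y : mx_specializes q (rho (UA_val x)) Y -> act x = Y.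
  exact: map_mx_spec.
have actP x : mx_specializes q (rho (UA_val x)) (act x).
  by have [Y xY] := rhoUA x; rewrite (actE _ _ xY).
have actB : zmod_morphism act.
  by move=> x y; apply: actE; rewrite /= rmorphB; apply: mx_specializesB.
have actM : monoid_morphism act.
  split=> [|x y]; apply: actE.
    by rewrite /= rmorph1; apply: mx_specializes_scalar; apply: specializes1.
  by rewrite /= rmorphM; apply: mx_specializesM.
pose m1 := GRing.isZmodMorphism.Build _ _ act actB.
pose m2 := GRing.isMonoidMorphism.Build _ _ act actM.
pose f : {rmorphism U_A -> 'M[F]_n.+1} := HB.pack act m1 m2.
exists f; split=> [|u|t x xt]; apply: actE.
- by rewrite /= rhoS; apply: mx_specializes_scalar; apply: (specializesX q 1).
- exact: rhouelt.
rewrite xt rhobin; apply: mx_specializes_opmx => a.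
rewrite (Weyl_weight _ _ vv_neq0) -(qbinz_kbin vv_neq0 vv1_neq0 qint_vv_neq0).
exact: specializes_qbinz.
Qed.

Definition Wact n := projT1 (cid (Wact_exists n)).

Lemma WactP n : [/\ Wact n (Lusv vv) = q%:M, forall u, Wact n (uelt u) = gact (W q n) u
    & forall t x, UA_val x = vKbin vv t ->
        Wact n x = opmx _ _ id (fun a => qbinz q (n%:Z - a.*2%:Z) t)].
Proof. exact: projT2 (cid (Wact_exists n)). Qed.

Lemma Wact_v n : Wact n (Lusv vv) = q%:M.
Proof. by have [] := WactP n. Qed.

Definition Wmod n : Uqmod q := MkUqmod (Wact_v n).

Lemma giso_Wmod n : giso (gm (Wmod n)) (W q n).
Proof. by apply: giso_ext => u /=; have [_ ->] := WactP n. Qed.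

Lemma Wmod_bin n t x : UA_val x = vKbin vv t ->
  mact (Wmod n) x = opmx _ _ id (fun a => qbinz q (n%:Z - a.*2%:Z) t).
Proof. by have [_ _] := WactP n; apply. Qed.
End WeylModules.

(** * Lusztig's commutation formula *)

Section LusztigCommutation.
Variables (k : fieldType) (v : k).
Hypotheses (v0 : v != 0) (vv1 : v - v^-1 != 0) (vq : forall r, qint v r.+1 != 0).
Variables (A : pzAlgType k) (E Fm K Ki : A).
Hypotheses (KKi : K * Ki = 1) (KiK : Ki * K = 1)
  (KE : K * E * Ki = (v ^+ 2)%:S * E) (KF : K * Fm * Ki = (v ^- 2)%:S * Fm)
  (EF : E * Fm - Fm * E = ((v - v^-1)^-1)%:S * (K - Ki)).
Implicit Types (a b : k) (x y : A) (c : int).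

Definition central_scale a x : A := a%:S * x.
Local Notation "a <*> x" := (central_scale a x) (at level 40, left associativity) : ring_scope.

Let scE a x : a%:S * x = a <*> x. Proof. by []. Qed.
Let sA a b x : a <*> (b <*> x) = (a * b) <*> x.
Proof. by rewrite /central_scale rmorphM mulrA. Qed.
Let sAl a x y : a <*> x * y = a <*> (x * y). Proof. by rewrite /central_scale mulrA. Qed.
Let sAr a x y : x * (a <*> y) = a <*> (x * y).
Proof. by rewrite /central_scale mulrA -scalC mulrA. Qed.
Let s1 x : 1 <*> x = x. Proof. by rewrite /central_scale rmorph1 mul1r. Qed.
Let s0 x : 0 <*> x = 0. Proof. by rewrite /central_scale rmorph0 mul0r. Qed.
Let sDl a b x : (a + b) <*> x = a <*> x + b <*> x.
Proof. by rewrite /central_scale rmorphD mulrDl. Qed.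
Let sNl a x : (- a) <*> x = - (a <*> x).
Proof. by rewrite /central_scale rmorphN mulNr. Qed.
Let sDr a x y : a <*> (x + y) = a <*> x + a <*> y. Proof. exact: mulrDr. Qed.
Let sNr a x : a <*> (- x) = - (a <*> x). Proof. exact: mulrN. Qed.

Let d := (v - v^-1)^-1.

(* [K; c] = (v^c K - v^-c K^-1) / (v - v^-1) *)
Let L c : A := (d * v ^ c) <*> K + (- (d * v ^ (- c))) <*> Ki.

(** Comparison of the coefficients of [K] and of [K^-1]. *)
Let L_lin a1 a2 a3 c1 c2 c3 : a1 * v ^ c1 + a2 * v ^ c2 = a3 * v ^ c3 ->
  a1 * v ^ (- c1) + a2 * v ^ (- c2) = a3 * v ^ (- c3) ->
  a1 <*> L c1 + a2 <*> L c2 = a3 <*> L c3.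
Proof.
move=> H1 H2; rewrite /L !sDr !sA addrACA -!sDl.
congr (_ <*> _ + _ <*> _).
  by rewrite ![_ * (d * _)]mulrCA -mulrDr H1.
by rewrite !mulrN -opprD ![_ * (d * _)]mulrCA -mulrDr H2.
Qed.

Let LC c c' : L c * L c' = L c' * L c.
Proof.
rewrite /L !mulrDl !mulrDr !sAl !sAr !sA KKi KiK.
rewrite -!addrA ![d * v ^ c * _]mulrC ![- (d * v ^ (- c)) * _]mulrC; congr (_ + _).
by rewrite addrCA.
Qed.

Let KE' : K * E = (v ^+ 2) <*> (E * K).
Proof. by rewrite -sAl -scE -KE -mulrA KiK mulr1. Qed.
Let KiE : Ki * E = (v ^- 2) <*> (E * Ki).
Proof.
have v2 : v ^+ 2 != 0 by rewrite expf_neq0.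
have H : E * Ki = (v ^+ 2) <*> (Ki * E).
  by rewrite -sAr -scE -KE !mulrA KiK mul1r.
by rewrite H sA mulVf // s1.
Qed.
Let KF' : K * Fm = (v ^- 2) <*> (Fm * K).
Proof. by rewrite -sAl -scE -KF -mulrA KiK mulr1. Qed.
Let KiF : Ki * Fm = (v ^+ 2) <*> (Fm * Ki).
Proof.
have v2 : v ^+ 2 != 0 by rewrite expf_neq0.
have H : Fm * Ki = (v ^- 2) <*> (Ki * Fm).
  by rewrite -sAr -scE -KF !mulrA KiK mul1r.
by rewrite H sA mulfV // s1.
Qed.

Let LE c : E * L c = L (c - 2) * E.
Proof.
rewrite /L mulrDl mulrDr !sAl !sAr KE' KiE !sA.
congr (_ <*> _ + _ <*> _).
  by rewrite expfzDr // -mulrA -exprnN mulfVK // expf_neq0.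
rewrite opprB addrC expfzDr // mulNr; congr (- _).
by rewrite -mulrA -exprnP mulfK // expf_neq0.
Qed.

Let LF c : L c * Fm = Fm * L (c - 2).
Proof.
rewrite /L mulrDl mulrDr !sAl !sAr KF' KiF !sA.
congr (_ <*> _ + _ <*> _).
  by rewrite expfzDr // -mulrA -exprnN.
by rewrite opprB addrC expfzDr // mulNr -mulrA -exprnP.
Qed.

Let EFL : E * Fm = Fm * E + L 0.
Proof.
by rewrite -[LHS](subrK (Fm * E)) EF addrC /L oppr0 expr0z mulr1 sNl scE -sNr -sDr.
Qed.

Let E_Fexp r : E * Fm ^+ r.+1 = Fm ^+ r.+1 * E + (qint v r.+1) <*> (Fm ^+ r * L (- r%:Z)).
Proof.
elim: r => [|r IHr].
  by rewrite expr1 expr0 mul1r EFL qint1 // s1 oppr0.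
rewrite [in LHS]exprSr mulrA IHr mulrDl -mulrA EFL mulrDr !mulrA -exprSr -addrA.
congr (_ + _); rewrite sAl -!mulrA LF [Fm ^+ r * _]mulrA -exprSr -!sAr -mulrDr.
congr (_ * _); rewrite -[L 0]s1; apply: L_lin.
  rewrite expr0z -[r.+2]addn1 qintDV // qint1 // expr1 expfzDr // -!exprnN exprSr.
  by field; rewrite v0 expf_neq0.
rewrite oppr0 expr0z -[r.+2]addn1 qintD // qint1 // expr1 opprD !opprK expfzDr // -!exprnP exprSr.
by field; rewrite v0 expf_neq0.
Qed.

Let Ed r := (qfact v r)^-1 <*> E ^+ r.
Let Fd r := (qfact v r)^-1 <*> Fm ^+ r.
(** Lusztig's [[K; c, t]]; the product [vKbin] is the case [c = 0]. *)
Let bin c t : A := \prod_(0 <= s < t) ((qint v s.+1)^-1 <*> L (c - s%:Z)).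

Let Ed0 : Ed 0 = 1. Proof. by rewrite /Ed /qfact big_geq // invr1 s1. Qed.
Let Fd0 : Fd 0 = 1. Proof. by rewrite /Fd /qfact big_geq // invr1 s1. Qed.

Let qfactS r : qfact v r.+1 = qfact v r * qint v r.+1.
Proof. by rewrite /qfact big_nat_recr. Qed.

Let EdS p : Ed p.+1 = (qint v p.+1)^-1 <*> (E * Ed p).
Proof. by rewrite /Ed qfactS invfM exprS sAr sA mulrC. Qed.

Let EEd p : E * Ed p = qint v p.+1 <*> Ed p.+1.
Proof. by rewrite EdS sA divff // s1. Qed.

Let qfact_neq0 r : qfact v r != 0.
Proof.
elim: r => [|r IHr]; first by rewrite /qfact big_geq ?oner_eq0.
by rewrite qfactS mulf_neq0.
Qed.

Let EFd r : E * Fd r.+1 = Fd r.+1 * E + Fd r * L (- r%:Z).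
Proof.
rewrite /Fd sAr E_Fexp sDr !sAl sA; congr (_ + _ <*> _).
by rewrite qfactS invfM -mulrA mulVf // mulr1.
Qed.

Let binS c t : bin c t.+1 = (qint v t.+1)^-1 <*> (bin c t * L (c - t%:Z)).
Proof. by rewrite /bin big_nat_recr //= sAr. Qed.

Let bin0 c : bin c 0 = 1. Proof. by rewrite /bin big_geq. Qed.

Let L_bin c c' t : L c * bin c' t = bin c' t * L c.
Proof.
elim: t => [|t IHt]; first by rewrite bin0 mulr1 mul1r.
by rewrite binS sAr sAl mulrA IHt -mulrA LC mulrA.
Qed.

Let binSl c t : bin (c + 1) t.+1 = (qint v t.+1)^-1 <*> (L (c + 1) * bin c t).
Proof.
elim: t => [|t IHt]; first by rewrite binS !bin0 mulr1 mul1r subr0.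
rewrite binS IHt sAl -mulrA binS [in RHS]sAr (_ : c + 1 - t.+1%:Z = c - t%:Z); last by lia.
by [].
Qed.

Let E_bin c t : E * bin c t = bin (c - 2) t * E.
Proof.
elim: t => [|t IHt]; first by rewrite !bin0 mulr1 mul1r.
rewrite !binS sAr sAl mulrA IHt -mulrA LE mulrA.
by rewrite (_ : c - t%:Z - 2 = c - 2 - t%:Z) //; lia.
Qed.

Let vzB c (n : nat) : v ^ (c - n%:Z) = v ^ c * v ^- n.
Proof. by rewrite expfzDr // exprnN. Qed.

Let vzBN c (n : nat) : v ^ (- (c - n%:Z)) = v ^ (- c) * v ^+ n.
Proof. by rewrite opprB addrC expfzDr. Qed.

(** Merges the two contributions to one term of [Ediv_Fdiv]. Once the common factor is removed, it
    is a linear relation between three [L]. *)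
Let bin_key (p t : nat) (y : int) :
  (qint v p) <*> bin (y - p.+1%:Z) t.+1 + L y * bin (y - p.+1%:Z) t
  = (qint v (p + t.+1)) <*> bin (y - p%:Z) t.+1.
Proof.
have -> : y - p%:Z = y - p.+1%:Z + 1 by lia.
rewrite binSl binS !L_bin !sA -!sAr -[L y]s1 -mulrDr; congr (_ * _).
have -> : y - p.+1%:Z - t%:Z = y - (p + t.+1)%:Z by lia.
have -> : y - p.+1%:Z + 1 = y - p%:Z by lia.
have vn n : v ^+ n != 0 by rewrite expf_neq0.
apply: L_lin; rewrite ?vzB ?vzBN; have := vq t.
  by rewrite qintDV // !exprD; move: (qint v t.+1) => z z0; field; rewrite ?z0 !vn.
by rewrite qintD // !exprD; move: (qint v t.+1) => z z0; field; rewrite ?z0 !vn.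
Qed.

Let Edn p t : (t <= p)%N -> E * Ed (p - t) = qint v (p.+1 - t) <*> Ed (p.+1 - t).
Proof. by move=> tp; rewrite EEd subSn. Qed.

Let EFdn r t : (t < r)%N ->
  E * Fd (r - t) = Fd (r - t) * E + Fd (r - t.+1) * L (t.+1%:Z - r%:Z).
Proof.
move=> tr; have -> : (r - t = (r - t.+1).+1)%N by lia.
by rewrite EFd; congr (_ + _ * L _); lia.
Qed.

(** Multiply the formula for [p] by [E] on the left. Moving [E] past [F^(r - t)] either keeps [t],
    which gives [a t], or replaces [F^(r - t)] by the next lower power, which gives [b t]. The bound
    [p <= r] keeps the subtractions [r - t] exact. *)
Lemma Ediv_Fdiv p r : (p <= r)%N -> Ed p * Fd r =
  \sum_(t < p.+1) Fd (r - t) * bin (t%:Z + t%:Z - p%:Z - r%:Z) t * Ed (p - t).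
Proof.
elim: p => [|p IHp] pr.
  by rewrite big_ord1 bin0 mulr1 subn0 /Ed /qfact big_geq // invr1 s1 expr0 mulr1 mul1r.
pose c t := t%:Z + t%:Z - p.+1%:Z - r%:Z.
pose a t := Fd (r - t) * (qint v (p.+1 - t) <*> bin (c t - 1) t) * Ed (p.+1 - t).
pose b t := Fd (r - t.+1) * (L (t.+1%:Z - r%:Z) * bin (c t + 1) t) * Ed (p - t).
have step t : (t <= p)%N ->
    E * (Fd (r - t) * bin (t%:Z + t%:Z - p%:Z - r%:Z) t * Ed (p - t)) = a t + b t.
  move=> tp; rewrite [LHS]mulrA [E * (_ * _)](mulrA E) EFdn; last by lia.
  have -> : t%:Z + t%:Z - p%:Z - r%:Z = c t + 1 by rewrite /c; lia.
  rewrite mulrDl mulrDl /a /b; congr (_ + _).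
    rewrite -[Fd (r - t) * E * _]mulrA E_bin (_ : c t + 1 - 2 = c t - 1); last by lia.
    rewrite [Fd (r - t) * (_ * _)]mulrA -[LHS]mulrA Edn //.
    by rewrite sAr -sAl sAr.
  by rewrite -[Fd (r - t.+1) * _ * _]mulrA.
rewrite EdS sAl -mulrA IHp; last by lia.
rewrite mulr_sumr (eq_bigr (fun t : 'I_p.+1 => a t + b t)) => [|t _]; last first.
  by apply: step; rewrite -ltnS.
(* The added term [a p.+1] carries the coefficient [[0]]; after this shift [a t.+1] and [b t]
   involve the same powers of [F] and [E]. *)
have shift : \sum_(t < p.+1) a t = a 0 + \sum_(t < p.+1) a t.+1.
  transitivity (\sum_(t < p.+2) a t); last by rewrite big_ord_recl.
  by rewrite [RHS]big_ord_recr /= [a p.+1]/a subnn qint0 s0 mulr0 mul0r addr0.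
rewrite big_split /= shift -addrA -big_split /=.
apply: etrans (_ : (qint v p.+1)^-1 <*> (qint v p.+1 <*> _) = _); last first.
  by rewrite sA mulVf // s1.
congr (_ <*> _); rewrite [in RHS]big_ord_recl sDr; congr (_ + _).
  by rewrite /a !subn0 !bin0 sAr sAl.
rewrite -!scE mulr_sumr; apply: eq_bigr => t _; have tp : (t <= p)%N by rewrite -ltnS.
rewrite /a /b !subSS -mulrDl -mulrDr scE -sAl -sAr; congr (_ * _ * _).
have := bin_key (p - t) t (t.+1%:Z - r%:Z); rewrite (_ : (p - t + t.+1 = p.+1)%N); last by lia.
have -> : t.+1%:Z - r%:Z - (p - t).+1%:Z = c t + 1 by rewrite /c; lia.
have -> : t.+1%:Z - r%:Z - (p - t)%:Z = c t.+1 by rewrite /c; lia.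
by have -> : c t.+1 - 1 = c t + 1 by rewrite /c; lia.
Qed.

(** Lowers [c] by one at the cost of a product with one factor fewer; integrality at [c = 0] thus
    spreads to all negative [c]. *)
Let bin_Pascal c t : bin c t.+1 =
  v ^- t.+1 <*> bin (c + 1) t.+1 - (v ^ (- (c + 1))) <*> (Ki * bin c t).
Proof.
have KiL c' : Ki * L c' = L c' * Ki.
  by rewrite /L mulrDl mulrDr !sAl !sAr KKi KiK.
have Kib : Ki * bin c t = bin c t * Ki.
  elim: t => [|t IHt]; first by rewrite bin0 mulr1 mul1r.
  by rewrite binS sAr sAl mulrA IHt -mulrA KiL mulrA.
rewrite binS binSl L_bin Kib !sA -!sAr -mulrBr; congr (_ * _).
have vn n : v ^+ n != 0 by rewrite expf_neq0.
rewrite (_ : c - t%:Z = c + 1 - t.+1%:Z); last by lia.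
move: (c + 1) => s; rewrite /L !sDr !sA !vzB !vzBN -addrA -sNl -sDl.
congr (_ <*> _ + _ <*> _); first by ring.
have z0 := vq t; have E1 : v ^- t.+1 = v ^+ t.+1 - qint v t.+1 * (v - v^-1).
  by rewrite -qint_def // opprB addrC subrK.
rewrite E1 /d; move: (qint v t.+1) z0 (v - v^-1) vv1 => z z0 e e0.
by field; rewrite ?z0 ?e0.
Qed.

Variable P : A -> Prop.
Hypotheses (Pv : P v%:S) (Pvi : P (v^-1)%:S) (PKi : P Ki) (P1 : P 1)
  (PE : forall r, P ((qfact v r)^-1%:S * E ^+ r)) (PF : forall r, P ((qfact v r)^-1%:S * Fm ^+ r))
  (PB : forall x y, P x -> P y -> P (x - y)) (PM : forall x y, P x -> P y -> P (x * y)).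

Let PvV n : P (v ^- n)%:S.
Proof.
elim: n => [|n IHn]; first by rewrite expr0 invr1 rmorph1.
by rewrite exprSr invfM rmorphM; apply: PM.
Qed.

Let PvX n : P (v ^+ n)%:S.
Proof.
elim: n => [|n IHn]; first by rewrite expr0 rmorph1.
by rewrite exprS rmorphM; apply: PM.
Qed.

(** The last summand of [E^(t) F^(t)] is [[K; 0, t]], and the others contain only [[K; -m, s]] with
    [s < t], so it can be solved for. The inner induction then lowers [c] by [bin_Pascal]; hence
    strong induction on [t], for all [n] at once. *)
Let Pbin t n : P (bin (- n%:Z) t).
Proof.
elim/ltn_ind: t n => t IHt; elim=> [|n IHn].
  have P0 : P 0 by rewrite -(subrr 1); apply: PB.
  have := Ediv_Fdiv (leqnn t); rewrite big_ord_recr /= subnn.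
  have -> : t%:Z + t%:Z - t%:Z - t%:Z = - 0%:Z by lia.
  rewrite Ed0 Fd0 mulr1 mul1r.
  rewrite [X in _ = X]addrC => /eqP; rewrite -subr_eq => /eqP <-; apply: PB; first by apply: PM; [exact: PE|exact: PF].
  elim/big_ind: _ => // [x y Px Py|s _].
    by rewrite -[y]opprK; apply: PB => //; rewrite -[- y]add0r; apply: PB.
  apply: PM; last exact: PE.
  apply: PM; first exact: PF.
  have -> : s%:Z + s%:Z - t%:Z - t%:Z = - (t + t - s - s)%N%:Z by have := ltn_ord s; lia.
  exact: IHt.
case: t IHt IHn => [|t] IHt IHn; first by rewrite bin0.
rewrite bin_Pascal (_ : - n.+1%:Z + 1 = - n%:Z) ?opprK; last by lia.
rewrite -!scE -exprnP; apply: PB; first exact: PM (PvV _) IHn.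
by apply: PM (PvX _) _; apply: PM PKi _; apply: IHt.
Qed.

Lemma Kbin_in t :
  P (\prod_(0 <= s < t) (((v ^+ s.+1 - v ^- s.+1)^-1)%:S * ((v ^- s)%:S * K - (v ^+ s)%:S * Ki))).
Proof.
suff -> : \prod_(0 <= s < t) (((v ^+ s.+1 - v ^- s.+1)^-1)%:S * ((v ^- s)%:S * K - (v ^+ s)%:S * Ki))
   = bin (- 0%:Z) t by apply: Pbin.
apply: eq_bigr => s _; rewrite !scE oppr0 sub0r /L opprK !sDr sNr !sA -sNl.
rewrite -exprnN -exprnP.
have -> : (v ^+ s.+1 - v ^- s.+1)^-1 = (qint v s.+1)^-1 * d.
  by rewrite qint_def // invfM.
by congr (_ <*> _ + _ <*> _); ring.
Qed.
End LusztigCommutation.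

(** * Tilting modules *)

Lemma vKbin_in_UA t : in_UA (vKbin vv t).
Proof.
exact: (@Kbin_in Qv vv vv_neq0 vv1_neq0 qint_vv_neq0 (Uv vv) (vE vv) (vF vv) (vK vv) (vKi vv)
  (vKKi vv) (vKiK vv) (vKE_conj vv) (vKF_conj vv) (vEF_bracket vv) (@in_UA Qv vv)
  (UA_v vv) (UA_vi vv) (UA_Ki vv) (UA_1 vv) (@UA_E Qv vv) (@UA_F Qv vv)
  (@UA_sub Qv vv) (@UA_mul Qv vv)).
Qed.

Section Weights.
Variables (F : fieldType) (q : F).
Hypothesis q0 : q != 0.
Implicit Types M N : Uqmod q.

Lemma weight_vector_hom M N (f : 'M[F]_(mdim N, mdim M)) m (w : 'cV_(mdim M)) :
  is_hom f -> weight_vector m w -> weight_vector (M := N) m (f *m w).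
Proof.
move=> hf [wK wb]; split=> [|t x xt].
  by rewrite mulmxA -hf -mulmxA wK -scalemxAr.
by rewrite mulmxA -hf -mulmxA (wb t x xt) -scalemxAr.
Qed.

Lemma highest_weight_iso M N m : iso M N -> highest_weight M m -> highest_weight N m.
Proof.
move=> [f [g [hf fg gf]]] [[w wm w0] wmax]; split.
  exists (f *m w); first exact: weight_vector_hom wm.
  by apply: contraNneq w0 => fw0; rewrite -[w]mul1mx -gf -mulmxA fw0 mulmx0.
have hg : is_hom g by move=> x; rewrite -[LHS]mulmx1 -fg mulmxA -[_ *m f]mulmxA -hf mulmxA gf mul1mx.
move=> m' w' w'm' w'0; apply: (wmax m' (g *m w')); first exact: weight_vector_hom w'm'.
by apply: contraNneq w'0 => gw0; rewrite -[w']mul1mx -fg -mulmxA gw0 mulmx0.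
Qed.

Lemma highest_weight_inj M m m' : highest_weight M m -> highest_weight M m' -> m = m'.
Proof.
move=> [[w wm w0] wmax] [[w' wm' w'0] wmax']; apply/eqP.
by rewrite Order.POrderTheory.eq_le (wmax' m w wm w0) (wmax m' w' wm' w'0).
Qed.

Definition sum_of_weights M (w : 'cV[F]_(mdim M)) : Prop :=
  exists (c : nat) (m : 'I_c -> int) (u : 'I_c -> 'cV[F]_(mdim M)),
    (forall i, weight_vector (m i) (u i)) /\ w = \sum_i u i.

Lemma sum_of_weights0 M : @sum_of_weights M 0.
Proof. by exists 0%N, (fun=> 0), (fun=> 0); split=> [[]|]; rewrite ?big_ord0. Qed.

Lemma sum_of_weights1 M m (w : 'cV_(mdim M)) : weight_vector m w -> sum_of_weights w.
Proof. by move=> wm; exists 1%N, (fun=> m), (fun=> w); rewrite big_ord1. Qed.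

Lemma sum_of_weightsD M (w w' : 'cV_(mdim M)) :
  sum_of_weights w -> sum_of_weights w' -> sum_of_weights (w + w').
Proof.
move=> [c [m [u [mu ->]]]] [c' [m' [u' [mu' ->]]]].
exists (c + c')%N, (fun i => match split i with inl j => m j | inr j => m' j end),
  (fun i => match split i with inl j => u j | inr j => u' j end); split=> [i|].
  by case: (split i).
rewrite big_split_ord /=; congr (_ + _); apply: eq_bigr => i _.
  by rewrite -[lshift c' i]/(unsplit (inl i)) unsplitK.
by rewrite -[rshift c i]/(unsplit (inr i)) unsplitK.
Qed.

Lemma sum_of_weights_hom M N (f : 'M[F]_(mdim N, mdim M)) (w : 'cV_(mdim M)) :
  is_hom f -> sum_of_weights w -> sum_of_weights (M := N) (f *m w).
Proof.
move=> hf [c [m [u [mu ->]]]]; exists c, m, (fun i => f *m u i); rewrite mulmx_sumr.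
by split=> // i; apply: weight_vector_hom.
Qed.

Lemma is_hom_in1 M N : @is_hom F q M (dsum M N) (in1 (gm M) (gm N)).
Proof. by apply/(is_homP q0) => u; apply: (ghom_in1 (gm M) (gm N) u). Qed.
Lemma is_hom_in2 M N : @is_hom F q N (dsum M N) (in2 (gm M) (gm N)).
Proof. by apply/(is_homP q0) => u; apply: (ghom_in2 (gm M) (gm N) u). Qed.
Lemma is_hom_pr1 M N : @is_hom F q (dsum M N) M (pr1 (gm M) (gm N)).
Proof. by apply/(is_homP q0) => u; apply: (ghom_pr1 (gm M) (gm N) u). Qed.

Lemma type1_dsum M N : type1 M -> type1 N -> type1 (dsum M N).
Proof.
move=> tM tN w; rewrite -[w]mul1mx -(in_pr (gm M) (gm N)) mulmxDl -!mulmxA.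
apply: sum_of_weightsD.
  by apply: (@sum_of_weights_hom M (dsum M N)); [exact: is_hom_in1 | apply: tM].
by apply: (@sum_of_weights_hom N (dsum M N)); [exact: is_hom_in2 | apply: tN].
Qed.

Lemma short_exact_dsum M N : short_exact N (dsum M N) M.
Proof.
exists (in2 (gm M) (gm N)), (pr1 (gm M) (gm N)); split.
- exact: is_hom_in2.
- exact: is_hom_pr1.
- move=> w w0; have := congr1 (mulmx (pr2 (gm M) (gm N))) w0.
  by rewrite (mulmxA (pr2 (gm M) (gm N))) (pr2_in2 (gm M) (gm N)) mul1mx mulmx0.
- move=> w; exists (in1 (gm M) (gm N) *m w).
  by rewrite (mulmxA (pr1 (gm M) (gm N))) (pr1_in1 (gm M) (gm N)) mul1mx.
move=> w; split=> [w0|[u ->]]; last first.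
  by rewrite (mulmxA (pr1 (gm M) (gm N))) (pr1_in2 (gm M) (gm N)) mul0mx.
exists (pr2 (gm M) (gm N) *m w).
rewrite -[LHS](mul1mx w) -(in_pr (gm M) (gm N)) mulmxDl.
by rewrite -(mulmxA (in1 (gm M) (gm N))) w0 mulmx0 add0r -mulmxA.
Qed.

Lemma short_exact_zero M : short_exact (zero_mod q) M M.
Proof.
exists 0, 1%:M; split.
- by move=> x; rewrite mul0mx mulmx0.
- by move=> x; rewrite mul1mx mulmx1.
- by move=> w _; rewrite [w]flatmx0.
- by move=> w; exists w; rewrite mul1mx.
move=> w; rewrite mul1mx; split=> [->|[u ->]]; last by rewrite mul0mx.
by exists 0; rewrite mul0mx.
Qed.

Lemma tilting_dsum_Weyl k M N : type1 M -> is_Weyl k M -> is_dualWeyl k M ->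
  tilting N -> tilting (dsum M N).
Proof.
move=> tM Wk dWk [tN fN fdN]; split; first exact: type1_dsum.
  exact: filtration_S fN (short_exact_dsum M N) Wk.
exact: filtration_S fdN (short_exact_dsum M N) dWk.
Qed.

Lemma tilting_zero : tilting (zero_mod q).
Proof.
split; try exact: filtration_0.
by move=> w; rewrite [w]flatmx0; apply: sum_of_weights0.
Qed.
End Weights.

Lemma qbin_qfact (F : fieldType) (v : F) n t : v != 0 -> v - v^-1 != 0 -> (t <= n)%N ->
  qbin v n t * (qfact v t * qfact v (n - t)) = qfact v n.
Proof.
move=> v0 vv1; elim: t n => [|t IHt] [|n] // tn; rewrite ?qbin0 ?subn0.
- by rewrite mul1r /qfact big_geq // mul1r.
- by rewrite mul1r {1}/qfact big_geq // mul1r.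
rewrite qfactS subSS [qfact v n.+1]qfactS -(IHt n) //.
transitivity (qint v t.+1 * qbin v n.+1 t.+1 * (qfact v t * qfact v (n - t))); first by ring.
by rewrite qbin_absorb //; ring.
Qed.

Lemma mx1_eq0 (F : fieldType) n : 1%:M = 0 :> 'M[F]_n -> n = 0%N.
Proof. by move/(congr1 (fun A => \rank A)); rewrite mxrank1 mxrank0. Qed.

(** * The Weyl modules below [l] as indecomposable tilting modules *)

Section SmallWeylModules.
Variables (F : fieldType) (q : F) (l : nat).
Hypotheses (q0 : q != 0) (hl : (3 <= l)%N) (hql : l.-primitive_root (q ^+ 2)).
Let qq1 := q_subV_neq0 q0 hl hql.
Let Wm k := Wmod q0 k.

Lemma qfact_neq0_small n : (n < l)%N -> qfact q n != 0.
Proof.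
elim: n => [|n IHn] nl; first by rewrite /qfact big_geq ?oner_eq0.
by rewrite qfactS mulf_neq0 ?(qint_neq0 q0 hl hql) ?nl // IHn // ltnW.
Qed.

(** Both sides are the quantum trinomial coefficient; the factorials cancel because [k < l]. *)
Lemma qbin_trinomial k i r : (i + r <= k)%N -> (k < l)%N ->
  qbin q k i * qbin q (k - i) r = qbin q (i + r) r * qbin q k (i + r).
Proof.
move=> irk kl; have f0 n : (n <= k)%N -> qfact q n != 0.
  by move=> nk; apply: qfact_neq0_small; apply: leq_ltn_trans nk kl.
have E1 := @qbin_qfact F q k i q0 qq1 ltac:(lia).
have E2 := @qbin_qfact F q (k - i) r q0 qq1 ltac:(lia).
have E3 := @qbin_qfact F q (i + r) r q0 qq1 ltac:(lia).
have E4 := @qbin_qfact F q k (i + r) q0 qq1 irk.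
rewrite addnK in E3; rewrite -subnDA in E2.
have nz : qfact q i * qfact q r * qfact q (k - (i + r)) != 0.
  by rewrite !mulf_neq0 ?f0 //; lia.
apply: (mulIf nz).
transitivity (qfact q k); first by rewrite -E1 -E2; ring.
by rewrite -E4 -E3; ring.
Qed.

Lemma Wmod_K k : mact (Wm k) (LusK vv) = WeylK q k.
Proof. by have [_ E _] := WactP q0 k; apply: (E UK). Qed.

Lemma weight_vector_Wmod k a (w : 'cV[F]_k.+1) :
  (forall b, (b < k.+1)%N -> b != a -> crd w b = 0) ->
  weight_vector (M := Wm k) (k%:Z - a.*2%:Z) w.
Proof.
move=> wa; split=> [|t x xt].
  rewrite Wmod_K WeylK_opmx; apply: crdP => b bk; rewrite crd_opmx // crdZ.
  by have [->|/(wa b bk) ->] := eqVneq b a; rewrite ?mulr0 // Weyl_weight.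
rewrite (Wmod_bin q0 k xt); apply: crdP => b bk; rewrite crd_opmx // crdZ.
by have [->|/(wa b bk) ->] := eqVneq b a; rewrite ?mulr0.
Qed.

Lemma type1_Wmod k : type1 (Wm k).
Proof.
move=> w; rewrite [w]matrix_sum_delta; apply: (big_ind (@sum_of_weights F q (Wm k))).
- exact: sum_of_weights0.
- by move=> x y; apply: sum_of_weightsD.
move=> i _; rewrite big_ord1; apply: (@sum_of_weights1 F q (Wm k) (k%:Z - i.*2%:Z)).
apply: weight_vector_Wmod => b bk bi; rewrite -[b]/(val (Ordinal bk)) crd_ord !mxE.
by rewrite -(inj_eq val_inj) /= (negPf bi) mulr0.
Qed.

(** A nonzero coordinate [a] of a vector of weight [p >= 0] forces [[k - 2a, t] = [p, t]] for all
    [t]. If [k - 2a >= 0], then [t = p] gives [p <= k]. If it is negative, [t = l (p + 1)] is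
    contradictory: it exceeds [p], so the right side is 0, while the left side is nonzero by
    [qbin_periodic_neq0]. *)
Lemma highest_weight_Wmod k : (k < l)%N -> highest_weight (Wm k) k%:Z.
Proof.
move=> kl; split.
  exists (delta_mx ord0 ord0 : 'cV[F]_k.+1).
    rewrite -[k%:Z]subr0; apply: (@weight_vector_Wmod k 0) => b _ b0.
    by rewrite crd_delta0 (negPf b0).
  apply/eqP=> /(congr1 (fun w : 'cV[F]_k.+1 => crd w 0)).
  by rewrite crd_delta0 crd0; apply/eqP/oner_neq0.
move=> [p|p] w [_ wb] w0; last by [].
have [a ak wa] : exists2 a, (a < k.+1)%N & crd w a != 0.
  apply: contraNP w0 => H; apply/eqP; apply: crdP => a ak; rewrite crd0.
  by apply/eqP; apply: contraT => wa; case: H; exists a.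
have E t : qbinz q (k%:Z - a.*2%:Z) t = qbin q p t.
  apply: (mulIf wa); have := wb t (toUA (vKbin_in_UA t)) erefl.
  move/(congr1 (fun w : 'cV[F]_k.+1 => crd w a)).
  by rewrite (Wmod_bin q0 k (x := toUA (vKbin_in_UA t)) erefl) crd_opmx // crdZ.
have : (exists2 p', (p' <= k)%N & k%:Z - a.*2%:Z = Posz p') \/
    (exists2 p', (p' < l)%N & k%:Z - a.*2%:Z = Negz p').
  case D : (k%:Z - a.*2%:Z) => [p'|p']; [left|right]; exists p' => //; lia.
case=> [[p' p'k D]|[p' p'l D]].
  have := E p; rewrite D /= qbinn; have [pk|kp] := leqP p k; first by lia.
  by rewrite qbin_small ?(leq_ltn_trans p'k) // => /esym/eqP; rewrite oner_eq0.
have := E (l * p.+1)%N; rewrite D /= [qbin q p _]qbin_small; last first.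
  by apply: leq_trans (leq_pmull _ _) => //; lia.
by move/eqP; rewrite mulf_eq0 signr_eq0 /= (negPf (qbin_periodic_neq0 q0 hl hql _ p'l)).
Qed.

Lemma is_Weyl_Wmod k : is_Weyl k (Wm k).
Proof. exact/is_WeylP/giso_Wmod. Qed.

(** The contravariant form is diagonal with entries [[k, i]], nonzero for [k < l], and so identifies
    the module with its dual. *)
Lemma is_dualWeyl_Wmod k : (k < l)%N -> is_dualWeyl k (Wm k).
Proof.
move=> kl.
have KKi : (WeylK q k)^T *m (WeylKi q k)^T = 1%:M.
  by rewrite -trmx_mul (mulmx1C (WeylKKi q0 k)) trmx1.
apply: (proj2 (realizesP (Wm k) (fun r => (WeylF q k r)^T) (fun r => (WeylE q k r)^T) KKi)).
apply: giso_trans (giso_Wmod q0 k) _.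
pose B : 'M[F]_k.+1 := diag_mx (\row_i qbin q k i).
pose B' : 'M[F]_k.+1 := diag_mx (\row_i (qbin q k i)^-1).
have b0 (i : 'I_k.+1) : qbin q k i != 0.
  by apply: (qbin_neq0 q0 hl hql); rewrite kl andbT -ltnS.
exists B, B'; split; last 2 first.
- rewrite mulmx_diag -diag_const_mx; congr diag_mx; apply/rowP=> i; rewrite !mxE.
  by rewrite mulfV.
- rewrite mulmx_diag -diag_const_mx; congr diag_mx; apply/rowP=> i; rewrite !mxE.
  by rewrite mulVf.
move=> u; apply/matrixP=> i j; rewrite mul_diag_mx mul_mx_diag.
case: u => [r|r||]; rewrite !mxE.
- case: eqP => [E|]; rewrite ?mulr0 ?mul0r //.
  have : (j < k.+1)%N := ltn_ord j; rewrite E => jk; move: (nat_of_ord i) jk => m jk; rewrite (_ : k - (m + r) + r = k - m)%N; last by lia.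
  by rewrite qbin_trinomial //; lia.
- case: eqP => [E|]; rewrite ?mulr0 ?mul0r //.
  have : (i < k.+1)%N := ltn_ord i; rewrite E => ik; move: (nat_of_ord j) ik => m ik; rewrite (_ : k - (m + r) + r = k - m)%N; last by lia.
  by rewrite mulrC [RHS]mulrC qbin_trinomial //; lia.
- by rewrite [j == i]eq_sym; case: eqP => [->|]; rewrite ?mulr0 ?mul0r // mulrC.
by rewrite [j == i]eq_sym; case: eqP => [->|]; rewrite ?mulr0 ?mul0r // mulrC.
Qed.

(** By Schur's lemma the projection onto [A] is a scalar [c]: if [c = 0] then [A] is zero, otherwise
    [B] is. *)
Lemma indecomposable_Wmod k : (k < l)%N -> indecomposable (Wm k).
Proof.
move=> kl; split=> // A B [f [g [hf fg gf]]].
pose i1 := in1 (gm A) (gm B); pose p1 := pr1 (gm A) (gm B).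
pose i2 := in2 (gm A) (gm B); pose p2 := pr2 (gm A) (gm B).
have hf' : @ghom F (gm (Wm k)) (gm (dsum A B)) f by apply/is_homP.
have hg := ghom_inv hf' fg gf.
have he : @ghom F (gm (Wm k)) (gm (Wm k)) (g *m (i1 *m p1) *m f).
  apply: ghomM hf'; apply: ghomM hg _.
  exact: (@ghomM F (gm (dsum A B)) (gm A) (gm (dsum A B)) _ _ ((is_homP q0 _).1 (is_hom_in1 q0 A B))
    ((is_homP q0 _).1 (is_hom_pr1 q0 A B))).
have he' : @ghom F (W q k) (W q k) (g *m (i1 *m p1) *m f).
  by move=> u; have := he u; have [_ E _] := WactP q0 k; rewrite /= E.
have [eE _] := Schur_Weyl q0 hl hql kl kl he'.
move: eE; set c := _ ord0 ord0; rewrite idmx1 => eE.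
have i1p1 : i1 *m p1 = c%:M.
  rewrite -[LHS]mul1mx -[1%:M]fg -[LHS]mulmx1 -[1%:M in LHS]fg.
  transitivity (f *m (g *m (i1 *m p1) *m f) *m g); first by rewrite !mulmxA.
  by rewrite eE -scalemxAr mulmx1 -scalemxAl fg scalemx1.
have [c0|c0] := eqVneq c 0.
  left; apply: (@mx1_eq0 F).
  have <- : p1 *m (i1 *m p1) *m i1 = 1%:M.
    by rewrite (mulmxA p1) (pr1_in1 (gm A) (gm B)) mul1mx (pr1_in1 (gm A) (gm B)).
  by rewrite i1p1 c0 -scalemx1 scale0r mulmx0 mul0mx.
right; apply: (@mx1_eq0 F); have E : p2 *m (i1 *m p1) *m i2 = 0.
  by rewrite (mulmxA p2) (pr2_in1 (gm A) (gm B)) mul0mx mul0mx.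
rewrite i1p1 mul_mx_scalar -scalemxAl (pr2_in2 (gm A) (gm B)) in E.
by apply/eqP; move/eqP: E; rewrite scaler_eq0 (negPf c0).
Qed.

Lemma tilting_Wmod k : (k < l)%N -> tilting (Wm k).
Proof.
move=> kl; split; first exact: type1_Wmod.
  exact: filtration_S (filtration_0 _ (erefl : mdim (zero_mod q) = 0%N)) (short_exact_zero _) (is_Weyl_Wmod k).
exact: filtration_S (filtration_0 _ (erefl : mdim (zero_mod q) = 0%N)) (short_exact_zero _) (is_dualWeyl_Wmod kl).
Qed.

Lemma is_T_Wmod k : (k < l)%N -> is_T k (Wm k).
Proof.
move=> kl; split; [exact: tilting_Wmod|exact: indecomposable_Wmod|exact: highest_weight_Wmod].
Qed.

Definition WSmod (L : seq nat) : Uqmod q := foldr (fun k M => dsum (Wm k) M) (zero_mod q) L.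

Lemma giso_WSmod L : giso (gm (WSmod L)) (WS q L).
Proof.
elim: L => [|k L IHL] /=; first exact: gm_zero.
exact: giso_trans (giso_dsum _ _) (giso_gdsum (giso_Wmod q0 k) IHL).
Qed.

Lemma tilting_WSmod L : all (ltn^~ l) L -> tilting (WSmod L).
Proof.
elim: L => [|k L IHL] /=; first by move=> _; apply: tilting_zero.
case/andP=> kl Ll; apply: tilting_dsum_Weyl (IHL Ll) => //.
- exact: type1_Wmod.
- exact: is_Weyl_Wmod.
exact: is_dualWeyl_Wmod.
Qed.

(** Some [W k] is a retract of [M]; by indecomposability its idempotent [u r] is 1, so [M] is [W k],
    and comparing highest weights gives [k = n]. *)
Lemma summand_is_T n (M : Uqmod q) L (a : 'M_(gdim (WS q L), mdim M)) (b : 'M_(mdim M, gdim (WS q L))) :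
  all (ltn^~ l) L -> @ghom F (gm M) (WS q L) a -> @ghom F (WS q L) (gm M) b -> b *m a = 1%:M ->
  is_T n M -> giso (gm M) (W q n) /\ (n < l)%N.
Proof.
move=> Ll ha hb ba [_ indM hM].
have [M0 _] := indM.
have [k [u [r [kL hu hr ru]]]] := retract_WS q0 hl hql Ll ha hb ba M0.
have hur : @ghom F (gm M) (gm M) (u *m r) := ghomM hu hr.
have kl : (k < l)%N := allP Ll k kL.
have [|ur0|ur1] := indecomposable_idempotent q0 indM ((is_homP q0 _).2 hur).
- by rewrite mulmxA -[_ *m r *m u]mulmxA ru mulmx1.
- have : r *m (u *m r) *m u = 1%:M by rewrite mulmxA ru mul1mx ru.
  rewrite ur0 mulmx0 mul0mx => /matrixP/(_ ord0 ord0); rewrite !mxE /= => /esym/eqP.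
  by rewrite oner_eq0.
have Mk : giso (gm M) (W q k) by exists r, u.
have isoM : iso M (Wm k).
  exact: (isoP q0 M (Wm k)).2 (giso_trans Mk (giso_sym (giso_Wmod q0 k))).
have [nk] := highest_weight_inj (highest_weight_iso isoM hM) (highest_weight_Wmod kl).
by rewrite nk.
Qed.
End SmallWeylModules.

(** * Reduced tensor powers *)

Section Retracts.
Variable F : fieldType.
Implicit Types A B C : gmod F.

Definition gretract A B : Prop :=
  exists (a : 'M_(gdim B, gdim A)) (b : 'M_(gdim A, gdim B)),
    [/\ @ghom F A B a, @ghom F B A b & b *m a = 1%:M].

Lemma gretract_trans A B C : gretract A B -> gretract B C -> gretract A C.
Proof.
move=> [a [b [ha hb ba]]] [a' [b' [ha' hb' ba']]]; exists (a' *m a), (b *m b'); split.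
- exact: ghomM ha.
- exact: ghomM hb'.
by rewrite mulmxA -[_ *m b' *m a']mulmxA ba' mulmx1.
Qed.

Lemma giso_retract A B : giso A B -> gretract A B.
Proof.
by move=> [f [g [hf fg gf]]]; exists f, g; split=> //; apply: ghom_inv fg gf.
Qed.

Lemma gretract_gdsuml A B : gretract A (gdsum A B).
Proof. by exists (in1 A B), (pr1 A B); split; [apply: ghom_in1|apply: ghom_pr1|apply: pr1_in1]. Qed.

Lemma gretract_gdsumr A B : gretract B (gdsum A B).
Proof. by exists (in2 A B), (pr2 A B); split; [apply: ghom_in2|apply: ghom_pr2|apply: pr2_in2]. Qed.
End Retracts.

Section BigSums.
Variables (F : fieldType) (q : F).
Hypothesis q0 : q != 0.

(** The guard [0 < c] is there because a [T n] of multiplicity 0 is not a retract of the sum and so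
    is not identified. *)
Lemma giso_dsum_iter (M : Uqmod q) n c : (0 < c -> giso (gm M) (W q n))%N ->
  giso (gm (dsum_iter c M)) (WS q (nseq c n)).
Proof.
elim: c => [|c IHc] MW; first exact: gm_zero.
rewrite /=; apply: giso_trans (giso_dsum _ _) (giso_gdsum (MW _) _) => //.
by apply: IHc => _; apply: MW.
Qed.

Lemma giso_big_dsum (I : Type) (r : seq I) (P : pred I) (M : I -> Uqmod q) (L : I -> seq nat) :
  (forall i, P i -> giso (gm (M i)) (WS q (L i))) ->
  giso (gm (\big[@dsum F q/zero_mod q]_(i <- r | P i) M i)) (WS q (flatten [seq L i | i <- r & P i])).
Proof.
move=> ML; elim: r => [|i r IHr]; first by rewrite big_nil; apply: gm_zero.
rewrite big_cons /=; case: ifP => Pi //=.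
apply: giso_trans (giso_dsum _ _) _; apply: giso_trans (giso_sym (giso_WS_cat _ _ _)).
exact: giso_gdsum (ML i Pi) IHr.
Qed.

Lemma gretract_big_dsum (I : eqType) (r : seq I) (M : I -> Uqmod q) i : i \in r ->
  gretract (gm (M i)) (gm (\big[@dsum F q/zero_mod q]_(i <- r) M i)).
Proof.
elim: r => // j r IHr; rewrite inE big_cons => /predU1P[->|ir].
  exact: gretract_trans (gretract_gdsuml _ _) (giso_retract (giso_sym (giso_dsum _ _))).
apply: gretract_trans (IHr ir) _.
exact: gretract_trans (gretract_gdsumr _ _) (giso_retract (giso_sym (giso_dsum _ _))).
Qed.

Lemma gretract_dsum_iter (M : Uqmod q) c : (0 < c)%N -> gretract (gm M) (gm (dsum_iter c M)).
Proof.
case: c => // c _.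
exact: gretract_trans (gretract_gdsuml _ _) (giso_retract (giso_sym (giso_dsum _ _))).
Qed.
End BigSums.

Lemma filter_flatten_nseq (I : Type) (r : seq I) (m x : I -> nat) (Q : pred nat) :
  filter Q (flatten [seq nseq (m i) (x i) | i <- r]) =
  flatten [seq nseq (m i) (x i) | i <- r & Q (x i)].
Proof.
elim: r => //= i r IHr; rewrite filter_cat IHr filter_nseq.
by case: (Q (x i)); rewrite ?mul1n.
Qed.

Lemma perm_flatten_count c (L : seq nat) : all (ltn^~ c) L ->
  perm_eq (flatten [seq nseq (count_mem (i : nat) L) (i : nat) | i : 'I_c <- index_enum 'I_c]) L.
Proof.
move=> Lc; apply/permP=> a; rewrite count_flatten sumnE !big_map.
rewrite (eq_bigr (fun i : 'I_c => a i * count_mem (i : nat) L)%N) => [|i _]; last by rewrite count_nseq.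
elim: L Lc => [_|x L IHL /= /andP[xc Lc]]; first by rewrite big1 // => i _; rewrite muln0.
rewrite -(IHL Lc) -[x in a x]/(val (Ordinal xc)).
rewrite (eq_bigr (fun i : 'I_c => (a i * (x == i)) + a i * count_mem (i : nat) L)%N) => [|i _]; last by rewrite mulnDr.
rewrite big_split /=; congr (_ + _)%N.
rewrite (bigD1 (Ordinal xc)) //= eqxx muln1 big1 ?addn0 // => i ix.
case: eqP => [xi|_]; last by rewrite muln0.
by case/eqP: ix; apply: val_inj.
Qed.

Section PathEnds.
Variable l : nat.
Hypothesis hl : (3 <= l)%N.
Let small k := (k.+1 < l)%N.

Lemma adjacent_lt L : all small L -> all (ltn^~ l) (flatten (map adjacent L)).
Proof.
move=> Ls; apply/allP=> a /flattenP[s /mapP[k kL ->]]; have := allP Ls k kL; rewrite /small.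
case: k {kL} => [|k]; rewrite !inE /= => kl; first by move/eqP->; lia.
by case/orP=> /eqP->; lia.
Qed.

Definition path_ends n := map (head 0%N) (paths l n).

(** Extending paths by a step does to end points what the reduced product with [W 1] does to labels,
    compare [reduced_tensor_WS]. *)
Lemma path_endsS n : path_ends n.+1 = filter small (flatten (map adjacent (path_ends n))).
Proof.
rewrite /path_ends /= map_flatten filter_flatten; congr flatten; rewrite -!map_comp.
by apply: eq_map => s /=; rewrite -map_comp map_id_in.
Qed.

Lemma path_ends_small n : all small (path_ends n).
Proof. by case: n => [|n]; rewrite ?path_endsS ?filter_all // /path_ends /= /small; lia. Qed.

Lemma path_ends1 : path_ends 1 = [:: 1%N].
Proof. by rewrite path_endsS /path_ends /= /small (_ : (2 < l)%N). Qed.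

End PathEnds.

Section ReducedPowers.
Variables (F : fieldType) (q : F) (l : nat).
Hypotheses (q0 : q != 0) (hl : (3 <= l)%N) (hql : l.-primitive_root (q ^+ 2)).
Implicit Types M D P : Uqmod q.

Let small k := (k.+1 < l)%N.

(** The tensor product has two descriptions: the given decomposition, and the sum of the [W a] for
    [a] adjacent to members of [L]. Each [T n] occurring in the first is a retract of the second,
    hence is [W n]; and isomorphic sums of [W k] with [k < l] stay isomorphic after truncation. *)
Lemma reduced_tensor_WS M D P L : all small L -> giso (gm M) (WS q L) ->
  giso (gm D) (W q 1) -> is_reduced_tensor l M D P ->
  giso (gm P) (WS q (filter small (flatten (map adjacent L)))).
Proof.
move=> Ls ML D1 [_ _ [c [T [m [Tn Tt TP]]]]].
set S := \big[_/_]_(n < c) _ in Tt.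
have SL : giso (gm S) (WS q (flatten (map adjacent L))).
  apply: giso_trans ((is_tensorP _ _ _).1 Tt) _.
  exact: (giso_tens_WS q0 hl hql Ls ML D1).
have Ll := adjacent_lt hl Ls.
have TW (i : 'I_c) : (0 < m i)%N -> giso (gm (T i)) (W q i) /\ (i < l)%N.
  move=> mi; have [a [b [ha hb ba]]] : gretract (gm (T i)) (WS q (flatten (map adjacent L))).
    apply: gretract_trans (giso_retract SL); apply: gretract_trans (gretract_dsum_iter (T i) mi) _.
    by apply: (gretract_big_dsum (fun i : 'I_c => dsum_iter (m i) (T i))); rewrite mem_index_enum.
  exact: (summand_is_T q0 hl hql Ll ha hb ba (Tn i (ltn_ord i))).
have iterW (i : 'I_c) : giso (gm (dsum_iter (m i) (T i))) (WS q (nseq (m i) (i : nat))).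
  by apply: giso_dsum_iter => mi; have [] := TW i mi.
pose L' := flatten [seq nseq (m i) (i : nat) | i : 'I_c <- index_enum 'I_c].
have SL' : giso (gm S) (WS q L').
  by have := giso_big_dsum (index_enum 'I_c) (P := xpredT) (fun i _ => iterW i); rewrite filter_predT.
have L'l : all (ltn^~ l) L'.
  apply/allP=> j /flattenP[s /mapP[i _ ->]]; rewrite mem_nseq => /andP[mi /eqP->].
  by have [] := TW i mi.
have PL' : giso (gm P) (WS q (filter small L')).
  rewrite /L' filter_flatten_nseq; apply: giso_trans ((isoP q0 _ _).1 TP) _.
  have := giso_big_dsum (index_enum 'I_c) (P := fun i : 'I_c => (i <= l - 2)%N) (fun i _ => iterW i).
  rewrite (eq_filter (a2 := fun i : 'I_c => small i)) // => i; rewrite /small; lia.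
apply: giso_trans PL' _; apply: (giso_WS_truncate q0 hl hql) => //.
exact: giso_trans (giso_sym SL') SL.
Qed.

Lemma reduced_power_WS n P : is_reduced_power l n P -> giso (gm P) (WS q (path_ends l n)).
Proof.
elim=> [P1 WP|n' P1 D P' _ IH WD redP].
  rewrite (path_ends1 hl) /=; apply: giso_trans ((is_WeylP q0 _ _).1 WP) _.
  exact: giso_trans (giso_sym (giso_gzerol _)) (giso_gdsumC _ _).
rewrite path_endsS; apply: reduced_tensor_WS redP => //; first exact: path_ends_small.
exact: (is_WeylP q0 _ _).1 WD.
Qed.

Lemma reduced_power_exists n : (0 < n)%N -> exists P, is_reduced_power l n P.
Proof.
case: n => // n _; exists (WSmod q0 (path_ends l n.+1)).
elim: n => [|n IHn].
  apply: reduced_power_1; apply: (is_WeylP q0 _ _).2; rewrite (path_ends1 hl).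
  apply: giso_trans (giso_WSmod q0 _) _.
  exact: giso_trans (giso_gdsumC _ _) (giso_gzerol _).
have l1 : (1 < l)%N by exact: ltnW.
have W1 := is_Weyl_Wmod q0 1.
apply: (reduced_power_S IHn W1); split.
- apply: (tilting_WSmod q0 hl hql); apply/allP=> k kn.
  by apply: ltnW; apply: (allP (path_ends_small hl n.+1)).
- exact: (tilting_Wmod q0 hl hql).
set L := path_ends l n.+1; pose L' := flatten (map adjacent L).
have Ls : all small L := path_ends_small hl n.+1.
have L'l : all (ltn^~ l) L' := adjacent_lt hl Ls.
have iterW (i : 'I_l) :
    giso (gm (dsum_iter (count_mem (i : nat) L') (Wmod q0 i))) (WS q (nseq (count_mem (i : nat) L') (i : nat))).
  by apply: giso_dsum_iter => _; apply: giso_Wmod.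
(* All labels lie below [l], where the Weyl modules themselves are the indecomposable tilting
   modules. *)
exists l, (Wmod q0), (fun i => count_mem i L'); split.
- by move=> i il; apply: (is_T_Wmod q0 hl hql).
- apply/is_tensorP; apply: giso_sym.
  apply: giso_trans (giso_tens_WS q0 hl hql Ls (giso_WSmod q0 L) (giso_Wmod q0 1)) _.
  apply: giso_trans (giso_WS_perm _ _) _; first by rewrite perm_sym; apply: perm_flatten_count L'l.
  have := giso_big_dsum (index_enum 'I_l) (P := xpredT) (fun i _ => iterW i).
  by rewrite filter_predT => /giso_sym.
apply: (isoP q0 _ _).2; apply: giso_trans (giso_WSmod q0 _) _.
rewrite path_endsS -/L -/L'; apply: giso_sym.
have := giso_big_dsum (index_enum 'I_l) (P := fun i : 'I_l => (i <= l - 2)%N) (fun i _ => iterW i).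
move=> H; apply: giso_trans H _.
rewrite (eq_filter (a2 := fun i : 'I_l => small i)); last by move=> i; rewrite /small; lia.
rewrite -filter_flatten_nseq; apply: giso_WS_perm; apply: perm_filter.
exact: perm_flatten_count.
Qed.
End ReducedPowers.

Lemma alg_isomorphic_same_image (k : pzRingType) (A B C : pzAlgType k)
    (f : {rmorphism A -> C}) (g : {rmorphism B -> C}) :
  alg_morphism f -> alg_morphism g -> injective f -> injective g ->
  (forall c, (exists x, f x = c) <-> (exists y, g y = c)) -> alg_isomorphic A B.
Proof.
move=> fS gS injf injg im.
have ex_phi x : exists y, g y = f x by apply/im; exists x.
have ex_psi y : exists x, f x = g y by apply/im; exists y.
pose phi x := projT1 (cid (ex_phi x)); pose psi y := projT1 (cid (ex_psi y)).
have phiE x : g (phi x) = f x := projT2 (cid (ex_phi x)).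
have psiE y : f (psi y) = g y := projT2 (cid (ex_psi y)).
have phiB : zmod_morphism phi by move=> x y; apply: injg; rewrite rmorphB !phiE rmorphB.
have phiM : monoid_morphism phi.
  by split=> [|x y]; apply: injg; rewrite ?rmorphM !phiE ?rmorphM ?rmorph1.
pose m1 := GRing.isZmodMorphism.Build _ _ phi phiB.
pose m2 := GRing.isMonoidMorphism.Build _ _ phi phiM.
pose h : {rmorphism A -> B} := HB.pack phi m1 m2.
exists h; split=> [a|]; first by apply: injg; rewrite phiE fS gS.
by exists psi => [x|y]; [apply: injf; rewrite psiE phiE|apply: injg; rewrite phiE psiE].
Qed.

(** * Endomorphisms of sums of Weyl modules *)

Section EndWeylSums.
Variables (F : fieldType) (q : F) (l : nat).
Hypotheses (q0 : q != 0) (hl : (3 <= l)%N) (hql : l.-primitive_root (q ^+ 2)).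
Variables (N : nat) (L : seq nat).
Hypotheses (LN : size L = N) (Ll : all (ltn^~ l) L).
Let e i := nth 0%N L i.

Lemma sum_wsin_wspr : \sum_(i < N) wsin q L i *m wspr q L i = 1%:M.
Proof. by case: N / LN; apply: wsin_wspr. Qed.

(** True for all sizes, so [wcoefM] needs no case distinction on the labels. *)
Lemma idmx_mul00 m n p : (idmx F m.+1 n.+1 *m idmx F n.+1 p.+1) ord0 ord0 = 1.
Proof.
rewrite mxE big_ord_recl big1 ?addr0 => [|i _]; first by rewrite !mxE /= mulr1.
by rewrite !mxE /= mul0r.
Qed.

Lemma ghom_idmx a b : a = b -> @ghom F (W q a) (W q b) (idmx F b.+1 a.+1).
Proof. by move=> ->; rewrite idmx1; apply: ghom1. Qed.

(** By Schur's lemma each block of an endomorphism is a multiple of [idmx]; its corner entry is the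
    scalar. *)
Definition wcoef (f : 'M[F]_(gdim (WS q L))) (i j : nat) : F :=
  (wspr q L i *m f *m wsin q L j) ord0 ord0.

Lemma wcoefE f i j : (i < N)%N -> (j < N)%N -> @ghom F (WS q L) (WS q L) f ->
  wspr q L i *m f *m wsin q L j = wcoef f i j *: idmx F (e i).+1 (e j).+1
  /\ (e j != e i -> wcoef f i j = 0).
Proof.
rewrite -LN => iN jN hf; have hij : @ghom F (W q (e j)) (W q (e i)) (wspr q L i *m f *m wsin q L j).
  apply: (@ghomM F (W q (e j)) (WS q L) (W q (e i))); last exact: ghom_wsin.
  by apply: (@ghomM F (WS q L) (WS q L) (W q (e i))) hf; apply: ghom_wspr.
have el i' : (i' < size L)%N -> (e i' < l)%N by move=> i'L; apply: (allP Ll); apply: mem_nth.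
have [E Z] := Schur_Weyl q0 hl hql (el j jN) (el i iN) hij; split=> // ne.
by rewrite /wcoef (Z ne) mxE.
Qed.

Lemma wcoefM f g (i j : 'I_N) : @ghom F (WS q L) (WS q L) f -> @ghom F (WS q L) (WS q L) g ->
  wcoef (f *m g) i j = \sum_(k < N) wcoef f i k * wcoef g k j.
Proof.
move=> hf hg; rewrite {1}/wcoef.
have -> : wspr q L i *m (f *m g) *m wsin q L j =
   \sum_(k < N) (wspr q L i *m f *m wsin q L k) *m (wspr q L k *m g *m wsin q L j).
  rewrite -[f in LHS]mulmx1 -sum_wsin_wspr mulmx_sumr mulmx_suml mulmx_sumr mulmx_suml.
  by apply: eq_bigr => k _; rewrite !mulmxA.
rewrite summxE; apply: eq_bigr => k _.
rewrite (wcoefE _ _ hf).1 // (wcoefE _ _ hg).1 // -scalemxAl -scalemxAr scalerA mxE.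
by rewrite idmx_mul00 mulr1.
Qed.

Lemma wcoef_eq0 f : @ghom F (WS q L) (WS q L) f ->
  (forall i j : 'I_N, wcoef f i j = 0) -> f = 0.
Proof.
move=> hf f0; rewrite -[f]mul1mx -[LHS]mulmx1 -sum_wsin_wspr mulmx_suml mulmx_suml.
apply: big1 => i _; rewrite mulmx_sumr; apply: big1 => j _.
transitivity (wsin q L i *m (wspr q L i *m f *m wsin q L j) *m wspr q L j).
  by rewrite !mulmxA.
by rewrite (wcoefE _ _ hf).1 // f0 scale0r mulmx0 mul0mx.
Qed.

Lemma wcoef_scalar a (i j : 'I_N) : wcoef a%:M i j = (a%:M : 'M_N) i j.
Proof.
rewrite /wcoef mul_mx_scalar -scalemxAl mxE [RHS]mxE.
have [<-|ij] := eqVneq i j; first by rewrite wspr_wsin ?LN // mxE eqxx mulr1 mulr1n.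
by rewrite wspr_wsin_neq // mxE mulr0 mulr0n.
Qed.

Lemma wcoef_surj (A : 'M[F]_N) : (forall i j : 'I_N, e j != e i -> A i j = 0) ->
  exists2 f, @ghom F (WS q L) (WS q L) f & forall i j : 'I_N, wcoef f i j = A i j.
Proof.
move=> A0; pose t (i j : 'I_N) : 'M_(gdim (WS q L)) :=
  A i j *: (wsin q L i *m idmx F (e i).+1 (e j).+1 *m wspr q L j).
exists (\sum_i \sum_j t i j).
  apply: big_ind => [|x y|i _]; [by move=> u; rewrite mul0mx mulmx0|exact: ghomD|].
  apply: big_ind => [|x y|j _]; [by move=> u; rewrite mul0mx mulmx0|exact: ghomD|].
  have [eij|ne] := eqVneq (e j) (e i); last first.
    by move=> u; rewrite /t A0 // scale0r mul0mx mulmx0.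
  apply: ghomZ; apply: (@ghomM F (WS q L) (W q (e j)) (WS q L)); last first.
    by apply: ghom_wspr; rewrite LN.
  apply: (@ghomM F (W q (e j)) (W q (e i)) (WS q L)); last exact: ghom_idmx.
  by apply: ghom_wsin; rewrite LN.
move=> i j; rewrite /wcoef.
have -> : wspr q L i *m (\sum_i \sum_j t i j) *m wsin q L j = A i j *: idmx F (e i).+1 (e j).+1.
  rewrite mulmx_sumr mulmx_suml (bigD1 i) //= [X in _ + X]big1 ?addr0; last first.
    move=> i' i'i; rewrite mulmx_sumr mulmx_suml big1 // => j' _.
    rewrite /t -scalemxAr -scalemxAl !mulmxA wspr_wsin_neq; last by rewrite eq_sym.
    by rewrite !mul0mx scaler0.
  rewrite mulmx_sumr mulmx_suml (bigD1 j) //= [X in _ + X]big1 ?addr0; last first.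
    move=> j' j'j; rewrite /t -scalemxAr -scalemxAl -!mulmxA wspr_wsin_neq //.
    by rewrite !mulmx0 scaler0.
  rewrite /t -scalemxAr -scalemxAl !mulmxA wspr_wsin ?LN // mul1mx -mulmxA.
  by rewrite wspr_wsin ?LN // mulmx1.
by rewrite !mxE /= mulr1.
Qed.

Lemma End_path_algebra (P : Uqmod q) : giso (gm P) (WS q L) ->
  exists f : {rmorphism End_Uq P -> 'M[F]_N}, [/\ alg_morphism f, injective f
    & forall A, (exists x, f x = A) <-> forall i j : 'I_N, e j != e i -> A i j = 0].
Proof.
move=> [h [h' [hh hh' h'h]]]; have hom' := ghom_inv hh hh' h'h.
pose conj (f : 'M[F]_(mdim P)) := h *m f *m h'.
have conj_hom (x : End_Uq P) : @ghom F (WS q L) (WS q L) (conj (End_val x)).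
  apply: (@ghomM F (WS q L) (gm P) (WS q L)) hom'; apply: ghomM hh _.
  by case: x => y /= /asboolP /(is_homP q0).
pose psi (x : End_Uq P) : 'M[F]_N := \matrix_(i, j) wcoef (conj (End_val x)) i j.
have psiB : zmod_morphism psi.
  move=> x y; apply/matrixP=> i j; rewrite !mxE /wcoef /conj /= mulmxBr mulmxBl mulmxBr mulmxBl.
  by rewrite !mxE.
have psiS a : psi (a%:S) = a%:M.
  apply/matrixP=> i j; rewrite mxE -wcoef_scalar; congr (wcoef _ i j).
  by rewrite /conj /= mul_mx_scalar -scalemxAl hh' scalemx1.
have psiM : monoid_morphism psi.
  split=> [|x y]; first by rewrite -[1](rmorph1 (scal : {rmorphism F -> End_Uq P})) psiS.
  apply/matrixP=> i j; rewrite !mxE -[conj _]/(conj (End_val x *m End_val y)).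
  have -> : conj (End_val x *m End_val y) = conj (End_val x) *m conj (End_val y).
    by rewrite /conj !mulmxA -[_ *m h' *m h]mulmxA h'h mulmx1.
  by rewrite wcoefM //; apply: eq_bigr => k _; rewrite !mxE.
pose m1 := GRing.isZmodMorphism.Build _ _ psi psiB.
pose m2 := GRing.isMonoidMorphism.Build _ _ psi psiM.
pose f : {rmorphism End_Uq P -> 'M[F]_N} := HB.pack psi m1 m2.
exists f; split=> [//||A].
  move=> x y /eqP; rewrite -subr_eq0 -raddfB => /eqP fxy; apply/eqP; rewrite -subr_eq0; apply/eqP.
  apply: val_inj; move: (x - y) fxy => z fz.
  have z0 : conj (End_val z) = 0.
    by apply: wcoef_eq0 => // i j; have := congr1 (fun A : 'M_N => A i j) fz; rewrite !mxE.
  transitivity (h' *m conj (End_val z) *m h); last by rewrite z0 mulmx0 mul0mx.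
  by rewrite /conj !mulmxA h'h mul1mx -mulmxA h'h mulmx1.
split=> [[x <-] i j ne|A0]; first by rewrite mxE; apply: (wcoefE _ _ (conj_hom x)).2.
have [g hg gA] := wcoef_surj A0.
have hx : h' *m g *m h \in @End_pred F q P.
  apply/asboolP/(is_homP q0); apply: (@ghomM F (gm P) (WS q L) (gm P)) hh.
  exact: (@ghomM F (WS q L) (WS q L) (gm P)) hom' hg.
exists (MkEnd hx); apply/matrixP=> i j; rewrite mxE -gA; congr (wcoef _ i j).
by rewrite /conj /= !mulmxA hh' mul1mx -mulmxA hh' mulmx1.
Qed.
End EndWeylSums.

Section Conclusion.
Variables (F : fieldType) (q : F) (l n : nat).
Hypotheses (q0 : q != 0) (hl : (3 <= l)%N) (hql : l.-primitive_root (q ^+ 2)).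

Lemma End_reduced_power (P : Uqmod q) : is_reduced_power l n P ->
  alg_isomorphic (End_Uq P) (Jones q l n).
Proof.
move=> redP; have [g [gS injg img]] := Jones_path_algebra q0 hl hql n.
have Ll : all (ltn^~ l) (path_ends l n).
  by apply/allP=> k kn; have /ltnW := allP (path_ends_small hl n) k kn.
have [f [fS injf imf]] := End_path_algebra q0 hl hql (size_map (head 0%N) (paths l n)) Ll
  (reduced_power_WS q0 hl hql redP).
apply: alg_isomorphic_same_image fS gS injf injg _ => A.
have ends (i : 'I_(size (paths l n))) : nth 0%N (path_ends l n) i = head 0%N (nth [::] (paths l n) i).
  by rewrite (nth_map [::]).
apply: iff_trans (imf A) _; apply: iff_trans _ (iff_sym (img A)); split=> H.
  move=> s t /(nthP [::])[i il <-] /(nthP [::])[j jl <-] ne.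
  rewrite -[i]/(val (Ordinal il)) -[j]/(val (Ordinal jl)) ent_nth.
  by apply: H; rewrite !ends.
move=> i j; rewrite !ends => ne; rewrite -[A i j]ent_nth.
by apply: H => //; apply: mem_nth.
Qed.
End Conclusion.

From mathcomp Require Import reals complex.
Local Open Scope complex_scope.

(** The first half shows that the second is not vacuous; the second holds whichever decompositions
    were chosen along the way. *)
Theorem proposition8p6 (R : realType) (q : R[i]) (l n : nat)
    (hq : q != 0) (hl : (3 <= l)%N) (hql : l.-primitive_root (q ^+ 2))
    (hn : (1 <= n)%N) :
  (exists P : Uqmod q, is_reduced_power l n P) /\
  (forall P : Uqmod q, is_reduced_power l n P ->
    alg_isomorphic (End_Uq P) (Jones q l n)).
Proof.
split; first exact: reduced_power_exists.
exact: End_reduced_power.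
Qed.
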